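(* If $f\in C_0^\infty(\mathbb{R}^n\setminus\{0\})^{L}$, i.e. $f$ is a smooth, compactly supported, $O(n)$-invariant function on $\mathbb{R}^n\setminus\{0\}$, then $$f(re_1)=\frac{\Gamma(1/2)}{2\pi^{n/2}}\int_{\mathbb{R}}\tilde f(\lambda)\,r^{i\lambda-n/2}\,\frac{\Gamma\left((-2i\lambda+n)/4\right)}{\Gamma\left(-(2i\lambda+(n-2))/2\right)}\,d\lambda .$$
   Context: $L=O(n)$ acts linearly on $\mathbb{R}^n$, $e_1=(1,0,\dots,0)$, and $r>0$. For an even function $f\in C_0^\infty(\mathbb{R}^n\setminus\{0\})$ and $\eta\in\mathbb{R}^{n-1}$ let $Tf(z,\eta)=\int_{\mathbb{R}^n}f(x)\,|\langle x,(1,\eta)\rangle|^{-(iz+n/2)}\,dx$, where $\langle\cdot,\cdot\rangle$ is the Euclidean inner product. The integral is well defined for $\operatorname{Im} z>n/2-1$ and continues to a meromorphic function of $z\in\mathbb{C}$ (with poles at $z=i(n/2-j)$, $j=1,2,\dots$), again denoted $Tf(z,\eta)$. For real $\lambda$ (except possibly $\lambda=0$) write $T_\lambda f(\eta)=Tf(\lambda,\eta)$. If $f$ is $O(n)$-invariant, $\tilde f$ is the function defined by $T_\lambda f(\eta)=\tilde f(\lambda)(1+|\eta|^2)^{-(i\lambda+n/2)/2}$ for $\eta\in\mathbb{R}^{n-1}$.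
   Formalization: The printed formula is corrected: the denominator is Γ(-(2iλ+(n-2))/4) instead of Γ(-(2iλ+(n-2))/2), and dλ is replaced by dλ/(2π); as printed, the integral diverges for every f ≠ 0. *)

(* Defs.v *)
From HB Require Import structures.
From mathcomp Require Import all_boot all_order all_algebra.
From mathcomp Require Export complex.
From mathcomp Require Import all_classical all_reals all_analysis.

Set Implicit Arguments.
Unset Strict Implicit.
Unset Printing Implicit Defensive.

Import Order.TTheory GRing.Theory Num.Theory.
Import numFieldNormedType.Exports.

Local Open Scope classical_set_scope.
Local Open Scope ring_scope.
Local Open Scope complex_scope.

Section lebesgue_Rn.
Variable R : realType.

Definition tuple_cons n (p : measurableTypeR R * n.-tuple (measurableTypeR R)) :
  n.+1.-tuple (measurableTypeR R) := [tuple of p.1 :: p.2].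

Lemma measurable_tuple_cons n : measurable_fun setT (@tuple_cons n).
Proof. exact: measurable_cons. Qed.

Section step.
Variables (n : nat)
  (mu : {sigma_finite_measure set (n.-tuple (measurableTypeR R)) -> \bar R}).

Definition lebesgue_step : set (n.+1.-tuple (measurableTypeR R)) -> \bar R :=
  pushforward (@lebesgue_measure R \x mu)%E (@tuple_cons n).

Let step0 : lebesgue_step set0 = 0%E.
Proof. by rewrite /lebesgue_step /pushforward preimage_set0 measure0. Qed.

Let step_ge0 A : (0 <= lebesgue_step A)%E.
Proof. by rewrite /lebesgue_step /pushforward; exact: measure_ge0. Qed.

Let step_sigma_additive : semi_sigma_additive lebesgue_step.
Proof.
move=> F mF tF mUF; rewrite /lebesgue_step /pushforward preimage_bigcup.
apply: measure_semi_sigma_additive.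
- by move=> k; rewrite -[X in measurable X]setTI; exact: measurable_tuple_cons.
- apply/trivIsetP => /= i j _ _ ij; rewrite -preimage_setI.
  by move/trivIsetP : tF => /(_ _ _ _ _ ij) ->//; rewrite preimage_set0.
- rewrite -preimage_bigcup -[X in measurable X]setTI.
  exact: measurable_tuple_cons.
Qed.

HB.instance Definition _ := isMeasure.Build _ _ _ lebesgue_step
  step0 step_ge0 step_sigma_additive.

Let measurable_thead : measurable_fun setT
  (fun x : n.+1.-tuple (measurableTypeR R) => thead x).
Proof. exact: measurable_tnth. Qed.

Let measurable_tail : measurable_fun setT
  (fun x : n.+1.-tuple (measurableTypeR R) => [tuple of behead x]).
Proof. exact: measurable_behead. Qed.

Let step_sigma_finite : sigma_finite setT lebesgue_step.
Proof.
have /sigma_finiteP[F [TF ndF Foo]] := sigma_finiteT (@lebesgue_measure R).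
have /sigma_finiteP[G [TG ndG Goo]] := sigma_finiteT mu.
exists (fun k => [set x | F k (thead x) /\ G k [tuple of behead x]]).
  rewrite predeqE => x; split => // _.
  have [i _ Fi] : (\bigcup_k F k) (thead x) by rewrite -TF.
  have [j _ Gj] : (\bigcup_k G k) [tuple of behead x] by rewrite -TG.
  exists (maxn i j) => //; split.
    by move: (thead x) Fi; exact/subsetPset/ndF/leq_maxl.
  by move: ([tuple of behead x] : n.-tuple _) Gj;
    exact/subsetPset/ndG/leq_maxr.
move=> k; have [mF ?] := Foo k; have [mG ?] := Goo k; split.
  have := measurableI _ _ (measurable_thead measurableT mF)
    (measurable_tail measurableT mG).
  by rewrite !setTI.
rewrite (_ : lebesgue_step _ = (@lebesgue_measure R \x mu)%E (F k `*` G k)).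
  by rewrite product_measure1E// lte_mul_pinfty// ge0_fin_numE.
rewrite /lebesgue_step /pushforward; congr (product_measure1 _ _ _).
apply/funext => -[x y] /=; congr (F k _ /\ G k _); exact/val_inj.
Qed.

HB.instance Definition _ := Measure_isSigmaFinite.Build _ _ _ lebesgue_step
  step_sigma_finite.

End step.

Fixpoint lebesgue_Rn n :
    {sigma_finite_measure set (n.-tuple (measurableTypeR R)) -> \bar R} :=
  match n with
  | 0 => dirac ([tuple] : 0.-tuple (measurableTypeR R))
  | k.+1 => lebesgue_step (lebesgue_Rn k)
  end.

End lebesgue_Rn.
Arguments lebesgue_Rn {R} n.

Section complex_analysis.
Variable R : realType.
Implicit Types (g : R[i] -> R[i]) (w z p : R[i]).

Definition cexp z : R[i] :=
  (expR (complex.Re z))%:C * (cos (complex.Im z) +i* sin (complex.Im z)).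

(* t ^ w for t > 0 *)
Definition rpow (t : R) w : R[i] := cexp (w * (ln t)%:C).

Definition cintegrable d (T : measurableType d) (mu : {measure set T -> \bar R})
    (D : set T) (f : T -> R[i]) : Prop :=
  mu.-integrable D (fun x => (complex.Re (f x))%:E) /\
  mu.-integrable D (fun x => (complex.Im (f x))%:E).

Definition cintegral d (T : measurableType d) (mu : {measure set T -> \bar R})
    (D : set T) (f : T -> R[i]) : R[i] :=
  (\int[mu]_(x in D) complex.Re (f x)) +i* (\int[mu]_(x in D) complex.Im (f x)).

Definition euler_integral w : R[i] :=
  cintegral (@lebesgue_measure R) (`]0, +oo[ : set R)
    (fun t : R => rpow t (w - 1) * (expR (- t))%:C).

(* Gamma w = Gamma (w + N) / (w (w + 1) ... (w + N - 1)), where N is large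
   enough for Euler's integral to converge at w + N; the poles get value 0. *)
Definition cGamma w : R[i] :=
  let N := (Num.truncn `|complex.Re w|).+1 in
  euler_integral (w + N%:R) / \prod_(k < N) (w + k%:R).

Definition analytic_at g p : Prop :=
  exists (a : nat -> R[i]) (e : R), 0 < e /\
    forall z, `|z - p| < e%:C ->
      (series (fun k => a k * (z - p) ^+ k) : nat -> R[i]^o) @ \oo
        --> (g z : R[i]^o).

(* Laurent expansion with finite principal part; g p itself is irrelevant. *)
Definition meromorphic_at g p : Prop :=
  exists (l : nat) (a : nat -> R[i]) (e : R), 0 < e /\
    forall z, z != p -> `|z - p| < e%:C ->
      (series (fun k => a k * (z - p) ^+ k) : nat -> R[i]^o) @ \oo
        --> ((z - p) ^+ l * g z : R[i]^o).

End complex_analysis.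

Section test_functions.
Variables (R : realType) (n : nat).

Fixpoint Ck_on (A : set 'rV[R]_n) (k : nat) (g : 'rV[R]_n -> R) : Prop :=
  match k with
  | 0 => forall x, A x -> {for x, continuous g}
  | k'.+1 => (forall x, A x -> {for x, continuous g}) /\
      forall i : 'I_n, (forall x, A x -> derivable g x 'e_i) /\
                       Ck_on A k' (fun x => 'D_('e_i) g x)
  end.

(* Elements of C_0^oo(R^n \ {0}), extended by 0 at the origin. *)
Definition test_function (f : 'rV[R]_n -> R[i]) : Prop :=
  (forall k, Ck_on (~` [set 0]) k (fun x => complex.Re (f x)) /\
             Ck_on (~` [set 0]) k (fun x => complex.Im (f x))) /\
  exists K : set 'rV[R]_n,
    [/\ compact K, ~ K 0 & forall x, ~ K x -> f x = 0].

(* x *m A^T is the row vector of A x. *)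
Definition orthogonal_invariant (f : 'rV[R]_n -> R[i]) : Prop :=
  forall A : 'M[R]_n, A *m A^T = 1%:M -> forall x, f (x *m A^T) = f x.

(* The norm of 'rV[R]_n in the library is the sup norm, hence dot x x is used
   for the square of the Euclidean norm. *)
Definition dot (x y : 'rV[R]_n) : R := \sum_(i < n) x 0 i * y 0 i.

End test_functions.

(* The dimension of the space is n = m.+1. *)
Section transform.
Variables (R : realType) (m : nat).
Implicit Types (f : 'rV[R]_m.+1 -> R[i]) (eta : 'rV[R]_m).

Definition one_row eta : 'rV[R]_m.+1 := row_mx (const_mx 1 : 'rV[R]_1) eta.

(* The value of rpow at 0 is immaterial: the hyperplane <x, (1, eta)> = 0 is
   negligible. *)
Definition T_integral f (z : R[i]) eta : R[i] :=
  cintegral (lebesgue_Rn m.+1) setT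
    (fun x : m.+1.-tuple (measurableTypeR R) =>
       let v : 'rV[R]_m.+1 := \row_j tnth x j in
       f v * rpow `|dot v (one_row eta)| (- ('i%C * z + m.+1%:R / 2))).

Definition T_pole (p : R[i]) : Prop :=
  exists j : nat, (0 < j)%N /\ p = 'i%C * (m.+1%:R / 2 - j%:R).

Definition is_T_continuation f eta (G : R[i] -> R[i]) : Prop :=
  [/\ forall z, m.+1%:R / 2 - 1 < complex.Im z -> G z = T_integral f z eta,
      forall p, meromorphic_at G p
    & forall p, ~ T_pole p -> analytic_at G p].

(* Off T_pole the continuation is unique, by the identity theorem. *)
Definition Tf f (z : R[i]) eta : R[i] :=
  xget (fun=> 0) [set G | is_T_continuation f eta G] z.

Definition is_tilde f (ftilde : R -> R[i]) : Prop :=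
  forall (lam : R) eta, lam != 0 ->
    Tf f lam%:C eta =
    ftilde lam * rpow (1 + dot eta eta) (- ('i%C * lam%:C + m.+1%:R / 2) / 2).

End transform.

(* Main.v *)
Require Import Defs.
From HB Require Import structures.
From mathcomp Require Import all_boot all_order all_algebra.
From mathcomp Require Import all_classical all_reals all_analysis.
From mathcomp Require Import measurable_realfun.
From mathcomp Require Import ring lra.
Import Order.TTheory GRing.Theory Num.Theory.
Import numFieldNormedType.Exports.
Set Implicit Arguments.
Unset Strict Implicit.
Unset Printing Implicit Defensive.
Local Open Scope classical_set_scope.
Local Open Scope ring_scope.
Local Open Scope complex_scope.

(** Write [n = m.+1], [F t = f (t e_0)] and [s = i z + n / 2]. By rotation
invariance (Householder reflections, [orthogonal_invariant_radial]) [f x] is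
[F |x|], and at [eta = 0] the factor [1 + |eta| ^ 2] disappears. Thus
[ftilde lam] is the value at [z = lam] of the continuation of
[A F s = int F |x| |x_0| ^ (- s) dx], and the inversion formula is a statement
about one function of one variable.

The integral [A F s] is computed by comparison with the Gaussian [g]. With
[M F w = int F (e ^ v) e ^ (w v) dv], the double integral of
[F (e ^ v) g (e ^ (- v) |x|) |x_0| ^ (- s)] over [v] and [x] equals
[M F (n - s) * A g s] by homogeneity, and it is symmetric in [F] and [g] because
[v] may be replaced by [ln |x| - v] ([radial_mellin]). Since [A g] and [M g] are
values of Euler's integral, and these are nonzero, for [Re s < 1]
[[
  A F s = 2 pi ^ (m / 2) * Gamma ((1 - s) / 2) / Gamma ((n - s) / 2)
            * M F (n - s)
]]
([radial_value]). That Gamma has no zeros follows from the recursion once it is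
known for arguments with a large real part, where the mass of Euler's integral
concentrates ([euler_large], [euler_neq0]).

The right-hand side makes sense for all [s] and is the continuation. Indeed [F]
vanishes near [0], so [t ^ (- 2 N) F t] is an equally good profile, and the same
formula, applied to it at [s - 2 N], presents the right-hand side on
[Re s < 1 + 2 N] as a product of linear factors times a convergent integral,
divided by linear factors ([continuedE]). Such an integral is
analytic by termwise integration of the exponential series
([analytic_integral]), and linear factors can be divided out of power series
([analytic_div_linear]). Two continuations agree at [lam != 0] by the identity
theorem along the line [Re z = lam], which contains no pole
([T_continuation_unique]).

At [z = lam] the factor [M F (n - s)] is the Fourier transform at [lam] of
[phi v = F (e ^ v) e ^ (n v / 2)], a function of class [C ^ 2] with bounded
support, and the Gamma factors cancel those of the inversion integral. What is
left is Fourier inversion for [phi] at [v = ln r]: the transform decays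
quadratically ([fourier_decay]), and with the damping [exp (- eps |lam|)] the
inversion integral becomes a Poisson integral of [phi], which tends to
[2 pi * phi v] as [eps] tends to [0] ([fourier_inversion]). *)

(** * The modulus and the exponential of a complex number *)

Section modulus.
Variable R : realType.
Implicit Types z w : R[i].

(** The library norm on [R[i]] takes values in [R[i]]; a modulus with values in
[R] lets all estimates be made between real numbers. *)
Definition cabs z : R := Num.sqrt (complex.Re z ^+ 2 + complex.Im z ^+ 2).

Lemma normcE z : `|z| = (cabs z)%:C.
Proof. exact: normc_def. Qed.

Lemma cabs_ge0 z : 0 <= cabs z. Proof. exact: sqrtr_ge0. Qed.

Lemma cabsM z w : cabs (z * w) = cabs z * cabs w.
Proof.
by apply: (@complexI R); rewrite rmorphM /= -!normcE normrM.
Qed.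

Lemma cabsD z w : cabs (z + w) <= cabs z + cabs w.
Proof. by rewrite -lecR rmorphD /= -!normcE ler_normD. Qed.

Lemma cabsN z : cabs (- z) = cabs z.
Proof. by apply: (@complexI R); rewrite -!normcE normrN. Qed.

Lemma cabsB z w : cabs (z - w) <= cabs z + cabs w.
Proof. by rewrite -[cabs w]cabsN cabsD. Qed.

Lemma cabs_real (x : R) : cabs x%:C = `|x|.
Proof. by rewrite /cabs /= expr0n addr0 sqrtr_sqr. Qed.

Lemma cabs0 : cabs 0 = 0.
Proof. by rewrite (cabs_real 0) normr0. Qed.

Lemma cabs1 : cabs 1 = 1.
Proof. by rewrite (cabs_real 1) normr1. Qed.

Lemma cabs_eq0 z : (cabs z == 0) = (z == 0).
Proof. by rewrite -(inj_eq (@complexI R)) -normcE normr_eq0. Qed.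

Lemma cabs_gt0 z : (0 < cabs z) = (z != 0).
Proof. by rewrite lt_def cabs_ge0 andbT cabs_eq0. Qed.

Lemma cabsX z k : cabs (z ^+ k) = cabs z ^+ k.
Proof. by elim: k => [|k IH]; rewrite ?cabs1// !exprS cabsM IH. Qed.

Lemma cabsV z : cabs z^-1 = (cabs z)^-1.
Proof.
have [->|z0] := eqVneq z 0; first by rewrite invr0 cabs0 invr0.
have c0 : cabs z != 0 by rewrite cabs_eq0.
by apply: (mulfI c0); rewrite -cabsM !mulfV// cabs1.
Qed.

Lemma cabs_i : cabs 'i%C = 1.
Proof. by rewrite /cabs /= expr0n expr1n add0r sqrtr1. Qed.

Lemma norm_Re_le z : `|complex.Re z| <= cabs z.
Proof. by rewrite /cabs -sqrtr_sqr ler_sqrt// ?lerDl ?addr_ge0 ?sqr_ge0. Qed.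

Lemma norm_Im_le z : `|complex.Im z| <= cabs z.
Proof. by rewrite /cabs -sqrtr_sqr ler_sqrt// ?lerDr ?addr_ge0 ?sqr_ge0. Qed.

Lemma complex_split z : z = (complex.Re z)%:C + 'i%C * (complex.Im z)%:C.
Proof. exact: complexE. Qed.

Lemma cabs_le z : cabs z <= `|complex.Re z| + `|complex.Im z|.
Proof.
rewrite {1}(complex_split z); apply: (le_trans (cabsD _ _)).
by rewrite cabsM cabs_i mul1r !cabs_real.
Qed.

Lemma ReD z w : complex.Re (z + w) = complex.Re z + complex.Re w.
Proof. by case: z w => [? ?] []. Qed.
Lemma ImD z w : complex.Im (z + w) = complex.Im z + complex.Im w.
Proof. by case: z w => [? ?] []. Qed.
Lemma ReN z : complex.Re (- z) = - complex.Re z.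
Proof. by case: z. Qed.
Lemma ImN z : complex.Im (- z) = - complex.Im z.
Proof. by case: z. Qed.
Lemma ReM z w : complex.Re (z * w) =
  complex.Re z * complex.Re w - complex.Im z * complex.Im w.
Proof. by case: z w => [? ?] []. Qed.
Lemma ImM z w : complex.Im (z * w) =
  complex.Re z * complex.Im w + complex.Im z * complex.Re w.
Proof. by case: z w => [? ?] []. Qed.
Lemma ReMr (x : R) z : complex.Re (x%:C * z) = x * complex.Re z.
Proof. by rewrite ReM /= mul0r subr0. Qed.
Lemma ImMr (x : R) z : complex.Im (x%:C * z) = x * complex.Im z.
Proof. by rewrite ImM /= mul0r addr0. Qed.
Definition ReIm := (ReD, ImD, ReN, ImN, ReM, ImM).

Lemma Re_nat k : complex.Re (k%:R : R[i]) = k%:R.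
Proof. by rewrite -(rmorph_nat (real_complex R)). Qed.
Lemma Im_nat k : complex.Im (k%:R : R[i]) = 0.
Proof. by rewrite -(rmorph_nat (real_complex R)). Qed.

Lemma cabs_nat k : cabs k%:R = k%:R.
Proof. by rewrite -(rmorph_nat (real_complex R)) cabs_real normr_nat. Qed.

Lemma complex_eqP z w :
  complex.Re z = complex.Re w -> complex.Im z = complex.Im w -> z = w.
Proof. by case: z w => [? ?] [? ?] /= -> ->. Qed.

Lemma Re_cexp z : complex.Re (cexp z) = expR (complex.Re z) * cos (complex.Im z).
Proof. by rewrite /cexp ReM /= mul0r subr0. Qed.

Lemma Im_cexp z : complex.Im (cexp z) = expR (complex.Re z) * sin (complex.Im z).
Proof. by rewrite /cexp ImM /= mul0r addr0. Qed.

Lemma cexpD z w : cexp (z + w) = cexp z * cexp w.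
Proof.
case: z w => [a b] [c d]; rewrite /cexp /= expRD cosD sinD.
by apply: complex_eqP; rewrite /= !mul0r !subr0 !addr0; ring.
Qed.

Lemma cexp0 : cexp 0 = 1 :> R[i].
Proof. by rewrite /cexp /= expR0 cos0 sin0 mul1r. Qed.

Lemma cexp_real (x : R) : cexp x%:C = (expR x)%:C.
Proof. by rewrite /cexp /= cos0 sin0 mulr1. Qed.

Lemma cabs_exp z : cabs (cexp z) = expR (complex.Re z).
Proof.
rewrite /cexp cabsM cabs_real ger0_norm ?expR_ge0//.
by rewrite /cabs /= cos2Dsin2 sqrtr1 mulr1.
Qed.

Lemma cexpX z k : cexp (z *+ k) = cexp z ^+ k.
Proof. by elim: k => [|k IH]; rewrite ?cexp0// mulrS cexpD IH exprS. Qed.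

Lemma ReZ z (x : R) : complex.Re (z * x%:C) = complex.Re z * x.
Proof. by rewrite ReM /= mulr0 subr0. Qed.
Lemma ImZ z (x : R) : complex.Im (z * x%:C) = complex.Im z * x.
Proof. by rewrite ImM /= mulr0 add0r. Qed.

Lemma cabs_rpow (t : R) w : cabs (rpow t w) = expR (complex.Re w * ln t).
Proof. by rewrite /rpow cabs_exp ReZ. Qed.

Lemma cvg_cabsP (u : nat -> R[i]) (l : R[i]) :
  (u : nat -> R[i]^o) @ \oo --> (l : R[i]^o) <->
  (fun n => cabs (u n - l)) @ \oo --> (0 : R).
Proof.
split.
  move=> /cvgrPdist_lt h; apply/cvgrPdist_lt => e e0.
  have e0' : 0 < e%:C by rewrite ltcR.
  near=> n; rewrite sub0r normrN ger0_norm ?cabs_ge0//.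
  have : `|l - u n| < e%:C by near: n; exact: h.
  by rewrite -normrN opprB normcE ltcR.
move=> /cvgrPdist_lt h; apply/cvgrPdist_lt => -[e e'].
rewrite ltcE /= => /andP[/eqP -> e0].
near=> n.
rewrite -normrN opprB normcE ltcR.
have : `|0 - cabs (u n - l)| < e by near: n; exact: h.
by rewrite sub0r normrN ger0_norm ?cabs_ge0.
Unshelve. all: by end_near. Qed.

Lemma cvg_ReIm (u : nat -> R[i]) (l : R[i]) :
  (fun n => complex.Re (u n)) @ \oo --> (complex.Re l : R) ->
  (fun n => complex.Im (u n)) @ \oo --> (complex.Im l : R) ->
  (u : nat -> R[i]^o) @ \oo --> (l : R[i]^o).
Proof.
move=> hR hI; apply/cvg_cabsP.
apply: (@squeeze_cvgr _ _ _ _ (fun=> 0)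
  (fun n => `|complex.Re (u n) - complex.Re l| +
            `|complex.Im (u n) - complex.Im l|)).
- near=> n; rewrite cabs_ge0/=; apply: (le_trans (cabs_le _)).
  by rewrite !ReIm.
- exact: cvg_cst.
- rewrite -[0]addr0; apply: cvgD; rewrite -[0](@normr0 R R);
    apply: cvg_norm; exact/subr_cvg0.
Unshelve. all: by end_near. Qed.

Lemma cvg_Re (u : nat -> R[i]) (l : R[i]) :
  (u : nat -> R[i]^o) @ \oo --> (l : R[i]^o) ->
  (fun n => complex.Re (u n)) @ \oo --> (complex.Re l : R).
Proof.
move=> /cvg_cabsP h; apply/subr_cvg0/norm_cvg0P.
apply: (@squeeze_cvgr _ _ _ _ (fun=> 0) (fun n => cabs (u n - l))) => //.
- near=> n; rewrite normr_ge0/=; apply: le_trans (norm_Re_le _).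
  by rewrite !ReIm.
- exact: cvg_cst.
Unshelve. all: by end_near. Qed.

Lemma cvg_Im (u : nat -> R[i]) (l : R[i]) :
  (u : nat -> R[i]^o) @ \oo --> (l : R[i]^o) ->
  (fun n => complex.Im (u n)) @ \oo --> (complex.Im l : R).
Proof.
move=> /cvg_cabsP h; apply/subr_cvg0/norm_cvg0P.
apply: (@squeeze_cvgr _ _ _ _ (fun=> 0) (fun n => cabs (u n - l))) => //.
- near=> n; rewrite normr_ge0/=; apply: le_trans (norm_Im_le _).
  by rewrite !ReIm.
- exact: cvg_cst.
Unshelve. all: by end_near. Qed.

End modulus.

#[global] Opaque cexp.

(** * Integration of complex-valued functions *)

Section complex_measurable.
Context d (T : measurableType d) (R : realType).
Implicit Types f g : T -> R[i].

Definition cmeas f : Prop :=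
  measurable_fun setT (fun x => complex.Re (f x)) /\
  measurable_fun setT (fun x => complex.Im (f x)).

Lemma cmeas_cst (c : R[i]) : cmeas (fun=> c).
Proof. by split; exact: measurable_cst. Qed.

Lemma cmeas_real (h : T -> R) : measurable_fun setT h ->
  cmeas (fun x => (h x)%:C).
Proof. by move=> mh; split => //=; exact: measurable_cst. Qed.

Lemma cmeasD f g : cmeas f -> cmeas g -> cmeas (fun x => f x + g x).
Proof.
move=> [f1 f2] [g1 g2]; split.
- by under eq_fun do rewrite ReD; exact: measurable_funD.
- by under eq_fun do rewrite ImD; exact: measurable_funD.
Qed.

Lemma cmeasN f : cmeas f -> cmeas (fun x => - f x).
Proof.
move=> [f1 f2]; split.
- by under eq_fun do rewrite ReN; exact: measurableT_comp.
- by under eq_fun do rewrite ImN; exact: measurableT_comp.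
Qed.

Lemma cmeasM f g : cmeas f -> cmeas g -> cmeas (fun x => f x * g x).
Proof.
move=> [f1 f2] [g1 g2]; split.
- under eq_fun do rewrite ReM.
  by apply: measurable_funB; exact: measurable_funM.
- under eq_fun do rewrite ImM.
  by apply: measurable_funD; exact: measurable_funM.
Qed.

Lemma cmeasX f k : cmeas f -> cmeas (fun x => f x ^+ k).
Proof.
move=> mf; elim: k => [|k IH]; first exact: cmeas_cst.
by under eq_fun do rewrite exprS; exact: cmeasM.
Qed.

Lemma cmeas_cexp f : cmeas f -> cmeas (fun x => cexp (f x)).
Proof.
move=> [f1 f2]; apply: cmeasM.
  by apply: cmeas_real; exact: (measurableT_comp (@measurable_expR R) f1).
have mcos := continuous_measurable_fun (@continuous_cos R).
have msin := continuous_measurable_fun (@continuous_sin R).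
by split => /=; [exact: (measurableT_comp mcos f2)|
  exact: (measurableT_comp msin f2)].
Qed.

Lemma cmeas_rpow (h : T -> R) w : measurable_fun setT h ->
  cmeas (fun x => rpow (h x) w).
Proof.
move=> mh; apply: cmeas_cexp; apply: cmeasM; first exact: cmeas_cst.
by apply: cmeas_real; exact: (measurableT_comp (@measurable_ln R) mh).
Qed.

Lemma measurable_cabs f : cmeas f -> measurable_fun setT (fun x => cabs (f x)).
Proof.
move=> [f1 f2]; have msqrt := continuous_measurable_fun (@sqrt_continuous R).
apply: (measurableT_comp msqrt).
by apply: measurable_funD; exact: measurable_funX.
Qed.

End complex_measurable.

Lemma cmeas_comp d d' (T : measurableType d) (T' : measurableType d')
    (R : realType) (f : T' -> R[i]) (h : T -> T') :
  cmeas f -> measurable_fun setT h -> cmeas (f \o h).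
Proof.
by move=> [f1 f2] mh; split;
  [exact: (measurableT_comp f1 mh)|exact: (measurableT_comp f2 mh)].
Qed.

Section complex_integral.
Context d (T : measurableType d) (R : realType)
  (mu : {measure set T -> \bar R}).
Implicit Types (f g : T -> R[i]) (h : T -> R).

Definition rintegrable h := mu.-integrable setT (EFin \o h).

Lemma rintegrable_le h (g : T -> R) : measurable_fun setT h -> rintegrable g ->
  (forall x, `|h x| <= g x) -> rintegrable h.
Proof.
move=> mh ig hg; apply: (le_integrable measurableT) ig.
  exact/measurable_EFinP.
by move=> x _ /=; rewrite lee_fin; exact: (le_trans (hg x) (ler_norm _)).
Qed.

Lemma rintegrable_ge0 h : measurable_fun setT h -> (forall x, 0 <= h x) ->
  (\int[mu]_x (h x)%:E < +oo)%E -> rintegrable h.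
Proof.
move=> mh h0 hoo; apply/integrableP; split; first exact/measurable_EFinP.
congr (_ < _)%E : hoo; apply: eq_integral => x _ /=.
by rewrite ger0_norm.
Qed.

Lemma rintegrableD h (g : T -> R) : rintegrable h -> rintegrable g ->
  rintegrable (fun x => h x + g x).
Proof.
move=> ih ig; rewrite /rintegrable.
have -> : EFin \o (fun x => h x + g x) = ((EFin \o h) \+ (EFin \o g))%E.
  by apply/funext => x /=; rewrite EFinD.
exact: integrableD.
Qed.

Lemma rintegrableZ (c : R) h : rintegrable h -> rintegrable (fun x => c * h x).
Proof.
move=> ih; rewrite /rintegrable.
have -> : EFin \o (fun x => c * h x) = (fun x => c%:E * (EFin \o h) x)%E.
  by apply/funext => x /=; rewrite EFinM.
exact: integrableZl.
Qed.

Lemma cintegrable_meas f : cintegrable mu setT f -> cmeas f.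
Proof.
by move=> [/measurable_int f1 /measurable_int f2]; split; exact/measurable_EFinP.
Qed.

Lemma cintegrable_le f (g : T -> R) : cmeas f -> rintegrable g ->
  (forall x, cabs (f x) <= g x) -> cintegrable mu setT f.
Proof.
move=> [f1 f2] ig fg; split; apply: (rintegrable_le _ ig) => // x.
- exact: le_trans (norm_Re_le _) (fg x).
- exact: le_trans (norm_Im_le _) (fg x).
Qed.

Lemma rintegrable_cabs f : cintegrable mu setT f ->
  rintegrable (fun x => cabs (f x)).
Proof.
move=> fi; have mf := cintegrable_meas fi.
have [f1 f2] := fi.
apply: (@rintegrable_le _ (fun x => `|complex.Re (f x)| + `|complex.Im (f x)|)).
- exact: measurable_cabs.
- by apply: rintegrableD; exact: integrable_norm.
- by move=> x; rewrite ger0_norm ?cabs_ge0 ?cabs_le.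
Qed.

Lemma cintegrable_domin f g : cmeas f -> cintegrable mu setT g ->
  (forall x, cabs (f x) <= cabs (g x)) -> cintegrable mu setT f.
Proof. by move=> mf /rintegrable_cabs ig; exact: cintegrable_le. Qed.

Lemma cintegrable_real h : rintegrable h ->
  cintegrable mu setT (fun x => (h x)%:C).
Proof. by move=> ih; split => //; exact: integrable0. Qed.

Lemma cintegrableD f g : cintegrable mu setT f -> cintegrable mu setT g ->
  cintegrable mu setT (fun x => f x + g x).
Proof.
move=> [f1 f2] [g1 g2]; split.
- by under eq_fun do rewrite ReD; exact: rintegrableD.
- by under eq_fun do rewrite ImD; exact: rintegrableD.
Qed.

Lemma cintegrableZ c f : cintegrable mu setT f ->
  cintegrable mu setT (fun x => c * f x).
Proof.
move=> fi; apply: (@cintegrable_le _ (fun x => cabs c * cabs (f x))).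
- by apply: cmeasM; [exact: cmeas_cst|exact: cintegrable_meas].
- by apply: rintegrableZ; exact: rintegrable_cabs.
- by move=> x; rewrite cabsM.
Qed.

Lemma eq_cintegral f g : (forall x, f x = g x) ->
  cintegral mu setT f = cintegral mu setT g.
Proof. by move=> fg; congr (cintegral mu setT _); exact/funext. Qed.

Lemma eq_cintegrable f g : (forall x, f x = g x) ->
  cintegrable mu setT f -> cintegrable mu setT g.
Proof. by move=> /funext ->. Qed.

Lemma cintegralD f g : cintegrable mu setT f -> cintegrable mu setT g ->
  cintegral mu setT (fun x => f x + g x) =
  cintegral mu setT f + cintegral mu setT g.
Proof.
move=> [f1 f2] [g1 g2]; apply: complex_eqP; rewrite !ReIm /=.
- under eq_Rintegral do rewrite ReD.
  by rewrite RintegralD.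
- under eq_Rintegral do rewrite ImD.
  by rewrite RintegralD.
Qed.

Lemma cintegralZ c f : cintegrable mu setT f ->
  cintegral mu setT (fun x => c * f x) = c * cintegral mu setT f.
Proof.
move=> [f1 f2]; apply: complex_eqP; rewrite !ReIm /=.
- under eq_Rintegral do rewrite ReM.
  rewrite RintegralB//; [|exact: rintegrableZ..].
  by rewrite !RintegralZl.
- under eq_Rintegral do rewrite ImM.
  rewrite RintegralD//; [|exact: rintegrableZ..].
  by rewrite !RintegralZl.
Qed.

Lemma cintegralB f g : cintegrable mu setT f -> cintegrable mu setT g ->
  cintegral mu setT (fun x => f x - g x) =
  cintegral mu setT f - cintegral mu setT g.
Proof.
move=> fi gi.
rewrite (@eq_cintegral _ (fun x => f x + (-1) * g x)); last first.
  by move=> x; rewrite mulN1r.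
rewrite cintegralD//; last exact: cintegrableZ.
by rewrite cintegralZ// mulN1r.
Qed.

Lemma cintegral_real h :
  cintegral mu setT (fun x => (h x)%:C) = (\int[mu]_x h x)%:C.
Proof.
apply: complex_eqP => //=.
by rewrite /Rintegral integral0.
Qed.

(** The real and the imaginary part are estimated separately, whence the
constant [2]. *)
Lemma cabs_cintegral_le f h : cintegrable mu setT f -> rintegrable h ->
  (forall x, cabs (f x) <= h x) ->
  cabs (cintegral mu setT f) <= 2 * \int[mu]_x h x.
Proof.
move=> [f1 f2] ih fh; apply: (le_trans (cabs_le _)) => /=.
have bnd k : rintegrable k -> (forall x, `|k x| <= h x) ->
    `|\int[mu]_x k x| <= \int[mu]_x h x.
  move=> ik kh; apply: (le_trans (le_normr_Rintegral _ ik)) => //.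
  by apply: le_Rintegral => //; exact: integrable_norm.
rewrite mulr_natl mulr2n; apply: lerD; apply: bnd => // x.
- exact: le_trans (norm_Re_le _) (fh x).
- exact: le_trans (norm_Im_le _) (fh x).
Qed.

Lemma cintegral_sum (I : Type) (s : seq I) (F : I -> T -> R[i]) :
  (forall i, cintegrable mu setT (F i)) ->
  cintegrable mu setT (fun x => \sum_(i <- s) F i x) /\
  cintegral mu setT (fun x => \sum_(i <- s) F i x) =
  \sum_(i <- s) cintegral mu setT (F i).
Proof.
move=> Fi; elim: s => [|i s [IH1 IH2]].
  have i0 := cintegrable_real (@integrable0 _ _ R mu setT).
  split.
    by apply: eq_cintegrable i0 => x; rewrite big_nil.
  rewrite big_nil (@eq_cintegral _ (fun=> 0%:C)) ?cintegral_real.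
    by rewrite /Rintegral integral0.
  by move=> x; rewrite big_nil.
split.
  by under eq_fun do rewrite big_cons; exact: cintegrableD.
under eq_fun do rewrite big_cons.
by rewrite cintegralD// IH2 big_cons.
Qed.

(** Integrals over a half-line become integrals over the whole space, for which
the other rules of integration are stated. *)
Lemma cintegral_patch (D : set T) f : measurable D ->
  let fD := fun x => if x \in D then f x else 0 in
  (cintegrable mu D f <-> cintegrable mu setT fD) /\
  cintegral mu D f = cintegral mu setT fD.
Proof.
move=> mD fD.
have patch (k : R[i] -> R) : k 0 = 0 ->
    (fun x => k (fD x)) = (fun x => k (f x)) \_ D.
  by move=> k0; apply/funext => x; rewrite patchE /fD; case: ifP.
have epatch (k : R[i] -> R) : k 0 = 0 ->
    (fun x => (k (fD x))%:E) = (EFin \o (fun x => k (f x))) \_ D.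
  by move=> k0; rewrite restrict_EFin -patch.
split.
  rewrite /cintegrable !epatch//; split=> -[i1 i2]; split.
  - exact: (integrable_mkcond _ mD).1 i1.
  - exact: (integrable_mkcond _ mD).1 i2.
  - exact: (integrable_mkcond _ mD).2 i1.
  - exact: (integrable_mkcond _ mD).2 i2.
apply: complex_eqP => /=; rewrite [LHS]Rintegral_mkcond.
- by rewrite -(patch (@complex.Re R)).
- by rewrite -(patch (@complex.Im R)).
Qed.

Lemma cintegral_ae (N : set T) f g : measurable N -> mu N = 0%E ->
  cmeas f -> cmeas g -> (forall x, ~ N x -> f x = g x) ->
  cintegral mu setT f = cintegral mu setT g /\
  (cintegrable mu setT g -> cintegrable mu setT f).
Proof.
move=> mN N0 [f1 f2] [g1 g2] fg.
have key (u v : T -> R) : measurable_fun setT u -> measurable_fun setT v ->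
    (forall x, ~ N x -> u x = v x) ->
    \int[mu]_x u x = \int[mu]_x v x /\ (rintegrable v -> rintegrable u).
  move=> mu_ mv uv.
  have ae : ae_eq mu setT (EFin \o u) (EFin \o v).
    exists N; split => // x /= xN; apply: contrapT => nx; apply: xN => _.
    by rewrite uv.
  split.
    congr fine; apply: ae_eq_integral => //; exact/measurable_EFinP.
  move=> /integrableP[_ iv]; apply/integrableP; split; first exact/measurable_EFinP.
  move: iv; congr (_ < _)%E; apply: ae_eq_integral => //; try by
    apply: measurableT_comp => //; exact/measurable_EFinP.
  by apply: filterS ae => x h Dx; congr abse; exact: (esym (h Dx)).
have [e1 i1] := key _ _ f1 g1 (fun x nx => congr1 (@complex.Re R) (fg x nx)).
have [e2 i2] := key _ _ f2 g2 (fun x nx => congr1 (@complex.Im R) (fg x nx)).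
split; first exact: complex_eqP.
by move=> [h1 h2]; split; [exact: i1|exact: i2].
Qed.

(** Dominated convergence, applied to the real and to the imaginary part. *)
Lemma cvg_cintegral (F : nat -> T -> R[i]) f h :
  (forall k, cmeas (F k)) -> cmeas f ->
  (forall x, (fun k => F k x : R[i]^o) @ \oo --> (f x : R[i]^o)) ->
  rintegrable h -> (forall k x, cabs (F k x) <= h x) ->
  (fun k => cintegral mu setT (F k) : R[i]^o) @ \oo -->
    (cintegral mu setT f : R[i]^o).
Proof.
move=> mF [f1 f2] Ff ih Fh.
have dct (u : nat -> T -> R) (v : T -> R) :
    (forall k, measurable_fun setT (u k)) -> measurable_fun setT v ->
    (forall x, (fun k => u k x) @ \oo --> v x) ->
    (forall k x, `|u k x| <= h x) ->
    (fun k => \int[mu]_x u k x) @ \oo --> (\int[mu]_x v x : R).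
  move=> mu_ mv uv uh.
  have [| | | | |iv _ c] := @dominated_convergence _ _ _ mu setT measurableT
    (fun k x => (u k x)%:E) (fun x => (v x)%:E) (fun x => (h x)%:E).
  - by move=> k; exact/measurable_EFinP.
  - exact/measurable_EFinP.
  - by apply: aeW => x _; apply: cvg_EFin; [exact: nearW|exact: uv].
  - exact: ih.
  - by apply: aeW => x k _; rewrite lee_fin; exact: uh.
  by apply/fine_cvg; rewrite /Rintegral fineK //; exact: integrable_fin_num.
apply: cvg_ReIm; apply: dct => //.
- by move=> k; have [] := mF k.
- by move=> x; exact: cvg_Re.
- by move=> k x; exact: le_trans (norm_Re_le _) (Fh k x).
- by move=> k; have [] := mF k.
- by move=> x; exact: cvg_Im.
- by move=> k x; exact: le_trans (norm_Im_le _) (Fh k x).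
Qed.

End complex_integral.

(** * Changes of variables and Fubini's theorem for complex integrands *)

Section transfer.
Context d d' (T : measurableType d) (T' : measurableType d') (R : realType).
Variables (mu : {measure set T -> \bar R}) (mu' : {measure set T' -> \bar R}).
Variables (phi : T -> T') (c : R).
Hypothesis mphi : measurable_fun setT phi.
Hypothesis c0 : 0 < c.

(** Every linear change of variables used below (translation, dilation,
reflection, splitting off one coordinate) has this form; stating it for
nonnegative functions makes it provable by Tonelli, and the lemmas of this
section then carry it to complex integrands. *)
Definition changes_measure : Prop :=
  forall g : T' -> \bar R, measurable_fun setT g -> (forall x, 0 <= g x)%E ->
  (\int[mu']_x g x = c%:E * \int[mu]_x g (phi x))%E.

Hypothesis H : changes_measure.

Lemma transfer_rintegrable (h : T' -> R) : measurable_fun setT h ->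
  rintegrable mu' h <-> rintegrable mu (h \o phi).
Proof.
move=> mh.
have mh' : measurable_fun setT (h \o phi) by exact: measurableT_comp.
have e : (\int[mu']_x `|(h x)%:E| = c%:E * \int[mu]_x `|(h (phi x))%:E|)%E.
  rewrite (H (g := fun x => `|(h x)%:E|%E))//.
  by apply: measurableT_comp => //; exact/measurable_EFinP.
split=> /integrableP[_ i]; apply/integrableP; split;
  try exact/measurable_EFinP.
- move: i; rewrite [X in (X < _)%E]e => i.
  rewrite ltNge; apply/negP; rewrite leye_eq => /eqP i'.
  by move: i; rewrite i' gt0_muley ?lte_fin// ltxx.
- by rewrite [X in (X < _)%E]e; apply: lte_mul_pinfty; rewrite ?lee_fin ?ltW.
Qed.

Lemma transfer_Rintegral (h : T' -> R) : rintegrable mu' h ->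
  \int[mu']_x h x = c * \int[mu]_x h (phi x).
Proof.
move=> ih.
have mh : measurable_fun setT h by move/measurable_int : ih => /measurable_EFinP.
have ih' := (transfer_rintegrable mh).1 ih.
have e : (\int[mu']_x (h x)%:E = c%:E * \int[mu]_x (h (phi x))%:E)%E.
  rewrite integralE [in RHS]integralE muleBr//; last first.
    exact: (integrable_add_def measurableT ih').
  rewrite (H (g := (fun x => (h x)%:E)^\+%E))//; last first.
    by apply: measurable_funepos; exact/measurable_EFinP.
  rewrite (H (g := (fun x => (h x)%:E)^\-%E))//; last first.
    by apply: measurable_funeneg; exact/measurable_EFinP.
  have ep := funepos_comp (fun x => (h x)%:E) phi.
  have en := funeneg_comp (fun x => (h x)%:E) phi.
  by congr (_ * _ - _ * _)%E; apply: eq_integral => x _;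
    [rewrite -[LHS]/((_ \o phi) x) -ep|rewrite -[LHS]/((_ \o phi) x) -en].
rewrite /Rintegral e fineM//; exact: (integrable_fin_num _ ih').
Qed.

Lemma transfer_cintegrable (f : T' -> R[i]) : cmeas f ->
  cintegrable mu' setT f <-> cintegrable mu setT (f \o phi).
Proof.
move=> [f1 f2]; split=> -[i1 i2]; split.
- exact/(transfer_rintegrable f1).
- exact/(transfer_rintegrable f2).
- exact/(transfer_rintegrable f1).
- exact/(transfer_rintegrable f2).
Qed.

Lemma transfer_cintegral (f : T' -> R[i]) : cintegrable mu' setT f ->
  cintegral mu' setT f = c%:C * cintegral mu setT (f \o phi).
Proof.
move=> [f1 f2]; apply: complex_eqP; rewrite ?ReMr ?ImMr /=.
- exact: transfer_Rintegral.
- exact: transfer_Rintegral.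
Qed.

End transfer.

(** If the measure is preserved, both sides also agree for a function that is
not integrable, since they then take the same default value. This allows the
fibres of a double integral to be transformed one by one, although only almost
every fibre is integrable. *)
Lemma transfer1_cintegral d d' (T : measurableType d) (T' : measurableType d')
    (R : realType) (mu : {measure set T -> \bar R})
    (mu' : {measure set T' -> \bar R}) (phi : T -> T') (f : T' -> R[i]) :
  changes_measure mu mu' phi 1 -> cmeas f ->
  cintegral mu' setT f = cintegral mu setT (f \o phi).
Proof.
move=> H [f1 f2].
have key (h : T' -> R) : measurable_fun setT h ->
    \int[mu']_x h x = \int[mu]_x h (phi x).
  move=> mh; rewrite /Rintegral integralE [in RHS]integralE.
  rewrite (H (fun x => (h x)%:E)^\+%E)//; last first.
    by apply: measurable_funepos; exact/measurable_EFinP.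
  rewrite (H (fun x => (h x)%:E)^\-%E)//; last first.
    by apply: measurable_funeneg; exact/measurable_EFinP.
  have ep := funepos_comp (fun x => (h x)%:E) phi.
  have en := funeneg_comp (fun x => (h x)%:E) phi.
  by rewrite !mul1e; congr (fine (_ - _)%E); apply: eq_integral => x _;
    [rewrite -[LHS]/((_ \o phi) x) -ep|rewrite -[LHS]/((_ \o phi) x) -en].
by apply: complex_eqP; [exact: (key _ f1)|exact: (key _ f2)].
Qed.

Section fubini_complex.
Context d1 d2 (T1 : measurableType d1) (T2 : measurableType d2) (R : realType).
Variables (m1 : {sigma_finite_measure set T1 -> \bar R})
  (m2 : {sigma_finite_measure set T2 -> \bar R}).
Local Notation m12 := (m1 \x m2)%E.

Lemma Rintegral_fubini1 (h : T1 * T2 -> R) : rintegrable m12 h ->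
  \int[m1]_x (\int[m2]_y h (x, y)) = \int[m12]_z h z.
Proof.
move=> ih; rewrite {1 3}/Rintegral -(integral12_prod_meas1 ih); congr fine.
have mF := measurable_fubini_F ih.
apply: ae_eq_integral => //.
- apply/measurable_EFinP; apply: (measurableT_comp (@fine_measurable R setT _)).
    exact: measurableT.
  exact: mF.
- have := ae_integrable1 ih; apply: filterS => x ix _ /=.
  by rewrite /Rintegral fineK//; exact: (integrable_fin_num _ ix).
Qed.

Lemma Rintegral_fubini2 (h : T1 * T2 -> R) : rintegrable m12 h ->
  \int[m2]_y (\int[m1]_x h (x, y)) = \int[m12]_z h z.
Proof.
move=> ih; rewrite {1 3}/Rintegral -(integral21_prod_meas1 ih); congr fine.
have mF := measurable_fubini_G ih.
apply: ae_eq_integral => //.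
- apply/measurable_EFinP; apply: (measurableT_comp (@fine_measurable R setT _)).
    exact: measurableT.
  exact: mF.
- have := ae_integrable2 ih; apply: filterS => x ix _ /=.
  by rewrite /Rintegral fineK//; exact: (integrable_fin_num _ ix).
Qed.

Lemma cintegral_fubini1 (f : T1 * T2 -> R[i]) : cintegrable m12 setT f ->
  cintegral m1 setT (fun x => cintegral m2 setT (fun y => f (x, y))) =
  cintegral m12 setT f.
Proof.
by move=> [f1 f2]; apply: complex_eqP;
  [exact: Rintegral_fubini1 f1|exact: Rintegral_fubini1 f2].
Qed.

Lemma cintegral_fubini2 (f : T1 * T2 -> R[i]) : cintegrable m12 setT f ->
  cintegral m2 setT (fun y => cintegral m1 setT (fun x => f (x, y))) =
  cintegral m12 setT f.
Proof.
by move=> [f1 f2]; apply: complex_eqP;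
  [exact: Rintegral_fubini2 f1|exact: Rintegral_fubini2 f2].
Qed.

Lemma cmeas_fubini2 (f : T1 * T2 -> R[i]) : cintegrable m12 setT f ->
  cmeas (fun y => cintegral m1 setT (fun x => f (x, y))).
Proof.
have key (h : T1 * T2 -> R) : rintegrable m12 h ->
    measurable_fun setT (fun y => \int[m1]_x h (x, y)).
  move=> ih; apply: (measurableT_comp (@fine_measurable R setT _)).
    exact: measurableT.
  exact: (measurable_fubini_G ih).
by move=> [f1 f2]; split; [exact: key f1|exact: key f2].
Qed.

Lemma cintegrable_tonelli1 (f : T1 * T2 -> R[i]) : cmeas f ->
  (\int[m1]_x \int[m2]_y (cabs (f (x, y)))%:E < +oo)%E ->
  cintegrable m12 setT f.
Proof.
move=> mf ioo; apply: (@cintegrable_le _ _ _ _ _ (fun z => cabs (f z))) => //.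
have mc : measurable_fun setT (EFin \o (fun z => cabs (f z))).
  by apply/measurable_EFinP; exact: measurable_cabs.
rewrite /rintegrable; apply/(@integrable12ltyP _ _ _ _ _ m1 m2 _ mc).
congr (_ < +oo)%E : ioo; apply: eq_integral => x _; apply: eq_integral => y _ /=.
by rewrite ger0_norm ?cabs_ge0.
Qed.

Lemma cintegral_prod (f : T1 -> R[i]) (g : T2 -> R[i]) :
  cintegrable m1 setT f -> cintegrable m2 setT g ->
  cintegrable m12 setT (fun z => f z.1 * g z.2) /\
  cintegral m12 setT (fun z => f z.1 * g z.2) =
  cintegral m1 setT f * cintegral m2 setT g.
Proof.
move=> fi gi.
have mf := cintegrable_meas fi; have mg := cintegrable_meas gi.
have mfg : cmeas (fun z : T1 * T2 => f z.1 * g z.2).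
  by apply: cmeasM; [exact: (cmeas_comp mf)|exact: (cmeas_comp mg)].
have ifg : cintegrable m12 setT (fun z => f z.1 * g z.2).
  apply: cintegrable_tonelli1 => //=.
  under eq_integral => x _.
    under eq_integral do rewrite cabsM EFinM.
    rewrite ge0_integralZl//; last 3 first.
    - by apply/measurable_EFinP; exact: measurable_cabs.
    - by move=> y _; rewrite lee_fin cabs_ge0.
    - by rewrite lee_fin cabs_ge0.
    over.
  rewrite ge0_integralZr//; last 3 first.
  - by apply/measurable_EFinP; exact: measurable_cabs.
  - by move=> y _; rewrite lee_fin cabs_ge0.
  - by apply: integral_ge0 => y _; rewrite lee_fin cabs_ge0.
  have /integrableP[_ i1] := rintegrable_cabs fi.
  have /integrableP[_ i2] := rintegrable_cabs gi.
  apply: lte_mul_pinfty.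
  - by apply: integral_ge0 => x _; rewrite lee_fin cabs_ge0.
  - rewrite ge0_fin_numE; last first.
      by apply: integral_ge0 => x _; rewrite lee_fin cabs_ge0.
    congr (_ < +oo)%E : i1; apply: eq_integral => x _ /=.
    by rewrite ger0_norm ?cabs_ge0.
  - congr (_ < +oo)%E : i2; apply: eq_integral => x _ /=.
    by rewrite ger0_norm ?cabs_ge0.
split => //.
rewrite -cintegral_fubini1//= mulrC -cintegralZ//.
by apply: eq_cintegral => x; rewrite cintegralZ// mulrC.
Qed.

End fubini_complex.

(** * Lebesgue measure on the line: substitutions and the fundamental theorem *)

Section lebesgue_line.
Variable R : realType.
Local Notation mu := (@lebesgue_measure R).
Local Notation mR := (measurableTypeR R).

Lemma measurable_affine (c b : R) :
  measurable_fun setT (fun x : mR => c * x + b : mR).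
Proof.
by apply: measurable_funD; [apply: measurable_funM|];
  [exact: measurable_cst|exact: measurable_id|exact: measurable_cst].
Qed.

(** Lebesgue measure is determined by its values on half-open intervals, so a
substitution need only be checked on preimages of intervals. *)
Lemma changes_measure_mscale (phi : mR -> mR) (c : R) (c0 : 0 < c) :
  measurable_fun setT phi ->
  (forall a b : R, a < b ->
     (c%:E * mu (phi @^-1` [set` `]a, b]%R]) = (b - a)%R%:E)%E) ->
  changes_measure mu mu phi c.
Proof.
move=> mphi H g mg g0.
pose nc : {nonneg R} := NngNum (ltW c0).
pose pushm : {measure set mR -> \bar R} := pushforward mu phi.
pose pm := pushm mphi.
transitivity (\int[mscale nc pm]_x g x)%E.
  apply: eq_measure_integral => A mA _.
  apply: (lebesgue_measure_unique (mu := mscale nc pm)) => // X.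
  move=> /ocitvP[->|[[a b] /= ab ->]]; first by rewrite !measure0.
  rewrite lebesgue_measure_itv /= lte_fin ab -EFinB.
  by rewrite /mscale /= /pushforward H.
by rewrite ge0_integral_mscale// ge0_integral_pushforward.
Qed.

Lemma changes_measure_affine (c b : R) : 0 < c ->
  changes_measure mu mu (fun x : mR => c * x + b : mR) c.
Proof.
move=> c0; apply: changes_measure_mscale => //; first exact: measurable_affine.
move=> u v uv.
have -> : (fun x : mR => c * x + b : mR) @^-1` `]u, v]%classic =
    `](u - b) / c, (v - b) / c]%classic.
  apply/seteqP; split=> x /=; rewrite !in_itv/= ltr_pdivrMr// ler_pdivlMr//;
    by rewrite [x * c]mulrC ltrBlDr lerBrDr.
rewrite lebesgue_measure_itv/= lte_fin ltr_pM2r ?invr_gt0// ltrD2r uv.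
by rewrite -EFinB -EFinM; congr EFin; field; rewrite gt_eqF.
Qed.

Lemma changes_measure_opp :
  changes_measure mu mu (fun x : mR => - x : mR) 1.
Proof.
apply: changes_measure_mscale => //; first exact: oppr_measurable.
move=> u v uv.
have -> : (fun x : mR => - x : mR) @^-1` `]u, v]%classic = `[- v, - u[%classic.
  by apply/seteqP; split=> x /=; rewrite !in_itv/= lerNl ltrNr andbC.
rewrite lebesgue_measure_itv/= lte_fin ltrN2 uv.
by rewrite -EFinB -EFinM; congr EFin; ring.
Qed.

(** A transform given by a meromorphic continuation is only known away from one
value of the spectral parameter; one point is a null set. *)
Lemma cintegral_off0 (f g : R -> R[i]) : (forall x, x != 0 -> f x = g x) ->
  cintegrable mu setT g ->
  cintegrable mu setT f /\ cintegral mu setT f = cintegral mu setT g.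
Proof.
move=> fg gi.
have m0 : measurable [set (0 : mR)] by exact: measurable_set1.
have [g1 g2] := cintegrable_meas gi.
have key (u v : mR -> R) : measurable_fun setT v ->
    (forall x, x != 0 -> u x = v x) -> measurable_fun setT u.
  move=> mv uv.
  have -> : u = fun x => v x + (u 0 - v 0) * \1_[set (0 : mR)] x.
    apply/funext => x; rewrite indicE.
    have [->|x0] := eqVneq x 0.
      by rewrite mem_set//= mulr1 addrCA subrr addr0.
    by rewrite memNset ?mulr0 ?addr0 ?uv//= => /eqP; rewrite (negPf x0).
  apply: measurable_funD => //.
  by apply: measurable_funM => //; exact: measurable_indic.
have mf : cmeas (f : mR -> R[i]).
  by split; [apply: key g1 _|apply: key g2 _] => x x0; rewrite fg.
have [||e i] := @cintegral_ae _ _ _ mu _ f g m0 (lebesgue_measure_set1 0) mf.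
- by split.
- by move=> x /eqP x0; exact: fg.
by split => //; exact: i.
Qed.

(** Nonnegative integrands come first because both sides are then monotone
limits over the compact intervals [[e^-n, e^n]] and [[-n, n]]. *)
Lemma ge0_integral_expR (g : R -> R) :
  (forall x, 0 < x -> {for x, continuous g}) -> (forall x, 0 < x -> 0 <= g x) ->
  (\int[mu]_(x in `]0%R, +oo[) (g x)%:E =
   \int[mu]_x (g (expR x) * expR x)%:E)%E.
Proof.
move=> cg g0.
have cge : continuous (fun x => g (expR x) * expR x).
  move=> x; apply: cvgM; last exact: continuous_expR.
  apply: (@continuous_comp _ _ _ (@expR R) g); first exact: continuous_expR.
  by apply: cg; exact: expR_gt0.
have dE : derive1 (@expR R) = @expR R.
  by apply/funext => x; rewrite derive1E derive_val.
pose E n : set mR := `[expR (- n%:R), expR n%:R]%classic.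
pose F n : set mR := `[- n%:R, n%:R]%classic.
have EF n : (\int[mu]_(x in E n) (g x)%:E =
             \int[mu]_(x in F n) (g (expR x) * expR x)%:E)%E.
  rewrite /E /F (@integration_by_substitution_increasing _ (@expR R) g).
  - by apply: eq_integral => x _; rewrite dE.
  - by rewrite lerNl (le_trans _ (ler0n _ n))// oppr_le0 ler0n.
  - by move=> x y _ _ xy; rewrite ltr_expR.
  - by rewrite dE => x _; exact: continuous_expR.
  - rewrite dE; apply/cvg_ex; exists (expR (- n%:R)).
    by apply: cvg_at_right_filter; exact: continuous_expR.
  - rewrite dE; apply/cvg_ex; exists (expR n%:R).
    by apply: cvg_at_left_filter; exact: continuous_expR.
  - split.
    + by move=> x _; exact: derivable_expR.
    + by apply: cvg_at_right_filter; exact: continuous_expR.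
    + by apply: cvg_at_left_filter; exact: continuous_expR.
  - apply: continuous_in_subspaceT => x /[!inE] /=; rewrite in_itv/= => /andP[h _].
    by apply: cg; apply: lt_le_trans h; exact: expR_gt0.
have UE : \bigcup_n E n = `]0, +oo[%classic.
  apply/seteqP; split => [x [n _]|x] /=; rewrite !in_itv/= ?andbT.
    by move=> /andP[]; rewrite bnd_simp => h _; apply: lt_le_trans h; exact: expR_gt0.
  move=> x0; exists (Num.truncn `|ln x|).+1 => //=.
  move: (ltW (truncnS_gt `|ln x|)); rewrite ler_norml => /andP[h1 h2].
  rewrite /E /= in_itv/=; apply/andP; split.
    by rewrite -[leRHS]lnK// ler_expR.
  by rewrite -[leLHS]lnK// ler_expR.
have UF : \bigcup_n F n = setT.
  apply/seteqP; split => // x _; exists (Num.truncn `|x|).+1 => //=.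
  by rewrite /F /= in_itv/= -ler_norml; apply: ltW; exact: truncnS_gt.
have cE : (\int[mu]_(x in E n) (g x)%:E)%E @[n --> \oo] -->
    (\int[mu]_(x in `]0%R, +oo[) (g x)%:E)%E.
  rewrite -UE; apply: ge0_nondecreasing_set_cvg_integral.
  - apply/nondecreasing_seqP => n; apply/subsetPset => x /=.
    rewrite /E /F /= !in_itv/= => /andP[h1 h2]; apply/andP; split.
      by apply: le_trans h1; rewrite ler_expR lerN2 ler_nat.
    by apply: (le_trans h2); rewrite ler_expR ler_nat.
  - by move=> n; exact: measurable_itv.
  - move=> n; apply/measurable_EFinP.
    apply: (@subspace_continuous_measurable_fun R (E n) g).
      exact: measurable_itv.
    apply: continuous_in_subspaceT => x /set_mem.
    rewrite /E /= in_itv/= => /andP[h _].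
    by apply: cg; apply: lt_le_trans h; exact: expR_gt0.
  - move=> n x; rewrite /E /= in_itv/= => /andP[h _].
    by rewrite lee_fin g0//; apply: lt_le_trans h; exact: expR_gt0.
have cF : (\int[mu]_(x in F n) (g (expR x) * expR x)%:E)%E @[n --> \oo] -->
    (\int[mu]_x (g (expR x) * expR x)%:E)%E.
  rewrite -UF; apply: ge0_nondecreasing_set_cvg_integral.
  - apply/nondecreasing_seqP => n; apply/subsetPset => x /=.
    rewrite /E /F /= !in_itv/= => /andP[h1 h2]; apply/andP; split.
      by apply: le_trans h1; rewrite lerN2 ler_nat.
    by apply: (le_trans h2); rewrite ler_nat.
  - by move=> n; exact: measurable_itv.
  - move=> n; apply/measurable_EFinP; apply: measurable_funTS.
    exact: continuous_measurable_fun.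
  - by move=> n x _; rewrite lee_fin mulr_ge0 ?expR_ge0// g0 ?expR_gt0.
rewrite -(cvg_lim _ cE)// -(cvg_lim _ cF)//.
by congr (limn _); apply/funext => n; exact: EF.
Qed.

Lemma Rintegral_expR (g : R -> R) :
  (forall x, 0 < x -> {for x, continuous g}) ->
  \int[mu]_(x in `]0, +oo[) g x = \int[mu]_x (g (expR x) * expR x).
Proof.
move=> cg; rewrite /Rintegral integralE [in RHS]integralE; congr (fine (_ - _)).
- transitivity (\int[mu]_(x in `]0%R, +oo[) (Num.max (g x) 0)%:E)%E.
    by apply: eq_integral => x _; rewrite funeposE EFin_max.
  rewrite ge0_integral_expR; last 2 first.
  + move=> x x0; apply: (@continuous_max _ _ g (cst 0) x); first exact: cg.
    exact: cst_continuous.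
  + by move=> x _; rewrite le_max lexx orbT.
  apply: eq_integral => x _; rewrite funeposE -EFin_max; congr EFin.
  by rewrite maxr_pMl ?expR_ge0// mul0r.
- transitivity (\int[mu]_(x in `]0%R, +oo[) (Num.max (- g x) 0)%:E)%E.
    by apply: eq_integral => x _; rewrite funenegE EFin_max.
  rewrite ge0_integral_expR; last 2 first.
  + move=> x x0; apply: (@continuous_max _ _ (fun y => - g y) (cst 0) x).
      by apply: cvgN; exact: cg.
    exact: cst_continuous.
  + by move=> x _; rewrite le_max lexx orbT.
  apply: eq_integral => x _; rewrite funenegE -EFinN -EFin_max; congr EFin.
  by rewrite maxr_pMl ?expR_ge0// mul0r mulNr.
Qed.

(** An improper form of the fundamental theorem of calculus in which the
integrability of the derivative replaces any sign condition. *)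
Lemma Rintegral_derive (G g : R -> R) (a b : nat -> R) (l : R) :
  (forall x : R, is_derive x (1 : R) G (g x)) -> continuous g ->
  (forall n, a n < b n) ->
  nondecreasing_seq (fun n => `[a n, b n]%classic : set R) ->
  mu.-integrable (\bigcup_n `[a n, b n]%classic) (EFin \o g) ->
  (fun n => G (b n) - G (a n)) @ \oo --> l ->
  \int[mu]_(x in \bigcup_n `[a n, b n]%classic) g x = l.
Proof.
move=> dG cg ab nd ig Gl.
set D := \bigcup_n _ in ig *.
have mD : measurable D.
  by apply: bigcupT_measurable => n; exact: measurable_itv.
have FTC n : \int[mu]_(x in `[a n, b n]) g x = G (b n) - G (a n).
  rewrite /Rintegral (@continuous_FTC2 _ g G)//.
  - exact: continuous_subspaceT.
  - have cG x : {for x, continuous G}.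
      by apply: differentiable_continuous; apply/derivable1_diffP; apply: ex_derive.
    split => [x _||].
    + exact: ex_derive.
    + by apply: cvg_at_right_filter; exact: cG.
    + by apply: cvg_at_left_filter; exact: cG.
  - by move=> x _; rewrite derive1E; apply: derive_val.
have gD : rintegrable mu (g \_ D).
  rewrite /rintegrable -restrict_EFin; exact: (@integrable_mkcond _ _ _ mu D (EFin \o g) mD).1.
have c : (fun n => G (b n) - G (a n)) @ \oo --> \int[mu]_(x in D) g x.
  under eq_fun do rewrite -FTC Rintegral_mkcond.
  rewrite Rintegral_mkcond.
  have mpatch (A : set R) : measurable A -> measurable_fun setT (g \_ A).
    move=> mA; apply/(measurable_restrictT _ _).1 => //.
    by apply: measurable_funTS; exact: continuous_measurable_fun.
  have := @cvg_cintegral _ _ _ mu (fun n x => ((g \_ `[a n, b n]) x)%:C)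
    (fun x => ((g \_ D) x)%:C) (fun x => `|(g \_ D) x|).
  move=> /(_ _ _ _ _ _)/cvg_Re.
  apply.
  - by move=> n; apply: cmeas_real; apply: mpatch; exact: measurable_itv.
  - by apply: cmeas_real; exact: mpatch.
  - move=> x; apply: cvg_ReIm => /=; last exact: cvg_cst.
    rewrite !patchE; case: ifPn => [/set_mem[N _ xN]|/negP xD].
      apply: cvg_near_cst; near=> n; rewrite patchE mem_set//.
      have : `[a N, b N]%classic `<=` (`[a n, b n]%classic : set R).
        by apply/subsetPset; apply: nd; near: n; exact: nbhs_infty_ge.
      exact.
    apply: cvg_near_cst; near=> n; rewrite patchE memNset// => xn; apply: xD.
    by apply: mem_set; exists n.
  - exact: integrable_norm.
  - move=> n x; rewrite cabs_real !patchE; case: ifPn => [/set_mem xn|_].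
      by rewrite mem_set//; exists n.
    by rewrite normr0.
by rewrite -(cvg_lim _ c)// -(cvg_lim _ Gl).
Unshelve. all: by end_near. Qed.

End lebesgue_line.

(** * Euler's integral in logarithmic form *)

Section log_integrals.
Variable R : realType.
Local Notation mu := (@lebesgue_measure R).
Local Notation mR := (measurableTypeR R).

Lemma cauchy_weight : rintegrable mu (fun v : R => (1 + v ^+ 2)^-1) /\
  \int[mu]_v (1 + v ^+ 2)^-1 = pi :> R.
Proof.
have c : continuous (fun v : R => (1 + v ^+ 2)^-1).
  exact: continuous_oneDsqrV.
have p0 (v : R) : 0 <= (1 + v ^+ 2)^-1.
  by rewrite invr_ge0 addr_ge0 ?sqr_ge0.
have e : (\int[mu]_v ((1 + v ^+ 2)^-1)%:E = (pi : R)%:E)%E.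
  rewrite ge0_symfun_integralT//; last by move=> v /=; rewrite sqrrN.
  rewrite (_ : [set x | _] = `[0, +oo[%classic); last first.
    by apply/seteqP; split => x/=; rewrite in_itv/= andbT.
  by rewrite (integral0y_oneDsqr R) -EFinM; congr EFin; field.
split; last by rewrite /Rintegral e.
apply: rintegrable_ge0 => //; first exact: continuous_measurable_fun.
by rewrite e ltry.
Qed.

(** The weight [1 / (1 + v ^ 2)] serves as the dominating function for
everything on the line: exponential decay and quadratic decay alike. *)
Lemma rintegrable_quadratic_decay (h : R -> R) (K : R) :
  measurable_fun setT (h : mR -> mR) ->
  (forall v, `|h v| <= K / (1 + v ^+ 2)) -> rintegrable mu h.
Proof.
move=> mh hK; apply: (rintegrable_le mh _ hK).
exact: (rintegrableZ K cauchy_weight.1).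
Qed.

(** The quadratic term of the exponential series already suffices:
[1 + (c v) ^ 2 / 2 <= exp (c |v|)]. *)
Lemma expRN_abs_le (c v : R) : 0 < c ->
  expR (- (c * `|v|)) <= (1 + 2 / c ^+ 2) / (1 + v ^+ 2).
Proof.
move=> c0; rewrite expRN.
have p1 : 0 < 1 + v ^+ 2 by rewrite ltr_pwDl// sqr_ge0.
rewrite ler_pdivlMr// mulrC ler_pdivrMr ?expR_gt0//.
have h := @expR_ge1Dxn R (c * `|v|) 1 (mulr_ge0 (ltW c0) (normr_ge0 v)).
have h2 : 1 + c ^+ 2 * v ^+ 2 / 2 <= expR (c * `|v|).
  by apply: le_trans h; rewrite exprMn real_normK ?num_real//.
have k0 : 0 <= 1 + 2 / c ^+ 2 by rewrite addr_ge0// divr_ge0// sqr_ge0.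
apply: le_trans (ler_wpM2l k0 h2).
rewrite [leRHS](_ : _ = 1 + v ^+ 2 + (c ^+ 2 * v ^+ 2 / 2 + 2 / c ^+ 2)).
  rewrite lerDl; apply: addr_ge0; apply: divr_ge0; rewrite ?sqr_ge0 ?ler0n//.
  by apply: mulr_ge0; exact: sqr_ge0.
by field; rewrite gt_eqF.
Qed.

Lemma rintegrable_expRN_abs (c : R) : 0 < c ->
  rintegrable mu (fun v : R => expR (- (c * `|v|))).
Proof.
move=> c0; apply: (@rintegrable_quadratic_decay _ (1 + 2 / c ^+ 2)).
  have m : measurable_fun setT (fun v : mR => c * `|v| : mR).
    by apply: measurable_funM; [exact: measurable_cst|exact: normr_measurable].
  exact: (measurableT_comp (@measurable_expR R) (measurable_funN m)).
by move=> v; rewrite ger0_norm ?expR_ge0// expRN_abs_le.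
Qed.

(** Euler's integrand after the substitution [t = exp v], which turns the
singularity at [t = 0] into exponential decay at [-oo]. *)
Definition euler_log (w : R[i]) (v : R) : R[i] := cexp (w * v%:C - (expR v)%:C).

Lemma cmeas_linear (w : R[i]) : cmeas (fun v : mR => w * v%:C).
Proof. by apply: cmeasM; [exact: cmeas_cst|exact: cmeas_real]. Qed.

Lemma cmeas_euler_log w : cmeas (euler_log w : mR -> R[i]).
Proof.
apply: cmeas_cexp; apply: cmeasD; first exact: cmeas_linear.
by apply: cmeasN; apply: cmeas_real; exact: measurable_expR.
Qed.

Lemma cabs_euler_log w v :
  cabs (euler_log w v) = expR (complex.Re w * v - expR v).
Proof. by rewrite cabs_exp ReD ReN ReZ. Qed.

(** For [v >= 0] the bound [exp v >= 1 + v ^ 2 / 2] absorbs [(1 + w) v] by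
completing the square; for [v < 0] the term [w v] decays by itself. *)
Lemma euler_log_decay (w v : R) : 0 < w ->
  w * v - expR v <= (1 + w) ^+ 2 / 2 - Num.min w 1 * `|v|.
Proof.
move=> w0; have h0 : 0 <= (1 + w) ^+ 2 / 2 by rewrite divr_ge0 ?sqr_ge0.
have [v0|v0] := leP 0 v.
  have h1 : expR v >= 1 + v ^+ 2 / 2.
    exact: (@expR_ge1Dxn R v 1 v0).
  have h2 : Num.min w 1 * v <= v.
    by rewrite -[leRHS]mul1r ler_wpM2r// ge_min lexx orbT.
  rewrite ger0_norm//.
  have h3 : 0 <= (v - (1 + w)) ^+ 2 by exact: sqr_ge0.
  nra.
have h1 : Num.min w 1 * `|v| <= w * `|v|.
  by rewrite ler_wpM2r// ge_min lexx.
have := expR_ge0 v.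
move: h1; rewrite ltr0_norm//; nra.
Qed.

Lemma cintegrable_euler_log w : 0 < complex.Re w ->
  cintegrable mu setT (euler_log w).
Proof.
move=> w0.
have c0 : 0 < Num.min (complex.Re w) 1 by rewrite lt_min w0 ltr01.
apply: (@cintegrable_le _ mR _ mu (euler_log w) (fun v => expR ((1 + complex.Re w) ^+ 2 / 2) *
  expR (- (Num.min (complex.Re w) 1 * `|v|)))).
- exact: cmeas_euler_log.
- by apply: rintegrableZ; exact: rintegrable_expRN_abs.
- by move=> v; rewrite cabs_euler_log -expRD ler_expR euler_log_decay.
Qed.

(** The substitution [x = exp v] turns Mellin integrals into integrals over the
whole line. *)
Lemma halfline_log (k : R -> R) (a : R[i]) : continuous k ->
  let f := fun x : R => rpow x a * (k x)%:C in
  let fl := fun v : R => cexp ((a + 1) * v%:C) * (k (expR v))%:C in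
  cintegral mu `]0, +oo[ f = cintegral mu setT fl /\
  (cintegrable mu setT fl -> cintegrable mu `]0, +oo[ f).
Proof.
move=> ck f fl.
have ReE x : complex.Re (f x) =
    expR (complex.Re a * ln x) * cos (complex.Im a * ln x) * k x.
  by rewrite /f /rpow ReZ Re_cexp ReZ ImZ.
have ImE x : complex.Im (f x) =
    expR (complex.Re a * ln x) * sin (complex.Im a * ln x) * k x.
  by rewrite /f /rpow ImZ Im_cexp ReZ ImZ.
have flE v : f (expR v) * (expR v)%:C = fl v.
  rewrite /f /fl /rpow expRK mulrDl cexpD mul1r cexp_real; ring.
have cln (b : R) x : 0 < x -> {for x, continuous (fun x => b * ln x)}.
  by move=> x0; apply: cvgM; [exact: cvg_cst|exact: continuous_ln].
have cexpln (b : R) x : 0 < x -> {for x, continuous (fun x => expR (b * ln x))}.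
  move=> x0; apply: continuous_comp; first exact: cln.
  exact: continuous_expR.
have cRe x : 0 < x -> {for x, continuous (fun x => complex.Re (f x))}.
  move=> x0; rewrite (_ : (fun x => _) = (fun x : R =>
    expR (complex.Re a * ln x) * cos (complex.Im a * ln x) * k x)).
    apply: cvgM; last exact: ck.
    apply: cvgM; first exact: cexpln.
    apply: (@continuous_comp _ _ _ (fun x => complex.Im a * ln x) (@cos R)).
      exact: cln.
    exact: continuous_cos.
  by apply/funext => y; rewrite ReE.
have cIm x : 0 < x -> {for x, continuous (fun x => complex.Im (f x))}.
  move=> x0; rewrite (_ : (fun x => _) = (fun x : R =>
    expR (complex.Re a * ln x) * sin (complex.Im a * ln x) * k x)).
    apply: cvgM; last exact: ck.
    apply: cvgM; first exact: cexpln.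
    apply: (@continuous_comp _ _ _ (fun x => complex.Im a * ln x) (@sin R)).
      exact: cln.
    exact: continuous_sin.
  by apply/funext => y; rewrite ImE.
split.
  apply: complex_eqP.
  - rewrite -[LHS]/(\int[mu]_(x in `]0, +oo[) complex.Re (f x)).
    rewrite -[RHS]/(\int[mu]_x complex.Re (fl x)) Rintegral_expR//.
    by apply: eq_Rintegral => v _; rewrite -flE ReZ.
  - rewrite -[LHS]/(\int[mu]_(x in `]0, +oo[) complex.Im (f x)).
    rewrite -[RHS]/(\int[mu]_x complex.Im (fl x)) Rintegral_expR//.
    by apply: eq_Rintegral => v _; rewrite -flE ImZ.
have key (g : R -> R) (gl : R -> R) :
    (forall x, 0 < x -> {for x, continuous g}) ->
    (forall v, g (expR v) * expR v = gl v) ->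
    rintegrable mu gl -> mu.-integrable `]0, +oo[ (EFin \o g).
  move=> cg ggl /integrableP[_ i]; apply/integrableP; split.
    apply/measurable_EFinP; apply: subspace_continuous_measurable_fun.
      exact: measurable_itv.
    by apply: continuous_in_subspaceT => x /set_mem /=; rewrite in_itv/= andbT;
      exact: cg.
  rewrite [X in (X < _)%E](_ : _ = \int[mu]_(x in `]0%R, +oo[) (`|g x|)%:E)%E//.
  rewrite ge0_integral_expR.
  - congr (_ < +oo)%E : i; apply: eq_integral => v _ /=.
    by rewrite -ggl normrM (ger0_norm (expR_ge0 v)).
  - move=> x x0; apply: (@continuous_comp _ _ _ g (fun y : R => `|y|)); first exact: cg.
    exact: norm_continuous.
  - by move=> x _; exact: normr_ge0.
move=> [i1 i2]; split.
- by apply: (key _ (fun v => complex.Re (fl v))) => // v; rewrite -flE ReZ.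
- by apply: (key _ (fun v => complex.Im (fl v))) => // v; rewrite -flE ImZ.
Qed.

Lemma euler_integralE w : euler_integral w = cintegral mu setT (euler_log w).
Proof.
have ck : continuous (fun t : R => expR (- t)).
  move=> t; apply: (@continuous_comp _ _ _ (@GRing.opp R) (@expR R)).
    exact: opp_continuous.
  exact: continuous_expR.
rewrite /euler_integral; have [-> _] := halfline_log (w - 1) ck.
apply: eq_cintegral => v.
by rewrite subrK /euler_log cexpD -cexp_real rmorphN.
Qed.

(** The dilation [v |-> 2 v] turns the Mellin transform of the Gaussian into
Euler's integral. *)
Lemma gauss_mellin w : 0 < complex.Re w ->
  let gl := fun v : R => (expR (- expR v ^+ 2))%:C * cexp (w * v%:C) in
  cintegrable mu setT gl /\ cintegral mu setT gl = euler_integral (w / 2) / 2.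
Proof.
move=> w0 gl.
have c2 : (0 : R) < 2 by [].
have Re2 : complex.Re (w / 2) = complex.Re w / 2.
  rewrite -(rmorph_nat (real_complex R)) /=.
  by rewrite -fmorphV /= ReZ.
have i2 : cintegrable mu setT (euler_log (w / 2)).
  by apply: cintegrable_euler_log; rewrite Re2 divr_gt0.
have glE v : gl v = euler_log (w / 2) (2 * v + 0).
  rewrite /gl /euler_log addr0 -cexp_real -cexpD addrC; congr cexp.
  congr (_ + _); last first.
    by rewrite rmorphN [2 * v]mulr_natl mulr2n expRD expr2.
  by rewrite rmorphM /= rmorph_nat; field.
have H := @changes_measure_affine R 2 0 c2.
have mphi := @measurable_affine R 2 0.
split.
  apply: (eq_cintegrable (f := euler_log (w / 2) \o (fun x : mR => 2 * x + 0))).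
    by move=> v; rewrite glE.
  exact: (transfer_cintegrable mphi c2 H (cmeas_euler_log _)).1.
rewrite euler_integralE (transfer_cintegral mphi c2 H i2).
rewrite rmorph_nat [2 * _]mulrC mulfK ?pnatr_eq0//.
by apply: eq_cintegral => v; rewrite glE.
Qed.

(** The Gaussian against a power of [|x|]: both half-lines contribute the same
integral, and each is a Mellin transform. *)
Lemma gauss_power s : complex.Re s < 1 ->
  let q := fun x : R => rpow `|x| (- s) * (expR (- x ^+ 2))%:C in
  cintegrable mu setT q /\ cintegral mu setT q = euler_integral ((1 - s) / 2).
Proof.
move=> s1 q.
have ck : continuous (fun t : R => expR (- t ^+ 2)).
  exact: continuous_gauss_fun.
have s1' : 0 < complex.Re (1 - s) by rewrite ReD ReN /= subr_gt0.
have [gi ge] := gauss_mellin s1'.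
have [he hi] := halfline_log (- s) ck.
set f := fun x : R => rpow x (- s) * (expR (- x ^+ 2))%:C in he hi.
have flE (v : R) : cexp ((- s + 1) * v%:C) * (expR (- expR v ^+ 2))%:C =
    (expR (- expR v ^+ 2))%:C * cexp ((1 - s) * v%:C).
  by rewrite mulrC [- s + 1]addrC.
have {}hi : cintegrable mu `]0, +oo[ f.
  by apply: hi; apply: eq_cintegrable gi => v; rewrite flE.
have {}he : cintegral mu `]0, +oo[ f = euler_integral ((1 - s) / 2) / 2.
  by rewrite he -ge; apply: eq_cintegral => v; rewrite flE.
have mD : measurable (`]0, +oo[%classic : set mR) by exact: measurable_itv.
have [pi pe] := cintegral_patch mu f mD.
pose q1 (x : R) : R[i] := if 0 < x then f x else 0.
have q1E : (fun x : mR => if x \in `]0, +oo[%classic then f x else 0) = q1.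
  apply/funext => x; rewrite /q1; congr (if _ then _ else _).
  by apply/idP/idP; rewrite inE /= in_itv/= andbT.
have q1i : cintegrable mu setT q1 by rewrite -q1E; exact/pi.
have q1e : cintegral mu setT q1 = euler_integral ((1 - s) / 2) / 2.
  by rewrite -he pe q1E.
have H := @changes_measure_opp R.
have mopp : measurable_fun setT (fun x : mR => - x : mR).
  exact: oppr_measurable.
have q1m := cintegrable_meas q1i.
have q2i := (transfer_cintegrable mopp ltr01 H q1m).1 q1i.
have q2e := transfer_cintegral mopp ltr01 H q1i.
have [qi qe] : cintegrable mu setT q /\ cintegral mu setT q =
    cintegral mu setT (fun x => q1 x + (q1 \o -%R) x).
  apply: cintegral_off0; last exact: cintegrableD.
  move=> x x0; rewrite /q1 /= /q /f oppr_gt0.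
  case: ltrgt0P x0 => // x0 _; first by rewrite addr0.
  by rewrite add0r sqrrN.
split; first exact: qi.
rewrite qe (cintegralD q1i q2i).
move: q2e; rewrite rmorph1 mul1r => <-; rewrite q1e.
by field.
Qed.

End log_integrals.

(** * Lebesgue measure on [R^n]: dilations and the Gaussian *)

Section lebesgue_space.
Variable R : realType.
Local Notation mu := (@lebesgue_measure R).
Local Notation mR := (measurableTypeR R).
Local Notation X n := (n.-tuple mR).

Lemma changes_measure_cons n :
  changes_measure (mu \x lebesgue_Rn n)%E (lebesgue_Rn n.+1)
    (@tuple_cons R n) 1.
Proof.
move=> g mg g0; rewrite mul1e.
exact: (ge0_integral_pushforward (@measurable_tuple_cons R n)).
Qed.

Definition dilate n (c : R) (x : X n) : X n := [tuple of map (fun t => c * t) x].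

Lemma measurable_dilate n c : measurable_fun setT (@dilate n c).
Proof.
apply/measurable_fun_tnthP => i.
have -> : (@tnth _ _)^~ i \o @dilate n c = fun x : X n => c * tnth x i.
  by apply/funext => x /=; rewrite tnth_map.
by apply: measurable_funM; [exact: measurable_cst|exact: measurable_tnth].
Qed.

Lemma dilate_cons n c (p : mR * X n) :
  dilate c (tuple_cons p) = tuple_cons (c * p.1, dilate c p.2).
Proof. exact/val_inj. Qed.

Lemma changes_measure_dilate n (c : R) : 0 < c ->
  changes_measure (lebesgue_Rn n) (lebesgue_Rn n) (@dilate n c) (c ^+ n).
Proof.
move=> c0; elim: n => [|n IH] g mg g0.
  rewrite expr0 mul1e; apply: eq_integral => x _.
  by rewrite [x]tuple0 [dilate _ _]tuple0.
have mc := @measurable_tuple_cons R n.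
have mgc : measurable_fun setT (g \o @tuple_cons R n).
  exact: measurableT_comp.
have mgd : measurable_fun setT (g \o @dilate n.+1 c).
  by apply: measurableT_comp => //; exact: measurable_dilate.
have mgdc : measurable_fun setT ((g \o @dilate n.+1 c) \o @tuple_cons R n).
  exact: measurableT_comp.
rewrite (@changes_measure_cons n)//.
rewrite [in RHS](@changes_measure_cons n (g \o @dilate n.+1 c))//; last first.
  by move=> x; exact: g0.
rewrite !mul1e.
rewrite (fubini_tonelli1 (g \o @tuple_cons R n))//; last first.
  by move=> x; exact: g0.
rewrite (fubini_tonelli1 ((g \o @dilate n.+1 c) \o @tuple_cons R n))//; last first.
  by move=> x; exact: g0.
rewrite (@changes_measure_affine R c 0 c0); last 2 first.
- by apply: measurable_fun_fubini_tonelli_F => // x; exact: g0.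
- by move=> x; apply: integral_ge0 => y _; exact: g0.
rewrite exprS EFinM -muleA; congr (_ * _)%E.
rewrite -ge0_integralZl//; last 3 first.
- by apply: (measurable_fun_fubini_tonelli_F
    ((g \o @dilate n.+1 c) \o @tuple_cons R n)) => // x; exact: g0.
- by move=> x _; apply: integral_ge0 => y _; exact: g0.
- by rewrite lee_fin exprn_ge0// ltW.
apply: eq_integral => x _; rewrite addr0.
rewrite /fubini_F (IH (fun y => g (tuple_cons (c * x, y)))).
- by congr (_ * _)%E; apply: eq_integral => y _; rewrite /= dilate_cons.
- apply: (measurableT_comp mgc).
  by apply: measurable_fun_pair => //; exact: measurable_cst.
- by move=> y; exact: g0.
Qed.

Definition sqnorm n (x : X n) : R := \sum_(i < n) tnth x i ^+ 2.

Lemma sqnorm_ge0 n (x : X n) : 0 <= sqnorm x.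
Proof. by apply: sumr_ge0 => i _; exact: sqr_ge0. Qed.

Lemma sqnorm_cons n (p : mR * X n) :
  sqnorm (tuple_cons p) = p.1 ^+ 2 + sqnorm p.2.
Proof.
rewrite /sqnorm big_ord_recl; congr (_ + _).
by apply: eq_bigr => i _; rewrite tnthS.
Qed.

Lemma sqnorm_dilate n c (x : X n) : sqnorm (dilate c x) = c ^+ 2 * sqnorm x.
Proof.
by rewrite /sqnorm mulr_sumr; apply: eq_bigr => i _; rewrite tnth_map exprMn.
Qed.

Lemma measurable_sqnorm n : measurable_fun setT (@sqnorm n : X n -> mR).
Proof.
apply: measurable_sum => i; apply: measurable_funX; exact: measurable_tnth.
Qed.

Lemma gauss_Rn n :
  (\int[lebesgue_Rn n]_x (expR (- sqnorm x))%:E = (Num.sqrt pi ^+ n : R)%:E)%E.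
Proof.
have mg k : measurable_fun setT (fun x : X k => (expR (- sqnorm x))%:E).
  apply/measurable_EFinP; apply: (measurableT_comp (@measurable_expR R)).
  exact: (measurable_funN (@measurable_sqnorm k)).
elim: n => [|n IH].
  rewrite expr0 integral_dirac//; last exact: mg.
  by rewrite diracE mem_set// mul1e /sqnorm big_ord0 oppr0 expR0.
rewrite (@changes_measure_cons n); last 2 first.
- exact: mg.
- by move=> x; rewrite lee_fin expR_ge0.
rewrite mul1e (fubini_tonelli1 (fun p => (expR (- sqnorm (tuple_cons p)))%:E))//=.
- rewrite /fubini_F.
  under eq_integral => x _.
    under eq_integral do rewrite sqnorm_cons /= opprD expRD EFinM.
    rewrite ge0_integralZl; last 4 first.
    + exact: measurableT.
    + exact: mg.
    + by move=> y _; rewrite lee_fin expR_ge0.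
    + by rewrite lee_fin expR_ge0.
    rewrite IH.
    over.
  rewrite ge0_integralZr; last 4 first.
  + exact: measurableT.
  + by apply/measurable_EFinP; exact: measurable_gauss_fun.
  + by move=> y _; rewrite lee_fin expR_ge0.
  + by rewrite lee_fin exprn_ge0// sqrtr_ge0.
  by rewrite integralT_gauss -EFinM exprS.
- exact: (measurableT_comp (mg n.+1) (@measurable_tuple_cons R n)).
Qed.

End lebesgue_space.

(** * Radial functions against a power of one coordinate *)

Section radial.
Variables (R : realType) (m : nat).
Local Notation mu := (@lebesgue_measure R).
Local Notation mR := (measurableTypeR R).
Local Notation X := (m.+1.-tuple mR).
Local Notation nu := (@lebesgue_Rn R m.+1).
Local Notation dim := (m.+1%:R : R[i]).
Implicit Types F : R -> R[i].

Definition enorm (x : X) : R := Num.sqrt (sqnorm x).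

(** For a radial function with profile [F] this is the defining integral of the
transform at [eta = 0], in the variable [s = i z + n / 2]. *)
Definition radial_term F s (x : X) : R[i] := F (enorm x) * rpow `|thead x| (- s).
Definition radial_integral F s : R[i] := cintegral nu setT (radial_term F s).

Definition mellin_term F w (v : R) : R[i] := F (expR v) * cexp (w * v%:C).
Definition mellin F w : R[i] := cintegral mu setT (mellin_term F w).

Definition gaussian (t : R) : R[i] := (expR (- t ^+ 2))%:C.

(** Domination by the Gaussian passes the integrability of its transforms on to
[F], for all exponents at once. *)
Definition gauss_dominated F : Prop :=
  cmeas (F : mR -> R[i]) /\
  exists C : R, forall t, cabs (F t) <= C * expR (- t ^+ 2).

Lemma cabs_gaussian t : cabs (gaussian t) = expR (- t ^+ 2).
Proof. by rewrite cabs_real ger0_norm ?expR_ge0. Qed.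

Lemma gauss_dominated_gaussian : gauss_dominated gaussian.
Proof.
split; first by apply: cmeas_real; exact: measurable_gauss_fun.
by exists 1 => t; rewrite mul1r cabs_gaussian.
Qed.

Lemma gauss_dominated_cabs F : gauss_dominated F ->
  gauss_dominated (fun t => (cabs (F t))%:C).
Proof.
move=> [mF [C FC]]; split; first by apply: cmeas_real; exact: measurable_cabs.
by exists C => t; rewrite cabs_real ger0_norm ?cabs_ge0.
Qed.

Lemma measurable_thead : measurable_fun setT (fun x : X => thead x : mR).
Proof. exact: measurable_tnth. Qed.

Lemma measurable_enorm : measurable_fun setT (enorm : X -> mR).
Proof.
have msqrt := continuous_measurable_fun (@sqrt_continuous R).
exact: (measurableT_comp msqrt (@measurable_sqnorm R m.+1)).
Qed.

Lemma cmeas_abs_power s : cmeas (fun x : X => rpow `|thead x| (- s)).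
Proof.
apply: cmeas_rpow.
exact: (measurableT_comp (@normr_measurable R setT) measurable_thead).
Qed.

Lemma cmeas_radial F s : cmeas (F : mR -> R[i]) -> cmeas (radial_term F s).
Proof.
move=> mF; apply: cmeasM; last exact: cmeas_abs_power.
exact: (cmeas_comp mF measurable_enorm).
Qed.

(** The Gaussian factors over the coordinates, so only the coordinate [x_0]
sees the exponent [s]. *)
Lemma radial_gaussian s : complex.Re s < 1 ->
  cintegrable nu setT (radial_term gaussian s) /\
  radial_integral gaussian s =
    euler_integral ((1 - s) / 2) * (Num.sqrt pi ^+ m)%:C.
Proof.
move=> s1; have [qi qe] := gauss_power s1.
have g0 (y : m.-tuple mR) : 0 <= expR (- sqnorm y) by exact: expR_ge0.
have mg : measurable_fun setT (fun y : m.-tuple mR => expR (- sqnorm y)).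
  apply: (measurableT_comp (@measurable_expR R)).
  exact: (measurable_funN (@measurable_sqnorm R m)).
have gi : rintegrable (@lebesgue_Rn R m) (fun y => expR (- sqnorm y)).
  apply: rintegrable_ge0; [exact: mg|exact: g0|].
  by rewrite gauss_Rn ltry.
have [fi fe] := cintegral_prod qi (cintegrable_real gi).
have mt := measurable_tuple_cons (R := R) (n := m).
have H := @changes_measure_cons R m.
have mr : cmeas (radial_term gaussian s).
  by apply: cmeas_radial; have [] := gauss_dominated_gaussian.
have E (z : mR * m.-tuple mR) : (radial_term gaussian s \o @tuple_cons R m) z =
    rpow `|z.1| (- s) * (expR (- z.1 ^+ 2))%:C * (expR (- sqnorm z.2))%:C.
  rewrite -[LHS]/(gaussian (enorm (tuple_cons z)) * rpow `|z.1| (- s)).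
  rewrite /gaussian /enorm sqr_sqrtr; last exact: sqnorm_ge0.
  by rewrite sqnorm_cons opprD expRD rmorphM mulrC mulrA.
have ri : cintegrable nu setT (radial_term gaussian s).
  apply/(transfer_cintegrable mt ltr01 H mr).
  by apply: eq_cintegrable fi => z; rewrite E.
split; first exact: ri.
rewrite /radial_integral (transfer_cintegral mt ltr01 H ri) rmorph1 mul1r.
rewrite (eq_cintegral _ E) fe qe; congr (_ * _).
by rewrite cintegral_real /Rintegral gauss_Rn.
Qed.

Lemma cintegrable_radial F s : gauss_dominated F -> complex.Re s < 1 ->
  cintegrable nu setT (radial_term F s).
Proof.
move=> [mF [C FC]] s1; have [gi _] := radial_gaussian s1.
apply: (cintegrable_domin (g := fun x => C%:C * radial_term gaussian s x)).
- exact: cmeas_radial.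
- exact: cintegrableZ.
move=> x; rewrite /radial_term; move: (rpow _ _) => p.
rewrite !cabsM cabs_real cabs_gaussian mulrA.
apply: ler_wpM2r; first exact: cabs_ge0.
apply: (le_trans (FC _)); apply: ler_wpM2r; first exact: expR_ge0.
exact: ler_norm.
Qed.

Lemma cintegrable_mellin F w : gauss_dominated F -> 0 < complex.Re w ->
  cintegrable mu setT (mellin_term F w).
Proof.
move=> [mF [C FC]] w0; have [gi _] := gauss_mellin w0.
apply: (@cintegrable_domin _ mR _ mu (mellin_term F w) (fun v => C%:C *
  ((expR (- expR v ^+ 2))%:C * cexp (w * v%:C)))).
- apply: cmeasM; first exact: (cmeas_comp mF (@measurable_expR R)).
  by apply: cmeas_cexp; exact: cmeas_linear.
- exact: cintegrableZ.
move=> v; rewrite /mellin_term; move: (cexp _) => p.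
rewrite !cabsM !cabs_real mulrA.
apply: ler_wpM2r; first exact: cabs_ge0.
apply: (le_trans (FC _)); rewrite (ger0_norm (expR_ge0 _)).
by apply: ler_wpM2r; [exact: expR_ge0|exact: ler_norm].
Qed.

Definition hyperplane : set X := [set x | thead x = 0].

Lemma measurable_hyperplane : measurable hyperplane.
Proof.
rewrite -[hyperplane]setTI.
exact: (measurable_thead measurableT (measurable_set1 (0 : mR))).
Qed.

Lemma hyperplane0 : nu hyperplane = 0%E.
Proof.
rewrite [LHS](_ : _ = (mu \x @lebesgue_Rn R m)%E ([set 0] `*` setT)).
  rewrite product_measure1E; last 2 first.
  - exact: (measurable_set1 (0 : mR)).
  - exact: measurableT.
  by rewrite [X in (X * _)%E](lebesgue_measure_set1 0) mul0e.
by congr (product_measure1 _ _ _); apply/seteqP; split => -[x y] /=;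
  [move=> h; split => //; exact: h|case=> h _; exact: h].
Qed.

Lemma enorm_gt0 (x : X) : ~ hyperplane x -> 0 < enorm x.
Proof.
move=> /eqP x0; rewrite sqrtr_gt0 /sqnorm big_ord_recl.
apply: ltr_wpDr; first by apply: sumr_ge0 => i _; rewrite sqr_ge0.
by rewrite lt_def sqr_ge0 andbT sqrf_eq0.
Qed.

Lemma enorm_dilate c (x : X) : 0 < c -> enorm (dilate c x) = c * enorm x.
Proof.
move=> c0; rewrite /enorm sqnorm_dilate sqrtrM ?sqr_ge0//.
by rewrite sqrtr_sqr gtr0_norm.
Qed.

Lemma thead_dilate c (x : X) : thead (dilate c x) = c * thead x.
Proof. by rewrite /thead tnth_map. Qed.

Definition stretched F s v (x : X) : R[i] :=
  F (expR (- v) * enorm x) * rpow `|thead x| (- s).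

Lemma cmeas_stretched F s v : cmeas (F : mR -> R[i]) -> cmeas (stretched F s v).
Proof.
move=> mF; apply: cmeasM; last exact: cmeas_abs_power.
apply: (cmeas_comp mF).
by apply: measurable_funM; [exact: measurable_cst|exact: measurable_enorm].
Qed.

(** The kernel [|x_0|^(-s)] is homogeneous of degree [- s] and Lebesgue measure
of degree [n]. *)
Lemma radial_stretched F s v : gauss_dominated F -> complex.Re s < 1 ->
  cintegrable nu setT (stretched F s v) /\
  cintegral nu setT (stretched F s v) =
    cexp ((dim - s) * v%:C) * radial_integral F s.
Proof.
move=> gF s1; have [mF _] := gF.
have c0 := expR_gt0 v; have cn0 := exprn_gt0 m.+1 c0.
have H := @changes_measure_dilate R m.+1 _ c0.
have md := @measurable_dilate R m.+1 (expR v).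
have ms := cmeas_stretched s v mF.
have mh : cmeas (fun x => cexp (- s * v%:C) * radial_term F s x).
  by apply: cmeasM; [exact: cmeas_cst|exact: cmeas_radial].
have ih : cintegrable nu setT (fun x => cexp (- s * v%:C) * radial_term F s x).
  by apply: cintegrableZ; exact: cintegrable_radial.
have [|e i] := @cintegral_ae _ _ _ nu hyperplane (stretched F s v \o dilate (expR v))
  (fun x => cexp (- s * v%:C) * radial_term F s x) measurable_hyperplane
  hyperplane0 (cmeas_comp ms md) mh.
  move=> x nx; rewrite /= /stretched /radial_term enorm_dilate// thead_dilate.
  rewrite [expR (- v) * _]mulrA -expRD addNr expR0 mul1r.
  rewrite [rpow _ _](_ : _ = cexp (- s * v%:C) * rpow `|thead x| (- s)).
    by rewrite mulrCA.
  rewrite /rpow normrM gtr0_norm// lnM ?posrE ?normr_gt0//; last exact/eqP.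
  by rewrite expRK rmorphD /= mulrDr cexpD.
have si : cintegrable nu setT (stretched F s v).
  by apply/(transfer_cintegrable md cn0 H ms); exact: i.
split => //.
rewrite (transfer_cintegral md cn0 H si) e cintegralZ; last exact: cintegrable_radial.
rewrite mulrA; congr (_ * _).
rewrite mulrBl -mulNr cexpD; congr (_ * _).
by rewrite -expRM_natl -cexp_real rmorphM /= rmorph_nat.
Qed.

Local Notation pm := (mu \x nu)%E.

(** Integrating out [v] gives the multiplicative convolution of [F1] and [F2] at
[|x|], times the kernel [|x_0|^(-s)]; a convolution is symmetric. *)
Definition kernel2 F1 F2 s (z : mR * X) : R[i] := F1 (expR z.1) * stretched F2 s z.1 z.2.

Lemma cmeas_kernel2 F1 F2 s : cmeas (F1 : mR -> R[i]) -> cmeas (F2 : mR -> R[i]) ->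
  cmeas (kernel2 F1 F2 s).
Proof.
move=> m1 m2; apply: cmeasM.
  apply: (cmeas_comp m1); exact: (measurableT_comp (@measurable_expR R)).
apply: cmeasM; last by apply: (cmeas_comp (cmeas_abs_power s)).
apply: (cmeas_comp m2); apply: measurable_funM.
  apply: (measurableT_comp (@measurable_expR R)).
  exact: (measurableT_comp (@oppr_measurable R setT)).
exact: (measurableT_comp measurable_enorm).
Qed.

Lemma Re_dimB (s : R[i]) : complex.Re (dim - s) = m.+1%:R - complex.Re s.
Proof. by rewrite ReD ReN Re_nat. Qed.

Lemma dimB_gt0 (s : R[i]) : complex.Re s < 1 -> 0 < complex.Re (dim - s).
Proof.
by move=> s1; rewrite Re_dimB subr_gt0 (lt_le_trans s1)// ler1n.
Qed.

Lemma kernel2_fubini F1 F2 s : gauss_dominated F1 -> gauss_dominated F2 ->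
  complex.Re s < 1 ->
  cintegrable pm setT (kernel2 F1 F2 s) /\
  cintegral pm setT (kernel2 F1 F2 s) = mellin F1 (dim - s) * radial_integral F2 s.
Proof.
move=> g1 g2 s1; have [m1 _] := g1; have [m2 _] := g2.
have inner v : cintegral nu setT (fun x => kernel2 F1 F2 s (v, x)) =
    radial_integral F2 s * mellin_term F1 (dim - s) v.
  rewrite /kernel2 /=; have [i e] := radial_stretched v g2 s1.
  by rewrite cintegralZ// e mulrA mulrC.
have ki : cintegrable pm setT (kernel2 F1 F2 s).
  apply: cintegrable_tonelli1; first exact: cmeas_kernel2.
  pose G1 t := (cabs (F1 t))%:C; pose G2 t := (cabs (F2 t))%:C.
  pose t : R[i] := (complex.Re s)%:C.
  have gG1 : gauss_dominated G1 := gauss_dominated_cabs g1.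
  have gG2 : gauss_dominated G2 := gauss_dominated_cabs g2.
  have absE v x : (cabs (kernel2 F1 F2 s (v, x)))%:C = G1 (expR v) * stretched G2 t v x.
    rewrite /kernel2 /stretched /G1 /G2 /= cabsM cabsM cabs_rpow ReN !rmorphM /=.
    by congr (_ * (_ * _)); rewrite /rpow -cexp_real /t rmorphM rmorphN.
  (* In modulus the kernel is that of the profiles [|F1|] and [|F2|] at the real
     exponent [Re s], so its iterated integral is again a product. *)
  have innerG v : (\int[nu]_x (cabs (kernel2 F1 F2 s (v, x)))%:E =
      (complex.Re (radial_integral G2 t * mellin_term G1 (dim - t) v))%:E)%E.
    have [i e] := radial_stretched v gG2 (s1 : complex.Re t < 1).
    have i' : cintegrable nu setT (fun x => (cabs (kernel2 F1 F2 s (v, x)))%:C).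
      by apply: eq_cintegrable (cintegrableZ (G1 (expR v)) i) => x; rewrite absE.
    have [ri _] := i'.
    transitivity ((\int[nu]_x cabs (kernel2 F1 F2 s (v, x)))%:E)%E.
      by rewrite /Rintegral fineK//; exact: (integrable_fin_num _ ri).
    congr EFin; apply: (@complexI R); rewrite -cintegral_real.
    rewrite (eq_cintegral _ (absE v)) cintegralZ// e.
    rewrite mulrA [_ * cexp _]mulrC -/(mellin_term _ _ _).
    have -> : cexp ((dim - t) * v%:C) * G1 (expR v) = mellin_term G1 (dim - t) v.
      by rewrite mulrC.
    rewrite mulrC; set z := _ * _.
    suff : complex.Im z = 0 by move=> z0; apply: complex_eqP.
    have r1 : complex.Im (mellin_term G1 (dim - t) v) = 0.
      rewrite /mellin_term /G1 ImMr Im_cexp ImZ ImD ImN Im_nat /= subr0 mul0r sin0.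
      by rewrite !mulr0.
    have r2 : complex.Im (radial_integral G2 t) = 0.
      rewrite /= /Rintegral integral0_eq// => x _.
      rewrite /radial_term /G2 ImMr /rpow Im_cexp ImZ ImN (_ : complex.Im t = 0)// oppr0 mul0r sin0.
      by rewrite !mulr0.
    by rewrite /z ImM r1 r2 mulr0 mul0r addr0.
  under eq_integral do rewrite innerG.
  have [ri _] := cintegrableZ (radial_integral G2 t)
    (cintegrable_mellin gG1 (dimB_gt0 (s1 : complex.Re t < 1))).
  exact: (integrable_lty measurableT ri).
split => //; rewrite -cintegral_fubini1// (eq_cintegral _ inner) cintegralZ.
  by rewrite mulrC.
by apply: cintegrable_mellin => //; exact: dimB_gt0.
Qed.

(** The substitution [v |-> ln |x| - v] exchanges the two profiles of a
multiplicative convolution. *)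
Lemma kernel2_sym F1 F2 s : gauss_dominated F1 -> gauss_dominated F2 ->
  complex.Re s < 1 ->
  cintegral pm setT (kernel2 F1 F2 s) = cintegral pm setT (kernel2 F2 F1 s).
Proof.
move=> g1 g2 s1; have [m1 _] := g1; have [m2 _] := g2.
have [i12 _] := kernel2_fubini g1 g2 s1; have [i21 _] := kernel2_fubini g2 g1 s1.
rewrite -(cintegral_fubini2 i12) -(cintegral_fubini2 i21).
have [|-> //] := @cintegral_ae _ _ _ nu hyperplane _ _ measurable_hyperplane
  hyperplane0 (cmeas_fubini2 i12) (cmeas_fubini2 i21).
move=> x /enorm_gt0 x0.
have mk : cmeas (fun v : mR => kernel2 F1 F2 s (v, x)).
  apply: (cmeas_comp (cmeas_kernel2 s m1 m2)).
  by apply: measurable_fun_pair => //; exact: measurable_cst.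
rewrite (transfer1_cintegral (@changes_measure_affine R 1 (ln (enorm x)) ltr01) mk).
rewrite (transfer1_cintegral (@changes_measure_opp R)); last first.
  exact: (cmeas_comp mk (measurable_affine _ _)).
have lk : expR (ln (enorm x)) = enorm x by rewrite lnK.
apply: eq_cintegral => v; rewrite /kernel2 /stretched /= mul1r.
rewrite opprD opprK !expRD [expR (- ln _)]expRN lk.
by rewrite -[expR v * _ * _]mulrA mulVf ?gt_eqF// mulr1 mulrCA.
Qed.

(** Comparison with the Gaussian determines the radial integral of every
profile: both sides of the identity are one double integral. *)
Lemma radial_mellin F s : gauss_dominated F -> complex.Re s < 1 ->
  mellin gaussian (dim - s) * radial_integral F s =
  mellin F (dim - s) * radial_integral gaussian s.
Proof.
move=> gF s1; have gg := gauss_dominated_gaussian.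
have [_ <-] := kernel2_fubini gg gF s1; have [_ <-] := kernel2_fubini gF gg s1.
exact: kernel2_sym.
Qed.

End radial.

(** * The Gamma function: recursion and absence of zeros *)

Section complex_derivative.
Variable R : realType.
Local Notation mu := (@lebesgue_measure R).
Local Notation mR := (measurableTypeR R).
Implicit Types G g L l : R -> R[i].

(** Componentwise, so that real calculus applies to both parts. *)
Definition cderiv G g : Prop := forall x : R,
  is_derive x (1 : R) (fun y => complex.Re (G y)) (complex.Re (g x)) /\
  is_derive x (1 : R) (fun y => complex.Im (G y)) (complex.Im (g x)).

Definition ccontinuous g : Prop :=
  continuous (fun x => complex.Re (g x)) /\ continuous (fun x => complex.Im (g x)).

Lemma is_derive_continuous (h : R -> R) (x d : R) :
  is_derive x (1 : R) h d -> {for x, continuous h}.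
Proof.
move=> hd; apply: differentiable_continuous; apply/derivable1_diffP.
exact: ex_derive.
Qed.

Lemma cderiv_continuous G g : cderiv G g -> ccontinuous G.
Proof. by move=> dG; split=> x; have [d1 d2] := dG x; exact: is_derive_continuous. Qed.

Lemma ccontinuous_cst (c : R[i]) : ccontinuous (fun=> c).
Proof. by split=> x; exact: cst_continuous. Qed.

Lemma ccontinuousD G g : ccontinuous G -> ccontinuous g ->
  ccontinuous (fun x => G x + g x).
Proof.
move=> [G1 G2] [g1 g2]; split=> x.
- by under eq_fun do rewrite ReD; apply: cvgD; [exact: G1|exact: g1].
- by under eq_fun do rewrite ImD; apply: cvgD; [exact: G2|exact: g2].
Qed.

Lemma ccontinuousM G g : ccontinuous G -> ccontinuous g ->
  ccontinuous (fun x => G x * g x).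
Proof.
move=> [G1 G2] [g1 g2]; split=> x.
- under eq_fun do rewrite ReM.
  by apply: cvgB; apply: cvgM; [exact: G1|exact: g1|exact: G2|exact: g2].
- under eq_fun do rewrite ImM.
  by apply: cvgD; apply: cvgM; [exact: G1|exact: g2|exact: G2|exact: g1].
Qed.

Lemma ccontinuous_real (h : R -> R) : continuous h ->
  ccontinuous (fun x => (h x)%:C).
Proof. by move=> ch; split => //= x; exact: cst_continuous. Qed.

Lemma ccontinuous_cmeas g : ccontinuous g -> cmeas (g : mR -> R[i]).
Proof. by move=> [g1 g2]; split; exact: continuous_measurable_fun. Qed.

Lemma cderiv_ext G g g' : (forall x, g x = g' x) -> cderiv G g -> cderiv G g'.
Proof. by move=> gg' dG x; rewrite -gg'; exact: dG. Qed.

Lemma cderiv_linear (c : R[i]) : cderiv (fun x => c * x%:C) (fun=> c).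
Proof.
move=> x; split.
- under eq_fun do rewrite ReZ.
  by apply: is_derive_eq; rewrite /GRing.scale /= mulr1.
- under eq_fun do rewrite ImZ.
  by apply: is_derive_eq; rewrite /GRing.scale /= mulr1.
Qed.

Lemma cderiv_real (h h' : R -> R) : (forall x : R, is_derive x (1 : R) h (h' x)) ->
  cderiv (fun x => (h x)%:C) (fun x => (h' x)%:C).
Proof. by move=> dh x; split => //=; exact: is_derive_cst. Qed.

Lemma cderivD G g L l : cderiv G g -> cderiv L l ->
  cderiv (fun x => G x + L x) (fun x => g x + l x).
Proof.
move=> dG dL x; have [G1 G2] := dG x; have [L1 L2] := dL x; split.
- by under eq_fun do rewrite ReD; rewrite ReD; exact: is_deriveD.
- by under eq_fun do rewrite ImD; rewrite ImD; exact: is_deriveD.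
Qed.

Lemma cderivN G g : cderiv G g -> cderiv (fun x => - G x) (fun x => - g x).
Proof.
move=> dG x; have [G1 G2] := dG x; split.
- by under eq_fun do rewrite ReN; rewrite ReN; exact: is_deriveN.
- by under eq_fun do rewrite ImN; rewrite ImN; exact: is_deriveN.
Qed.

Lemma cderivM G g L l : cderiv G g -> cderiv L l ->
  cderiv (fun x => G x * L x) (fun x => g x * L x + G x * l x).
Proof.
move=> dG dL x; have [G1 G2] := dG x; have [L1 L2] := dL x; split.
- under eq_fun do rewrite ReM.
  by apply: is_derive_eq; rewrite /GRing.scale /= !ReIm; ring.
- under eq_fun do rewrite ImM.
  by apply: is_derive_eq; rewrite /GRing.scale /= !ReIm; ring.
Qed.

Lemma cderiv_cexp L l : cderiv L l ->
  cderiv (fun x => cexp (L x)) (fun x => l x * cexp (L x)).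
Proof.
move=> dL x; have [L1 L2] := dL x.
have dcmp (h : R -> R) (h' : R) (k : R -> R) (k' : R) :
    is_derive (k x) (1 : R) h h' -> is_derive x (1 : R) k k' ->
    is_derive x (1 : R) (fun y => h (k y)) (h' * k').
  by move=> dh dk; exact: (@is_derive1_comp _ h k x h' k').
have de := dcmp _ _ _ _ (is_derive_expR (complex.Re (L x))) L1.
have dc := dcmp _ _ _ _ (is_derive_cos (complex.Im (L x))) L2.
have ds := dcmp _ _ _ _ (is_derive_sin (complex.Im (L x))) L2.
split.
- under eq_fun do rewrite Re_cexp.
  by apply: is_derive_eq; rewrite /GRing.scale /= ReM Re_cexp Im_cexp; ring.
- under eq_fun do rewrite Im_cexp.
  by apply: is_derive_eq; rewrite /GRing.scale /= ImM Re_cexp Im_cexp; ring.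
Qed.

Lemma cintegral_derive G g (a b : nat -> R) (l : R[i]) :
  cderiv G g -> ccontinuous g -> (forall n, a n < b n) ->
  nondecreasing_seq (fun n => `[a n, b n]%classic : set R) ->
  cintegrable mu (\bigcup_n `[a n, b n]%classic) g ->
  (fun n => G (b n) - G (a n) : R[i]^o) @ \oo --> (l : R[i]^o) ->
  cintegral mu (\bigcup_n `[a n, b n]%classic) g = l.
Proof.
move=> dG [c1 c2] ab nd [i1 i2] Gl; apply: complex_eqP.
- apply: (Rintegral_derive (G := fun x => complex.Re (G x))) => //.
  + by move=> x; have [] := dG x.
  + by have := cvg_Re Gl; under eq_fun do rewrite ReD ReN.
- apply: (Rintegral_derive (G := fun x => complex.Im (G x))) => //.
  + by move=> x; have [] := dG x.
  + by have := cvg_Im Gl; under eq_fun do rewrite ImD ImN.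
Qed.

Lemma bigcup_symmetric :
  \bigcup_n `[- n.+1%:R, n.+1%:R]%classic = setT :> set R.
Proof.
apply/seteqP; split => // x _; exists (Num.truncn `|x|) => //=.
by rewrite in_itv/= -ler_norml; apply: ltW; exact: truncnS_gt.
Qed.

Lemma cintegral_derive0 G g : cderiv G g -> ccontinuous g ->
  cintegrable mu setT g ->
  (fun n : nat => cabs (G n.+1%:R)) @ \oo --> (0 : R) ->
  (fun n : nat => cabs (G (- n.+1%:R))) @ \oo --> (0 : R) ->
  cintegral mu setT g = 0.
Proof.
move=> dG cg ig Gp Gm.
rewrite -[X in cintegral _ X]bigcup_symmetric.
apply: (cintegral_derive (a := fun n => - n.+1%:R) (b := fun n => n.+1%:R) dG cg).
- by move=> n; rewrite (lt_trans (y := 0)) ?oppr_lt0 ?ltr0n.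
- apply/nondecreasing_seqP => n; apply/subsetPset => x /=.
  rewrite !in_itv/= => /andP[h1 h2]; apply/andP; split.
    by apply: le_trans h1; rewrite lerN2 ler_nat.
  by apply: (le_trans h2); rewrite ler_nat.
- by rewrite bigcup_symmetric.
apply/cvg_cabsP.
apply: (@squeeze_cvgr _ _ _ _ (fun=> 0)
  (fun n => cabs (G n.+1%:R) + cabs (G (- n.+1%:R)))).
- by apply: nearW => n; rewrite cabs_ge0 subr0 cabsB.
- exact: cvg_cst.
- by rewrite -[0]addr0; exact: cvgD.
Qed.

End complex_derivative.

Section gamma.
Variable R : realType.
Local Notation mu := (@lebesgue_measure R).
Local Notation mR := (measurableTypeR R).
Implicit Types w : R[i].

Lemma expRN_nat_cvg0 (c K : R) : 0 < c ->
  (fun n : nat => K * expR (- (c * n.+1%:R))) @ \oo --> (0 : R).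
Proof.
move=> c0; rewrite -[0](mulr0 K); apply: cvgM; first exact: cvg_cst.
rewrite (_ : (fun n : nat => _) = (fun n : nat => expR (- c) ^+ n.+1)).
  rewrite (cvg_shiftS (fun n : nat => expR (- c) ^+ n)).
  by apply: cvg_expr; rewrite ger0_norm ?expR_ge0// expR_lt1 oppr_lt0.
by apply/funext => n; rewrite -expRM_natl mulrN mulrC.
Qed.

Lemma euler_log_cvg0 w (e : R) : 0 < complex.Re w -> `|e| = 1 ->
  (fun n : nat => cabs (euler_log w (e * n.+1%:R))) @ \oo --> (0 : R).
Proof.
move=> w0 e1; have c0 : 0 < Num.min (complex.Re w) 1 by rewrite lt_min w0 ltr01.
apply: (@squeeze_cvgr _ _ _ _ (fun=> 0) (fun n : nat =>
  expR ((1 + complex.Re w) ^+ 2 / 2) *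
  expR (- (Num.min (complex.Re w) 1 * n.+1%:R)))).
- apply: nearW => n; rewrite cabs_ge0/= cabs_euler_log -expRD ler_expR.
  by have := euler_log_decay (e * n.+1%:R) w0; rewrite normrM e1 mul1r normr_nat.
- exact: cvg_cst.
- exact: expRN_nat_cvg0.
Qed.

Lemma euler_recursion w : 0 < complex.Re w ->
  euler_integral (w + 1) = w * euler_integral w.
Proof.
move=> w0; have w1 : 0 < complex.Re (w + 1) by rewrite ReD addr_gt0// ltr01.
have i0 := cintegrable_euler_log w0; have i1 := cintegrable_euler_log w1.
apply/eqP; rewrite -subr_eq0 -oppr_eq0 opprB; apply/eqP.
rewrite !euler_integralE -cintegralZ// -cintegralB//; last exact: cintegrableZ.
have e1 v : euler_log (w + 1) v = (expR v)%:C * euler_log w v.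
  by rewrite /euler_log -cexp_real -cexpD; congr cexp; rewrite mulrDl mul1r; ring.
have dE (u : R[i]) : cderiv (euler_log u) (fun v => (u - (expR v)%:C) * euler_log u v).
  apply: cderiv_cexp; apply: cderivD; first exact: cderiv_linear.
  by apply: cderivN; apply: cderiv_real => v; exact: is_derive_expR.
have dG : cderiv (euler_log w) (fun v => w * euler_log w v - euler_log (w + 1) v).
  by apply: (cderiv_ext _ (dE w)) => v; rewrite e1 mulrBl.
have cE (u : R[i]) := cderiv_continuous (dE u).
apply: (cintegral_derive0 dG).
- apply: ccontinuousD; first by apply: ccontinuousM => //; exact: ccontinuous_cst.
  have [c1 c2] := cE (w + 1); split=> x.
  + by under eq_fun do rewrite ReN; apply: cvgN; exact: c1.
  + by under eq_fun do rewrite ImN; apply: cvgN; exact: c2.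
- apply: cintegrableD; first exact: cintegrableZ.
  by under eq_fun do rewrite -mulN1r; exact: cintegrableZ.
- by under eq_fun do rewrite -[X in euler_log w X]mul1r;
    apply: euler_log_cvg0 => //; rewrite normr1.
- by under eq_fun do rewrite -mulN1r;
    apply: euler_log_cvg0 => //; rewrite normrN1.
Qed.

Definition real_gamma (x : R) : R := \int[mu]_v expR (x * v - expR v).

Lemma rintegrable_gamma (x : R) : 0 < x ->
  rintegrable mu (fun v => expR (x * v - expR v)).
Proof.
move=> x0; have [h _] := @cintegrable_euler_log R x%:C x0.
move: h; rewrite /rintegrable; congr (mu.-integrable _ _); apply/funext => v /=.
by rewrite /euler_log -rmorphM -rmorphB cexp_real.
Qed.

Lemma euler_real (x : R) : euler_integral x%:C = (real_gamma x)%:C.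
Proof.
rewrite euler_integralE -cintegral_real; apply: eq_cintegral => v.
by rewrite /euler_log -rmorphM -rmorphB cexp_real.
Qed.

Lemma real_gammaS (x : R) : 0 < x -> real_gamma (x + 1) = x * real_gamma x.
Proof.
move=> x0; apply: (@complexI R); rewrite rmorphM /= -!euler_real.
by rewrite rmorphD rmorph1 euler_recursion.
Qed.

Lemma real_gamma_gt0 (x : R) : 0 < x -> 0 < real_gamma x.
Proof.
move=> x0; pose c : R := expR (- expR 1).
have m01 : measurable (`[0, 1]%classic : set mR) by exact: measurable_itv.
have i01 : rintegrable mu (fun v => c * \1_(`[0, 1]%classic : set R) v).
  by apply: rintegrableZ; exact: integrable_indic_itv.
have : \int[mu]_v (c * \1_(`[0, 1]%classic : set R) v) <= real_gamma x.
  apply: le_Rintegral => //; first exact: rintegrable_gamma.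
  move=> v _; rewrite indicE; have [/set_mem|_] := boolP (v \in _); last first.
    by rewrite mulr0 expR_ge0.
  rewrite /= in_itv /= => /andP[v0 v1]; rewrite mulr1 ler_expR.
  have h : expR v <= expR 1 by rewrite ler_expR.
  have xv : 0 <= x * v by rewrite mulr_ge0// ltW.
  lra.
apply: lt_le_trans.
have -> : \int[mu]_v (c * \1_(`[0, 1]%classic : set R) v) = c.
  rewrite RintegralZl//; last exact: integrable_indic_itv.
  have m1 : mu (`[0, 1]%classic : set R) = 1%E.
    by rewrite lebesgue_measure_itv/= lte_fin ltr01 oppr0 adde0.
  rewrite /Rintegral integral_indic// setIT.
  by rewrite [X in fine X]m1 mulr1.
exact: expR_gt0.
Qed.

(** The right-hand side is [(2 sinh t) ^ 2]. *)
Lemma sqr_le_sinh2 (t : R) : t ^+ 2 <= expR (2 * t) - 2 + expR (- (2 * t)).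
Proof.
have -> : expR (2 * t) - 2 + expR (- (2 * t)) = (expR t - expR (- t)) ^+ 2.
  rewrite sqrrB -!expRM_natl mulrN -expRD subrr expR0; ring.
wlog t0 : t / 0 <= t => [H|].
  have [|t0] := leP 0 t; first exact: H.
  have := H (- t); rewrite sqrrN opprK => h; rewrite -[leRHS]sqrrN opprB.
  by apply: h; rewrite oppr_ge0 ltW.
have h1 := expR_ge1Dx t.
have h2 : expR (- t) <= 1 by rewrite expR_le1 oppr_le0.
by rewrite ler_sqr ?nnegrE ?subr_ge0 ?ler_expR; lra.
Qed.

Lemma cos_ge (t : R) : 1 - t ^+ 2 / 2 <= cos t.
Proof.
have -> : cos t = 1 - 2 * sin (t / 2) ^+ 2.
  rewrite -[in LHS](_ : t / 2 + t / 2 = t); last by field.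
  by rewrite cosD -!expr2; have := cos2Dsin2 (t / 2); lra.
suff : sin (t / 2) ^+ 2 <= (t / 2) ^+ 2.
  by rewrite expr_div_n => h; lra.
rewrite -(real_normK (num_real (sin _))) -[leRHS](real_normK (num_real _)).
rewrite ler_sqr ?nnegrE//.
wlog t0 : t / 0 <= t => [H|].
  have [|t0] := leP 0 t; first exact: H.
  have := H (- t); rewrite mulNr sinN !normrN; apply.
  by rewrite oppr_ge0 ltW.
have [/eqP->|tn0] := boolP (t == 0); first by rewrite mul0r sin0.
have tp : 0 < t / 2 by rewrite divr_gt0// lt_def tn0.
have ds (x : R) : is_derive x (1 : R) (@sin R) (cos x) by exact: is_derive_sin.
have csin : {within `[0, t / 2], continuous (@sin R)}.
  by apply: continuous_subspaceT; exact: continuous_sin.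
have [c _ e] := MVT tp (fun x _ => ds x) csin.
move: e; rewrite sin0 !subr0 => ->; rewrite normrM ler_piMl//.
by rewrite ler_norml cos_geN1 cos_le1.
Qed.

(** For large [x] the mass of [v |-> exp (x v - exp v)] concentrates near
[v = ln x], where the oscillating factor [exp (i y v)] is almost constant; the
second moments of [exp v / x] make this quantitative. *)
Lemma euler_large (x y : R) : 4 <= x -> 9 * y ^+ 2 < 2 * x ->
  euler_integral (x +i* y) != 0.
Proof.
move=> x4 xy; have x0 : 0 < x by lra.
have w0 : 0 < complex.Re (x +i* y) by [].
have iw := cintegrable_euler_log w0.
pose c := cexp (- ('i%C * (y * ln x)%:C)).
suff : 0 < complex.Re (c * euler_integral (x +i* y)).
  by apply: contraTneq => ->; rewrite mulr0 ltxx.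
rewrite euler_integralE -cintegralZ//.
have [ic _] := cintegrableZ c iw.
rewrite [ltRHS]/=.
have ReE v : complex.Re (c * euler_log (x +i* y) v) =
    expR (x * v - expR v) * cos (y * (v - ln x)).
  rewrite /c /euler_log -cexpD Re_cexp !ReIm /=.
  by congr (expR _ * cos _); ring.
pose g v := expR (x * v - expR v).
(* With [u = exp v / x], the factor [cos (y ln u)] is at least
   [1 - y ^ 2 (u ^ 2 - 2 + u ^ (-2)) / 2]; integrating this minorant brings in
   the values of Gamma at [x] and [x +- 2], which the recursion relates. *)
pose lo (v : R) : R := (1 + y ^+ 2) * expR (x * v - expR v) +
  - (y ^+ 2 / 2) * (x ^- 2 * expR ((x + 2) * v - expR v)) +
  - (y ^+ 2 / 2) * (x ^+ 2 * expR ((x - 2) * v - expR v)).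
have i2 : 0 < x + 2 by lra.
have i3 : 0 < x - 2 by lra.
have g1 := rintegrable_gamma x0; have g2 := rintegrable_gamma i2.
have g3 := rintegrable_gamma i3.
have il1 : rintegrable mu (fun v => (1 + y ^+ 2) * expR (x * v - expR v)).
  exact: rintegrableZ.
have il2 : rintegrable mu
    (fun v => - (y ^+ 2 / 2) * (x ^- 2 * expR ((x + 2) * v - expR v))).
  by do 2 apply: rintegrableZ.
have il3 : rintegrable mu
    (fun v => - (y ^+ 2 / 2) * (x ^+ 2 * expR ((x - 2) * v - expR v))).
  by do 2 apply: rintegrableZ.
have ilo : rintegrable mu lo by apply: rintegrableD => //; exact: rintegrableD.
have lo_le : \int[mu]_v lo v <=
    \int[mu]_v complex.Re (c * euler_log (x +i* y) v).
  apply: le_Rintegral => // v _; rewrite ReE.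
  apply: le_trans (ler_wpM2l (expR_ge0 _) (cos_ge _)).
  have h := sqr_le_sinh2 (v - ln x).
  have e2 : expR (2 * (v - ln x)) = expR (2 * v) * x ^- 2.
    by rewrite mulrBr expRD expRN [expR (2 * ln x)]expRM_natl lnK.
  have e3 : expR (- (2 * (v - ln x))) = expR (- (2 * v)) * x ^+ 2.
    by rewrite mulrBr opprB addrC expRD [expR (2 * ln x)]expRM_natl lnK.
  have E2 : expR ((x + 2) * v - expR v) = g v * expR (2 * v).
    by rewrite /g -expRD; congr expR; ring.
  have E3 : expR ((x - 2) * v - expR v) = g v * expR (- (2 * v)).
    by rewrite /g -expRD; congr expR; ring.
  rewrite /lo E2 E3 -/(g v) -subr_ge0.
  rewrite [leRHS](_ : _ = g v * (y ^+ 2 / 2) * (expR (2 * (v - ln x)) - 2 +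
    expR (- (2 * (v - ln x))) - (v - ln x) ^+ 2)).
    rewrite mulr_ge0 ?subr_ge0// mulr_ge0 ?expR_ge0// divr_ge0 ?sqr_ge0//.
  by rewrite e2 e3; field; rewrite gt_eqF.
apply: lt_le_trans lo_le.
rewrite /lo RintegralD//; last exact: rintegrableD.
rewrite RintegralD// !RintegralZl//; try exact: rintegrableZ.
rewrite -!/(real_gamma _).
have G2 : real_gamma (x + 2) = (x + 1) * (x * real_gamma x).
  rewrite -real_gammaS// -real_gammaS; last lra.
  by congr real_gamma; ring.
have G3 : real_gamma x = (x - 1) * ((x - 2) * real_gamma (x - 2)).
  have -> : x - 1 = x - 2 + 1 by ring.
  rewrite -(real_gammaS i3) -real_gammaS; last lra.
  by congr real_gamma; ring.
have gp := real_gamma_gt0 i3.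
rewrite G2 G3; set z := real_gamma (x - 2) in gp *.
rewrite [ltRHS](_ : _ = z * ((x - 1) * (x - 2) -
   y ^+ 2 / 2 * ((x - 1) * (x - 2) / x + (3 * x - 2)))); last first.
  by field; rewrite gt_eqF.
rewrite mulr_gt0// subr_gt0.
have y2 : 0 <= y ^+ 2 by exact: sqr_ge0.
have b1 : (x - 1) * (x - 2) / x + (3 * x - 2) <= 9 * ((x - 1) * (x - 2)) / x.
  rewrite -subr_ge0 [leRHS](_ : _ = (8 * ((x - 1) * (x - 2)) - x * (3 * x - 2)) / x);
    last by field; rewrite gt_eqF.
  rewrite divr_ge0 ?(ltW x0)//; nra.
have b0 : 0 < (x - 1) * (x - 2) by apply: mulr_gt0; lra.
apply: (@le_lt_trans _ _ (y ^+ 2 / 2 * (9 * ((x - 1) * (x - 2)) / x))).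
  by rewrite ler_wpM2l// divr_ge0.
rewrite [ltLHS](_ : _ = (x - 1) * (x - 2) * (9 * y ^+ 2 / (2 * x))); last first.
  by field; rewrite gt_eqF.
rewrite gtr_pMr// ltr_pdivrMr ?mul1r//; lra.
Qed.

Lemma euler_shift w N : 0 < complex.Re w ->
  euler_integral (w + N%:R) = \prod_(k < N) (w + k%:R) * euler_integral w.
Proof.
move=> w0; elim: N => [|N IH]; first by rewrite big_ord0 mul1r addr0.
rewrite big_ord_recr /= -mulrA mulrCA -IH -natr1 addrA euler_recursion//.
by rewrite ReD Re_nat ltr_wpDr.
Qed.

(** By the recursion a zero at [w] would propagate to all [w + N], against
[euler_large]. *)
Lemma euler_neq0 w : 0 < complex.Re w -> euler_integral w != 0.
Proof.
move=> w0; apply/eqP => e0.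
pose y := complex.Im w.
pose N := (Num.truncn (4 + 9 * y ^+ 2)).+1.
have hN : 4 + 9 * y ^+ 2 < N%:R by exact: truncnS_gt.
have y2 : 0 <= y ^+ 2 by exact: sqr_ge0.
have := @euler_large (complex.Re w + N%:R) y.
have -> : (complex.Re w + N%:R) +i* y = w + N%:R.
  by apply: complex_eqP; rewrite ?ReD ?ImD ?Re_nat ?Im_nat ?addr0.
rewrite euler_shift// e0 mulr0 eqxx.
by move=> /(_ _ _)/negP; apply => //; lra.
Qed.

(** The definition of [cGamma] fixes one shift; every admissible shift gives
the same value, also at the poles, where both products vanish. *)
Lemma cGammaE w N : 0 < complex.Re w + N%:R ->
  cGamma w = euler_integral (w + N%:R) / \prod_(k < N) (w + k%:R).
Proof.
pose g M := euler_integral (w + M%:R) / \prod_(k < M) (w + k%:R).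
have step M : 0 < complex.Re w + M%:R -> g M.+1 = g M.
  move=> wM; rewrite /g big_ord_recr /= -natr1 addrA.
  have wM' : 0 < complex.Re (w + M%:R) by rewrite ReD Re_nat.
  have n0 : w + M%:R != 0.
    by apply: contraTneq wM' => ->; rewrite ltxx.
  by rewrite euler_recursion// invfM [_ * euler_integral _]mulrC mulrACA divff// mulr1.
have up M K : 0 < complex.Re w + M%:R -> g (M + K)%N = g M.
  move=> wM; elim: K => [|K IH]; first by rewrite addn0.
  by rewrite addnS step// natrD addrA ltr_wpDr.
have all_eq M K : 0 < complex.Re w + M%:R -> 0 < complex.Re w + K%:R -> g M = g K.
  move=> wM wK; have [h|h] := leqP M K.
    by rewrite -(subnKC h) up.
  by rewrite -(subnKC (ltnW h)) up.
move=> wN; apply: (all_eq _ N) => //.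
have := truncnS_gt `|complex.Re w|; have := ler_norm (- complex.Re w).
rewrite normrN; lra.
Qed.

Lemma cGamma_euler w : 0 < complex.Re w -> cGamma w = euler_integral w.
Proof.
by move=> w0; rewrite (@cGammaE w 0) ?addr0// big_ord0 divr1.
Qed.

Lemma cGamma_neq0 w : (forall k : nat, w + k%:R != 0) -> cGamma w != 0.
Proof.
move=> wk; pose N := (Num.truncn `|complex.Re w|).+1.
have wN : 0 < complex.Re w + N%:R.
  have := truncnS_gt `|complex.Re w|; have := ler_norm (- complex.Re w).
  rewrite normrN /N; lra.
rewrite (cGammaE wN) mulf_neq0//.
  by apply: euler_neq0; rewrite ReD Re_nat.
by rewrite invr_eq0; apply/prodf_neq0 => k _; exact: wk.
Qed.

End gamma.

(** * Power series *)

Section null_sequences.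
Variable R : realType.
Implicit Types u v : nat -> R.

Definition null u : Prop := u @ \oo --> (0 : R).

Lemma null_le u v : (forall n, 0 <= u n <= v n) -> null v -> null u.
Proof.
move=> uv v0; apply: (@squeeze_cvgr _ _ _ _ (fun=> 0) v) => //.
- by apply: nearW.
- exact: cvg_cst.
Qed.

Lemma nullD u v : null u -> null v -> null (fun n => u n + v n).
Proof. by move=> u0 v0; rewrite /null -[0]addr0; exact: cvgD. Qed.

Lemma nullZ (c : R) u : null u -> null (fun n => c * u n).
Proof. by move=> u0; rewrite /null -(mulr0 c); apply: cvgM => //; exact: cvg_cst. Qed.

Lemma nullS u : null (fun n => u n.+1) <-> null u.
Proof. by rewrite /null (cvg_shiftS u). Qed.

Lemma null_shiftn k u : null u -> null (fun n => u (k + n)%N).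
Proof.
move=> u0; elim: k => [//|k IH].
by under eq_fun do rewrite addSnnS; exact/(nullS (fun n => u (k + n)%N)).
Qed.

Lemma null_geo (x : R) : 0 <= x < 1 -> null (fun n => x ^+ n).
Proof. by move=> /andP[x0 x1]; apply: cvg_expr; rewrite ger0_norm. Qed.

Lemma null_bounded u : null u -> exists2 M : R, 0 <= M & forall n, `|u n| <= M.
Proof.
move=> u0; have [M [_ hM]] := cvg_seq_bounded (cvgP _ u0).
exists (`|M| + 1); first by rewrite addr_ge0.
move=> n; apply: hM => //; apply: (le_lt_trans (ler_norm M)).
by rewrite ltrDl.
Qed.

End null_sequences.

Section exponential_series.
Variable R : realType.
Implicit Types z : R[i].

Definition exp_partial z n : R[i] := \sum_(k < n) z ^+ k / k`!%:R.

Lemma exp_partial_le z n : cabs (exp_partial z n) <= expR (cabs z).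
Proof.
apply: (@le_trans _ _ (series (exp_coeff (cabs z)) n)); last first.
  apply: nondecreasing_cvgn_le; last exact: is_cvg_series_exp_coeff.
  apply/nondecreasing_seqP => k; rewrite !seriesEnat/= big_nat_recr//= lerDl.
  by rewrite divr_ge0 ?exprn_ge0 ?cabs_ge0.
rewrite /exp_partial /series /= big_mkord.
elim: n => [|n IH]; first by rewrite !big_ord0 cabs0.
rewrite !big_ord_recr /=; apply: (le_trans (cabsD _ _)); apply: lerD => //.
by rewrite cabsM cabsX cabsV cabs_nat.
Qed.

Lemma is_derive_pow n (x : R) :
  is_derive x (1 : R) (fun y : R => y ^+ n.+1) (n.+1%:R * x ^+ n).
Proof.
apply: DeriveDef; first exact: exprn_derivable.
by rewrite exp_derive /GRing.scale /= mulr1.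
Qed.

(** The mean value theorem for the difference of [f] and the monomial on the
right-hand side. *)
Lemma derive_bound (f f' : R -> R) (A : R) (n : nat) :
  f 0 = 0 -> (forall t : R, is_derive t (1 : R) f (f' t)) ->
  (forall t, 0 <= t <= 1 -> `|f' t| <= A * t ^+ n) ->
  forall t, 0 <= t <= 1 -> `|f t| <= A / n.+1%:R * t ^+ n.+1.
Proof.
have n0 : (n.+1%:R : R) != 0 by rewrite pnatr_eq0.
move=> f0 df fA t /andP[t0 t1].
pose P (x : R) := A / n.+1%:R * x ^+ n.+1.
have dP (x : R) : is_derive x (1 : R) P (A * x ^+ n).
  have := is_deriveZ (A / n.+1%:R) (is_derive_pow n x).
  rewrite /GRing.scale /= mulrA divfK//; exact.
have key (g g' : R -> R) : g 0 = 0 ->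
    (forall x : R, is_derive x (1 : R) g (g' x)) ->
    (forall x, 0 <= x <= 1 -> `|g' x| <= A * x ^+ n) -> g t <= P t.
  move=> g0 dg gA; rewrite -subr_ge0.
  have dh (x : R) : is_derive x (1 : R) (fun y => P y - g y) (A * x ^+ n - g' x).
    exact: is_deriveB.
  have ch : {within `[0, t], continuous (fun y => P y - g y)}.
    by apply: continuous_subspaceT => x; exact: is_derive_continuous (dh x).
  have [c ct] := MVT_segment t0 (fun x _ => dh x) ch.
  rewrite /P expr0n mulr0 g0 !subr0 -/(P t) => ->.
  move: ct; rewrite in_itv/= => /andP[c0 ct].
  rewrite mulr_ge0// subr_ge0; apply: (le_trans (ler_norm _)); apply: gA.
  by rewrite c0 (le_trans ct).
rewrite ler_norml; apply/andP; split; last exact: (key f f').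
rewrite lerNl; apply: (key (fun x => - f x) (fun x => - f' x)).
- by rewrite f0 oppr0.
- by move=> x x01; rewrite normrN; exact: fA.
Qed.

(** Taylor's formula along the segment from [0] to [z], by induction on [n]: the
derivative of a remainder is [z] times the preceding remainder. Each step adds
the bounds of the two parts, which turns [cabs z] into [2 * cabs z]. *)
Lemma cexp_taylor z n (t : R) : 0 <= t <= 1 ->
  let r := cexp (z * t%:C) - exp_partial (z * t%:C) n in
  let B := expR (cabs z) * (2 * cabs z) ^+ n / n`!%:R * t ^+ n in
  `|complex.Re r| <= B /\ `|complex.Im r| <= B.
Proof.
pose r n t := cexp (z * t%:C) - exp_partial (z * t%:C) n.
have dpart k : cderiv (fun t => exp_partial (z * t%:C) k.+1)
    (fun t => z * exp_partial (z * t%:C) k).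
  elim: k => [|k IH].
    apply: (@cderiv_ext _ _ (fun=> 0)).
      by move=> x; rewrite /exp_partial big_ord0 mulr0.
    rewrite (_ : (fun _ => _) = fun=> 1); first by move=> x; split; exact: is_derive_cst.
    by apply/funext => x; rewrite /exp_partial big_ord1 expr0 divr1.
  rewrite (_ : (fun t => exp_partial _ k.+2) = (fun t => exp_partial (z * t%:C) k.+1 +
      (z ^+ k.+1 / k.+1`!%:R) * (t ^+ k.+1)%:C)); last first.
    apply/funext => x; rewrite /exp_partial [LHS]big_ord_recr /=.
    by congr (_ + _); rewrite exprMn rmorphXn mulrAC.
  pose c : R[i] := z ^+ k.+1 / k.+1`!%:R.
  have dpow : cderiv (fun t : R => (t ^+ k.+1)%:C) (fun t => (k.+1%:R * t ^+ k)%:C).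
    by apply: cderiv_real => x; exact: is_derive_pow.
  have dc : cderiv (fun=> c) (fun=> 0) by move=> x; split; exact: is_derive_cst.
  apply: (cderiv_ext _ (cderivD IH (cderivM dc dpow))) => x.
  rewrite mul0r add0r {2}/exp_partial big_ord_recr/= mulrDr -/(exp_partial _ k).
  congr (_ + _); rewrite /c exprMn rmorphM rmorphXn rmorph_nat factS natrM.
  rewrite exprS; field.
  by rewrite nat1r !pnatr_eq0 -lt0n fact_gt0.
have dr k : cderiv (r k.+1) (fun t => z * r k t).
  have de := cderiv_cexp (cderiv_linear z).
  by apply: (cderiv_ext _ (cderivD de (cderivN (dpart k)))) => x; rewrite /r mulrBr.
have r0 k : r k.+1 0 = 0.
  rewrite /r mulr0 cexp0 /exp_partial big_ord_recl expr0 divr1 big1 ?addr0 ?subrr//.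
  by move=> i _; rewrite exprS !mul0r.
move: t; rewrite /=; elim: n => [|n IH] t t01.
  rewrite /exp_partial big_ord0 subr0 fact0 expr0 divr1 mulr1 expr0 mulr1.
  have h : cabs (cexp (z * t%:C)) <= expR (cabs z).
    rewrite cabs_exp ler_expR ReZ; move/andP : t01 => [t0 t1].
    apply: (@le_trans _ _ (`|complex.Re z| * t)).
      by rewrite ler_wpM2r// ler_norm.
    apply: (@le_trans _ _ (`|complex.Re z| * 1)); first by rewrite ler_wpM2l.
    by rewrite mulr1 norm_Re_le.
  by split; apply: le_trans h; [exact: norm_Re_le|exact: norm_Im_le].
set A := expR (cabs z) * (2 * cabs z) ^+ n.+1 / n`!%:R.
have AE : expR (cabs z) * (2 * cabs z) ^+ n.+1 / n.+1`!%:R = A / n.+1%:R.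
  by rewrite /A factS natrM invfM mulrA [_ / _ / _]mulrAC.
have hz x : 0 <= x <= 1 -> cabs (z * r n x) <= A * x ^+ n.
  move=> /IH[h1 h2]; rewrite cabsM.
  apply: (@le_trans _ _ (cabs z * (2 * (expR (cabs z) * (2 * cabs z) ^+ n / n`!%:R * x ^+ n)))).
    apply: ler_wpM2l; first exact: cabs_ge0.
    by apply: (le_trans (cabs_le _)); rewrite mulr_natl mulr2n lerD.
  by rewrite le_eqVlt; apply/orP; left; apply/eqP; rewrite /A exprS; ring.
rewrite AE; split.
- apply: (derive_bound (f := fun x => complex.Re (r n.+1 x))
    (f' := fun x => complex.Re (z * r n x))) => //.
  + by rewrite r0.
  + by move=> x; have [] := dr n x.
  + by move=> x x01; apply: le_trans (norm_Re_le _) (hz x x01).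
- apply: (derive_bound (f := fun x => complex.Im (r n.+1 x))
    (f' := fun x => complex.Im (z * r n x))) => //.
  + by rewrite r0.
  + by move=> x; have [] := dr n x.
  + by move=> x x01; apply: le_trans (norm_Im_le _) (hz x x01).
Qed.

Lemma exp_partial_cvg z :
  (exp_partial z : nat -> R[i]^o) @ \oo --> (cexp z : R[i]^o).
Proof.
apply/cvg_cabsP.
have h : null (fun n => 2 * (expR (cabs z) * exp_coeff (2 * cabs z) n)).
  by do 2 apply: nullZ; exact: cvg_exp_coeff.
apply: null_le h => n; rewrite cabs_ge0 /=.
have [|] := @cexp_taylor z n 1; first by rewrite ler01 lexx.
rewrite mulr1 expr1n mulr1 => h1 h2.
rewrite -cabsN opprB; apply: (le_trans (cabs_le _)).
rewrite mulr_natl mulr2n; apply: lerD.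
- by apply: (le_trans h1); rewrite /exp_coeff mulrA.
- by apply: (le_trans h2); rewrite /exp_coeff mulrA.
Qed.

End exponential_series.

(** * Analytic functions of one complex variable *)

Section analytic.
Variable R : realType.
Implicit Types (g : R[i] -> R[i]) (p w z c : R[i]) (a : nat -> R[i]).

Definition psum a w n : R[i] := \sum_(k < n) a k * w ^+ k.

(** The form of [analytic_at] in which all errors are null sequences in [R]. *)
Lemma analytic_atP g p : analytic_at g p <->
  exists a (e : R), 0 < e /\ forall z, cabs (z - p) < e ->
    null (fun n => cabs (psum a (z - p) n - g z)).
Proof.
have sE a w : series (fun k => a k * w ^+ k) = psum a w.
  by apply/funext => n; rewrite /series /psum /= big_mkord.
split=> -[a [e [e0 h]]]; exists a, e; split=> // z zp.
  have /h : `|z - p| < e%:C by rewrite normcE ltcR.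
  by rewrite sE => /cvg_cabsP.
rewrite sE; apply/cvg_cabsP; apply: h.
by rewrite -ltcR -normcE.
Qed.

Lemma psumS a w n : psum a w n.+1 = psum a w n + a n * w ^+ n.
Proof. by rewrite /psum big_ord_recr. Qed.

Lemma psum_term a w l : null (fun n => cabs (psum a w n - l)) ->
  null (fun n => cabs (a n * w ^+ n)).
Proof.
move=> h; have h1 := (nullS (fun n => cabs (psum a w n - l))).2 h.
apply: null_le (nullD h1 h) => n; rewrite cabs_ge0 /=.
have -> : a n * w ^+ n = (psum a w n.+1 - l) - (psum a w n - l).
  by rewrite psumS; ring.
exact: cabsB.
Qed.

(** Cauchy's estimate in its crudest form. *)
Lemma psum_coef_bound a g p (e : R) : 0 < e ->
  (forall z, cabs (z - p) < e -> null (fun n => cabs (psum a (z - p) n - g z))) ->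
  exists2 M : R, 0 <= M & forall k, cabs (a k) * (e / 2) ^+ k <= M.
Proof.
move=> e0 h.
have e20 : 0 <= e / 2 by rewrite divr_ge0// ltW.
have /h : cabs (p + (e / 2)%:C - p) < e.
  by rewrite addrAC subrr add0r cabs_real ger0_norm//; lra.
move=> /psum_term /null_bounded[M M0 hM]; exists M => // k.
have := hM k; rewrite ger0_norm ?cabs_ge0//.
by rewrite addrAC subrr add0r cabsM cabsX cabs_real ger0_norm.
Qed.

Lemma analytic_ext g g' p (e : R) : 0 < e ->
  (forall z, cabs (z - p) < e -> g z = g' z) ->
  analytic_at g p -> analytic_at g' p.
Proof.
move=> e0 gg' /analytic_atP[a [d [d0 h]]]; apply/analytic_atP.
exists a, (Num.min d e); split=> [|z]; first by rewrite lt_min d0.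
by rewrite lt_min => /andP[zd ze]; rewrite -gg'//; exact: h.
Qed.

Lemma analyticD g g' p : analytic_at g p -> analytic_at g' p ->
  analytic_at (fun z => g z + g' z) p.
Proof.
move=> /analytic_atP[a [d [d0 h]]] /analytic_atP[a' [d' [d'0 h']]].
apply/analytic_atP; exists (fun k => a k + a' k), (Num.min d d').
split=> [|z]; first by rewrite lt_min d0.
rewrite lt_min => /andP[/h zd /h' zd'].
apply: null_le (nullD zd zd') => n; rewrite cabs_ge0 /=.
have -> : psum (fun k => a k + a' k) (z - p) n =
    psum a (z - p) n + psum a' (z - p) n.
  by rewrite /psum -big_split; apply: eq_bigr => k _; rewrite mulrDl.
by rewrite opprD addrACA cabsD.
Qed.

Lemma analyticZ (c : R[i]) g p : analytic_at g p -> analytic_at (fun z => c * g z) p.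
Proof.
move=> /analytic_atP[a [d [d0 h]]].
apply/analytic_atP; exists (fun k => c * a k), d; split=> // z /h zd.
apply: null_le (nullZ (cabs c) zd) => n; rewrite cabs_ge0 /= -cabsM mulrBr.
rewrite (_ : psum (fun k => c * a k) (z - p) n = c * psum a (z - p) n)//.
by rewrite /psum mulr_sumr; apply: eq_bigr => k _; rewrite mulrA.
Qed.

(** Multiplication and division by a linear factor telescope at the level of
partial sums, so that no product of power series is needed. *)
Lemma analytic_mul_linear g p c : analytic_at g p ->
  analytic_at (fun z => (z - c) * g z) p.
Proof.
move=> /analytic_atP[a [d [d0 h]]]; apply/analytic_atP.
pose b k := (if k is j.+1 then a j else 0) + (p - c) * a k.
exists b, d; split=> // z zd; have {}h := h z zd.
set w := z - p in h zd *.
have zc : z - c = w + (p - c) by rewrite /w; ring.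
have bE n : psum b w n.+1 = (z - c) * psum a w n.+1 - w * (a n * w ^+ n).
  elim: n => [|n IH].
    by rewrite /psum !big_ord1 /b zc !expr0; ring.
  by rewrite psumS IH [in RHS]psumS /b zc exprS; ring.
have h1 := (nullS (fun n => cabs (psum a w n - g z))).2 h.
apply/nullS; apply: null_le (nullD (nullZ (cabs (z - c)) h1)
  (nullZ (cabs w) (psum_term h))) => n; rewrite cabs_ge0 /=.
rewrite bE addrAC -mulrBr; apply: (le_trans (cabsB _ _)).
by rewrite !cabsM.
Qed.

Lemma analytic_div_linear g p c : c != p -> analytic_at g p ->
  analytic_at (fun z => g z / (z - c)) p.
Proof.
move=> cp /analytic_atP[a [e [e0 h]]]; apply/analytic_atP.
have [M M0 hM] := psum_coef_bound e0 h.
pose d := c - p; have d0 : d != 0 by rewrite subr_eq0.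
have cd0 : 0 < cabs d by rewrite cabs_gt0.
(* The coefficients are forced by [(w - d) * sum b_k w^k = sum a_k w^k]. *)
pose b := fix b k := if k is j.+1 then (b j - a k) / d else - a 0%N / d.
(* [tau] exceeds the exponential growth rates of [a] and of the coefficients of
   [1 / (w - d)], hence also that of [b]. *)
pose tau := 2 / e + 2 / cabs d; pose B := 2 * M / cabs d.
have t1 : 0 < 2 / e by rewrite divr_gt0.
have t2 : 0 < 2 / cabs d by rewrite divr_gt0.
have t0 : 0 < tau by rewrite addr_gt0.
have B0 : 0 <= B by rewrite /B divr_ge0 ?mulr_ge0// ltW.
have aM k : cabs (a k) <= M * tau ^+ k.
  have h2 : (2 / e) ^+ k <= tau ^+ k.
    by rewrite lerXn2r ?nnegrE ?(ltW t1) ?(ltW t0)// lerDl ltW.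
  apply: le_trans (ler_wpM2l M0 h2).
  have -> : 2 / e = (e / 2)^-1 by rewrite invf_div.
  by rewrite exprVn ler_pdivlMr ?exprn_gt0// divr_gt0.
have bB k : cabs (b k) <= B * tau ^+ k.
  have step u j : cabs u <= M * tau ^+ j -> cabs (u / d) <= B / 2 * tau ^+ j.
    move=> hu; rewrite cabsM cabsV ler_pdivrMr//; apply: (le_trans hu).
    by rewrite le_eqVlt; apply/orP; left; apply/eqP; rewrite /B; field; rewrite gt_eqF.
  elim: k => [|k IH] /=.
    apply: (le_trans (step _ 0%N _)); first by rewrite cabsN.
    by rewrite ler_wpM2r ?exprn_ge0 ?(ltW t0)//; lra.
  rewrite mulrBl; apply: (le_trans (cabsB _ _)).
  have s2 := step _ _ (aM k.+1).
  have s1 : cabs (b k / d) <= B / 2 * tau ^+ k.+1.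
    rewrite cabsM cabsV exprS mulrA.
    apply: (@le_trans _ _ (B * tau ^+ k / cabs d)).
      by rewrite ler_wpM2r// invr_ge0 ltW.
    rewrite -mulrA [_ / cabs d]mulrC mulrA.
    apply: ler_wpM2r; first by rewrite exprn_ge0// ltW.
    rewrite -mulrA; apply: ler_wpM2l => //.
    by rewrite /tau; lra.
  by apply: (le_trans (lerD s1 s2)); lra.
exists b, (Num.min e (1 / (2 * tau))); split.
  by rewrite lt_min e0 divr_gt0// mulr_gt0.
move=> z; rewrite lt_min => /andP[ze zt]; have {}h := h z ze.
set w := z - p in h ze zt *.
have zc : z - c = w - d by rewrite /w /d; ring.
have tw : tau * cabs w < 1 / 2.
  by move: zt; rewrite ltr_pdivlMr ?mulr_gt0//; lra.
have wd0 : w - d != 0.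
  rewrite subr_eq0; apply/eqP => wd; move: tw; rewrite wd /tau mulrDl.
  rewrite divfK ?gt_eqF//; have : 0 < 2 / e * cabs d by rewrite mulr_gt0.
  lra.
have bE n : (w - d) * psum b w n.+1 = psum a w n.+1 + w * (b n * w ^+ n).
  elim: n => [|n IH].
    by rewrite /psum !big_ord1 /= !expr0; field.
  by rewrite psumS mulrDr IH [in RHS]psumS /= exprS; field.
have bw : null (fun n => cabs w * cabs (b n * w ^+ n)).
  apply: nullZ; apply: null_le (nullZ B (@null_geo R (1 / 2) _)); last lra.
  move=> n; rewrite cabs_ge0 /= cabsM cabsX.
  apply: (@le_trans _ _ (B * tau ^+ n * cabs w ^+ n)).
    by rewrite ler_wpM2r// exprn_ge0// cabs_ge0.
  rewrite -mulrA -exprMn ler_wpM2l// lerXn2r ?nnegrE ?mulr_ge0 ?cabs_ge0 ?(ltW t0)//; lra.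
have h1 := (nullS (fun n => cabs (psum a w n - g z))).2 h.
apply/nullS; apply: null_le (nullZ (cabs (w - d))^-1 (nullD h1 bw)) => n.
rewrite cabs_ge0 /= -cabsM -cabsV.
have -> : psum b w n.+1 - g z / (z - c) =
    (w - d)^-1 * ((psum a w n.+1 - g z) + w * (b n * w ^+ n)).
  by rewrite [_ - g z + _]addrAC -bE zc; field.
by rewrite [leLHS]cabsM ler_wpM2l ?cabs_ge0// cabsD.
Qed.

Lemma analytic_prod g p (s : seq R[i]) : analytic_at g p ->
  analytic_at (fun z => (\prod_(c <- s) (z - c)) * g z) p.
Proof.
move=> ag; elim: s => [|c s IH].
  by apply: (analytic_ext ltr01 _ ag) => z _; rewrite big_nil mul1r.
apply: (analytic_ext ltr01 _ (analytic_mul_linear c IH)) => z _.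
by rewrite big_cons mulrA.
Qed.

Lemma analytic_div_prod g p (s : seq R[i]) : p \notin s -> analytic_at g p ->
  analytic_at (fun z => g z / \prod_(c <- s) (z - c)) p.
Proof.
move=> + ag; elim: s => [_|c s IH].
  by apply: (analytic_ext ltr01 _ ag) => z _; rewrite big_nil divr1.
rewrite inE negb_or eq_sym => /andP[cp /IH{}IH].
apply: (analytic_ext ltr01 _ (analytic_div_linear cp IH)) => z _.
by rewrite big_cons invfM mulrCA mulrC.
Qed.

Lemma meromorphicP g p :
  (exists (l : nat) g', analytic_at g' p /\ exists2 e : R, 0 < e &
     forall z, z != p -> cabs (z - p) < e -> (z - p) ^+ l * g z = g' z) ->
  meromorphic_at g p.
Proof.
move=> [l [g' [[a [d [d0 h]]] [e e0 gg']]]].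
exists l, a, (Num.min d e); split=> [|z zp ze]; first by rewrite lt_min d0.
move: ze; rewrite normcE ltcR lt_min => /andP[zd ze].
by rewrite gg'//; apply: h; rewrite normcE ltcR.
Qed.

(** A factor vanishing at [p] raises the order of the pole; the others divide
without harm. *)
Lemma meromorphic_div_prod g p (s : seq R[i]) : analytic_at g p ->
  exists (l : nat) g', analytic_at g' p /\
    forall z, z != p -> (z - p) ^+ l * (g z / \prod_(c <- s) (z - c)) = g' z.
Proof.
move=> ag; elim: s => [|c s [l [g' [ag' gg']]]].
  by exists 0%N, g; split => // z _; rewrite big_nil divr1 expr0 mul1r.
have [cp|cp] := eqVneq c p; last first.
  exists l, (fun z => g' z / (z - c)); split; first exact: analytic_div_linear.
  by move=> z zp; rewrite -gg'// big_cons invfM [_^-1 * _]mulrC !mulrA.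
exists l.+1, g'; split => // z zp; rewrite -gg'// big_cons cp invfM exprSr.
have zp0 : z - p != 0 by rewrite subr_eq0.
by rewrite [g z * _]mulrCA -mulrA mulVKf.
Qed.

End analytic.

(** * Parametric integrals and the identity theorem *)
Section parametric_integral.
Context d (T : measurableType d) (R : realType) (nu : {measure set T -> \bar R}).
Variables (h : T -> R[i]) (u : T -> R).
Hypotheses (mh : cmeas h) (mu_ : measurable_fun setT u).

Lemma expR_ge_term (x : R) k : 0 <= x -> x ^+ k / k`!%:R <= expR x.
Proof.
move=> x0; case: k => [|k]; first by rewrite expr0 fact0 divr1 -expR0 ler_expR.
by apply: le_trans (expR_ge1Dxn k x0); rewrite lerDr.
Qed.

(** The exponential is expanded under the integral sign; for [z] close to [p],
the factor [exp (eps |u|)] dominates all partial sums at once. *)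
Lemma analytic_integral (al be p : R[i]) (eps : R) : 0 < eps ->
  rintegrable nu (fun x => cabs (h x) * expR (complex.Re (al + be * p) * u x) *
    expR (eps * `|u x|)) ->
  analytic_at
    (fun z => cintegral nu setT (fun x => h x * cexp ((al + be * z) * (u x)%:C))) p.
Proof.
move=> eps0 ih.
pose h0 x := h x * cexp ((al + be * p) * (u x)%:C).
have mu' : cmeas (fun x => (u x)%:C) by exact: cmeas_real.
have mh0 : cmeas h0.
  by apply: cmeasM => //; apply: cmeas_cexp; apply: cmeasM => //; exact: cmeas_cst.
have ah0 x : cabs (h0 x) = cabs (h x) * expR (complex.Re (al + be * p) * u x).
  by rewrite /h0 cabsM cabs_exp ReZ.
pose e := eps / (cabs be + 1).
have b1 : 0 < cabs be + 1 by rewrite ltr_pwDr// cabs_ge0.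
have e0 : 0 < e by rewrite divr_gt0.
have ebe (x : R) : x <= e -> cabs be * x <= eps.
  move=> xe; apply: (@le_trans _ _ (cabs be * e)).
    by rewrite ler_wpM2l// cabs_ge0.
  by rewrite /e mulrA ler_pdivrMr// mulrDr mulr1 mulrC lerDl ltW.
pose term k x := h0 x * (be * (u x)%:C) ^+ k / k`!%:R.
have mterm k : cmeas (term k).
  apply: cmeasM; last exact: cmeas_cst.
  apply: cmeasM => //; apply: cmeasX; apply: cmeasM => //; exact: cmeas_cst.
have iterm k : cintegrable nu setT (term k).
  apply: (cintegrable_le (mterm k) (rintegrableZ (e^-1 ^+ k) ih)) => x.
  rewrite /term -mulrA cabsM ah0 mulrCA ler_wpM2l//.
    by rewrite mulr_ge0 ?cabs_ge0 ?expR_ge0.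
  rewrite cabsM cabsX cabsM cabsV cabs_nat cabs_real.
  rewrite exprVn ler_pdivlMl ?exprn_gt0// mulrA -exprMn.
  have x0 : 0 <= e * (cabs be * `|u x|).
    by apply: mulr_ge0; [exact: ltW|apply: mulr_ge0; rewrite ?cabs_ge0].
  apply: (le_trans (expR_ge_term k x0)).
  by rewrite ler_expR mulrA ler_wpM2r// mulrC ebe.
apply/analytic_atP; exists (fun k => cintegral nu setT (term k)), e.
split => // z ze; set w := z - p in ze *.
pose F n x := h0 x * exp_partial (be * (u x)%:C * w) n.
have FE n x : F n x = \sum_(k < n) w ^+ k * term k x.
  rewrite /F /exp_partial mulr_sumr; apply: eq_bigr => k _.
  by rewrite /term exprMn; ring.
have iF n : cintegrable nu setT (F n).
  have [i _] := @cintegral_sum _ _ _ nu _ (index_enum 'I_n)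
    (fun k : 'I_n => fun x => w ^+ k * term k x)
    (fun k => cintegrableZ _ (iterm k)).
  by apply: eq_cintegrable i => x; rewrite FE.
have eF n : psum (fun k => cintegral nu setT (term k)) w n = cintegral nu setT (F n).
  have [_ e1] := @cintegral_sum _ _ _ nu _ (index_enum 'I_n)
    (fun k : 'I_n => fun x => w ^+ k * term k x)
    (fun k => cintegrableZ _ (iterm k)).
  rewrite (eq_cintegral _ (FE n)) e1 /psum; apply: eq_bigr => k _.
  by rewrite cintegralZ// mulrC.
have lim : (fun n => cintegral nu setT (F n) : R[i]^o) @ \oo -->
    (cintegral nu setT (fun x => h x * cexp ((al + be * z) * (u x)%:C)) : R[i]^o).
  apply: (cvg_cintegral (h := fun x => cabs (h x) *
    expR (complex.Re (al + be * p) * u x) * expR (eps * `|u x|))) => //.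
  - by move=> n; exact: cintegrable_meas (iF n).
  - apply: cmeasM => //; apply: cmeas_cexp; apply: cmeasM => //; exact: cmeas_cst.
  - move=> x; have -> : h x * cexp ((al + be * z) * (u x)%:C) =
        h0 x * cexp (be * (u x)%:C * w).
      by rewrite /h0 -mulrA -cexpD; congr (_ * cexp _); rewrite /w; ring.
    apply/cvg_cabsP; have /cvg_cabsP h1 := @exp_partial_cvg R (be * (u x)%:C * w).
    apply: null_le (nullZ (cabs (h0 x)) h1) => n.
    by rewrite cabs_ge0 /= /F -mulrBr cabsM.
  - move=> n x; rewrite /F cabsM ah0 ler_wpM2l//.
      by rewrite mulr_ge0 ?cabs_ge0 ?expR_ge0.
    apply: (le_trans (exp_partial_le _ _)); rewrite ler_expR !cabsM cabs_real.
    by rewrite mulrAC ler_wpM2r// ebe// ltW.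
move/cvg_cabsP : lim; rewrite /null; apply: cvg_trans; apply: near_eq_cvg.
by apply: nearW => n; rewrite eF.
Qed.

End parametric_integral.

Section identity.
Variable R : realType.
Implicit Types (g : R[i] -> R[i]) (p : R[i]).

Lemma null_ge (c : R) (u : nat -> R) : (forall n, c <= u n) -> null u -> c <= 0.
Proof.
move=> cu u0; rewrite leNgt; apply/negP => c0.
have /cvgrPdist_lt /(_ c c0) [N _ /(_ N (leqnn N))] := u0.
by rewrite /= sub0r normrN; have := cu N; have := ler_norm (u N); lra.
Qed.

(** If [a k] is the first Taylor coefficient other than [0], then at a zero
[p + i t] the term [a k (i t) ^ k] is cancelled by a tail of order
[t ^ (k + 1)], which is impossible for small [t]. *)
Lemma analytic_zero g p (del : R) : 0 < del -> analytic_at g p ->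
  (forall t : R, 0 < t < del -> g (p + 'i%C * t%:C) = 0) ->
  exists2 e : R, 0 < e & forall z, cabs (z - p) < e -> g z = 0.
Proof.
move=> del0 /analytic_atP[a [e [e0 h]]] g0.
have [M M0 hM] := psum_coef_bound e0 h.
pose rho := e / 2; have rho0 : 0 < rho by rewrite divr_gt0.
have a0 k : a k = 0.
  elim/ltn_ind: k => k IH.
  have tail (t : R) : 0 < t -> t <= rho / 2 -> t < del ->
      cabs (a k) <= 2 * M * t / rho ^+ k.+1.
    move=> t0 tr td; pose w := 'i%C * t%:C; pose q := t / rho.
    have wt : cabs w = t by rewrite /w cabsM cabs_i mul1r cabs_real gtr0_norm.
    have q0 : 0 <= q by rewrite divr_ge0 ?ltW.
    have q2 : q <= 1 / 2 by rewrite ler_pdivrMr//; lra.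
    have head : psum a w k.+1 = a k * w ^+ k.
      rewrite psumS /psum big1 ?add0r// => j _.
      by rewrite IH// mul0r.
    have aq j : cabs (a j * w ^+ j) <= M * q ^+ j.
      rewrite cabsM cabsX wt /q expr_div_n mulrA ler_pdivlMr ?exprn_gt0//.
      rewrite mulrAC; apply: ler_wpM2r; first by rewrite exprn_ge0// ltW.
      exact: hM.
    have tl m : cabs (psum a w (k.+1 + m)%N - a k * w ^+ k) <=
        2 * M * q ^+ k.+1 * (1 - (1 / 2) ^+ m).
      elim: m => [|m IHm].
        by rewrite addn0 head subrr cabs0 expr0 subrr mulr0.
      rewrite addnS psumS addrAC; apply: (le_trans (cabsD _ _)).
      have h1 : cabs (a (k.+1 + m)%N * w ^+ (k.+1 + m)) <= M * q ^+ k.+1 * (1 / 2) ^+ m.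
        apply: (le_trans (aq _)); rewrite exprD mulrA.
        apply: ler_wpM2l; first by rewrite mulr_ge0// exprn_ge0.
        by rewrite lerXn2r ?nnegrE//; lra.
      apply: (le_trans (lerD IHm h1)).
      by rewrite le_eqVlt; apply/orP; left; apply/eqP; rewrite [(1 / 2) ^+ m.+1]exprS; field.
    have hw : cabs (p + w - p) < e.
      by rewrite addrAC subrr add0r wt; move: tr; rewrite /rho; lra.
    have := h _ hw; rewrite g0 ?t0// addrAC subrr add0r => hn.
    have hn' : null (fun m => cabs (psum a w (k.+1 + m)%N - 0)).
      exact: (null_shiftn k.+1 hn).
    have key : cabs (a k) * t ^+ k - 2 * M * q ^+ k.+1 <= 0.
      apply: null_ge hn' => m; rewrite subr0.
      have h1 := tl m.
      have h2 : cabs (a k * w ^+ k) <= cabs (psum a w (k.+1 + m)%N) +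
          cabs (psum a w (k.+1 + m)%N - a k * w ^+ k).
        by rewrite -{1}(subKr (psum a w (k.+1 + m)%N) (a k * w ^+ k)) cabsB.
      move: h2; rewrite cabsM cabsX wt => h2.
      have h3 : 2 * M * q ^+ k.+1 * (1 - (1 / 2) ^+ m) <= 2 * M * q ^+ k.+1.
        rewrite ler_piMr// ?mulr_ge0 ?exprn_ge0// lerBlDr lerDl exprn_ge0//; lra.
      lra.
    have tk : 0 < t ^+ k by rewrite exprn_gt0.
    rewrite -(ler_pM2r tk); move: key; rewrite subr_le0 => /le_trans; apply.
    by rewrite /q expr_div_n exprS le_eqVlt; apply/orP; left; apply/eqP; ring.
  apply/eqP; rewrite -cabs_eq0 eq_le cabs_ge0 andbT.
  pose C := 2 * M / rho ^+ k.+1.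
  have C0 : 0 <= C by rewrite divr_ge0 ?mulr_ge0// exprn_ge0// ltW.
  rewrite leNgt; apply/negP => ak.
  pose t := Num.min (Num.min (rho / 2) (del / 2)) (cabs (a k) / (2 * (C + 1))).
  have t0 : 0 < t.
    rewrite !lt_min; apply/andP; split; first by apply/andP; split; lra.
    by apply: divr_gt0 => //; apply: mulr_gt0 => //; lra.
  have := tail t t0; rewrite {1}/t !ge_min lexx /= => /(_ isT).
  have td : t < del.
    by rewrite /t !gt_min; apply/orP; left; apply/orP; right; lra.
  move=> /(_ td).
  have tC : t * (2 * (C + 1)) <= cabs (a k).
    rewrite -ler_pdivlMr; first by rewrite /t ge_min lexx orbT.
    by apply: mulr_gt0 => //; lra.
  rewrite mulrAC -/C => h1.
  have tC0 : 0 <= t * C by rewrite mulr_ge0// ltW.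
  nra.
exists e => // z /h hn.
have : cabs (g z) <= 0.
  apply: null_ge hn => n; rewrite /psum big1 ?sub0r ?cabsN// => k _.
  by rewrite a0 mul0r.
by rewrite le_eqVlt ltNge cabs_ge0 orbF cabs_eq0 => /eqP.
Qed.

(** The infimum of the heights above which [g] vanishes cannot be positive:
by [analytic_zero], [g] vanishes in a whole disc around it. *)
Lemma vertical_identity g (x y0 : R) :
  (forall y, 0 <= y -> analytic_at g (x +i* y)) ->
  (forall y, y0 < y -> g (x +i* y) = 0) -> g (x +i* 0) = 0.
Proof.
move=> ag g0.
pose S := [set y : R | 0 <= y /\ forall y', y < y' -> g (x +i* y') = 0].
have Sne : S !=set0.
  exists (Num.max y0 0); split; first by rewrite le_max lexx orbT.
  by move=> y'; rewrite gt_max => /andP[h _]; exact: g0.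
have Slb : has_lbound S by exists 0 => y [].
have hS : has_inf S by split.
pose ys := inf S.
have ys0 : 0 <= ys by apply: lb_le_inf => // y [].
have above y : ys < y -> g (x +i* y) = 0.
  by move=> ysy; have [s [_ hs] sy] := inf_lt Sne ysy; exact: hs.
have line (y t : R) : x +i* y + 'i%C * t%:C = x +i* (y + t).
  by apply: complex_eqP; rewrite !ReIm /=; ring.
have [e e0 he] : exists2 e : R, 0 < e & forall z, cabs (z - (x +i* ys)) < e -> g z = 0.
  apply: (analytic_zero ltr01 (ag _ ys0)) => t /andP[t0 _].
  by rewrite line above// ltrDl.
have [ysE|yspos] := eqVneq ys 0.
  by rewrite -ysE; apply: he; rewrite subrr cabs0.
pose y1 := Num.max 0 (ys - e / 2).
have y1s : y1 < ys.
  rewrite gt_max lt_def yspos ys0/=; lra.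
suff Sy1 : S y1 by have := ge_inf Slb Sy1; rewrite leNgt y1s.
split; first by rewrite le_max lexx.
move=> y'; rewrite gt_max => /andP[_ yy'].
have [h|h] := ltP ys y'; first exact: above.
apply: he; have -> : (x +i* y') - (x +i* ys) = 'i%C * (y' - ys)%:C.
  by apply: complex_eqP; rewrite !ReIm /=; ring.
by rewrite cabsM cabs_i mul1r cabs_real ler0_norm ?subr_le0//; lra.
Qed.

End identity.

(** * Fourier inversion for twice differentiable functions of bounded support *)

Section fourier.
Variable R : realType.
Local Notation mu := (@lebesgue_measure R).
Local Notation mR := (measurableTypeR R).
Implicit Types phi g : R -> R[i].

Definition supported (L : R) g : Prop := forall v, L < `|v| -> g v = 0.

Lemma continuous_cabs g : ccontinuous g -> continuous (fun v => cabs (g v)).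
Proof.
move=> [g1 g2] v; rewrite /cabs.
apply: (@continuous_comp _ _ _
  (fun v => complex.Re (g v) ^+ 2 + complex.Im (g v) ^+ 2) (@Num.sqrt R)).
  by apply: cvgD; apply: cvgM; [exact: g1|exact: g1|exact: g2|exact: g2].
exact: sqrt_continuous.
Qed.

Lemma supported_bounded L g : 0 <= L -> ccontinuous g -> supported L g ->
  exists2 M : R, 0 <= M & forall v, cabs (g v) <= M.
Proof.
move=> L0 cg sg.
have LL : - L <= L by lra.
have [c cL hc] := EVT_max LL (continuous_subspaceT (continuous_cabs cg)).
exists (cabs (g c)); first exact: cabs_ge0.
move=> v; have [h|h] := leP `|v| L.
  by apply: hc; rewrite in_itv/= -ler_norml.
by rewrite sg// cabs0 cabs_ge0.
Qed.

Lemma supported_decay L g : 0 <= L -> ccontinuous g -> supported L g ->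
  exists K : R, forall v, cabs (g v) <= K / (1 + v ^+ 2).
Proof.
move=> L0 cg sg; have [M M0 hM] := supported_bounded L0 cg sg.
exists (M * (1 + L ^+ 2)) => v.
have p1 : 0 < 1 + v ^+ 2 by rewrite ltr_pwDl// sqr_ge0.
rewrite ler_pdivlMr//; have [h|h] := leP `|v| L.
  apply: ler_pM; rewrite ?cabs_ge0// ?(ltW p1)// lerD2l.
  by rewrite -(real_normK (num_real v)) lerXn2r ?nnegrE.
by rewrite sg// cabs0 mul0r mulr_ge0// addr_ge0// sqr_ge0.
Qed.

Lemma supported_cintegrable L g : 0 <= L -> ccontinuous g -> supported L g ->
  cintegrable mu setT g.
Proof.
move=> L0 cg sg; have [K hK] := supported_decay L0 cg sg.
apply: (cintegrable_le (ccontinuous_cmeas cg) (rintegrableZ K (cauchy_weight R).1)).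
exact: hK.
Qed.

Lemma supported_cderiv L phi phi' : cderiv phi phi' -> supported L phi ->
  supported L phi'.
Proof.
move=> dphi sphi v Lv.
have near0 : \forall y \near v, phi y = 0.
  near=> y; apply: sphi; near: y.
  by apply: (cvgr_gt `|v|) => //; exact: norm_continuous.
have [d1 d2] := dphi v.
have z (h : R -> R) : (\forall y \near v, h y = 0) -> 'D_1 h v = 0.
  move=> h0; have -> : 'D_1 h v = 'D_1 (cst (0 : R)) v.
    exact: near_eq_derive.
  exact: derive_cst.
apply: complex_eqP.
- rewrite -(@derive_val _ _ _ _ _ _ _ d1); apply: z.
  by apply: filterS near0 => y ->.
- rewrite -(@derive_val _ _ _ _ _ _ _ d2); apply: z.
  by apply: filterS near0 => y ->.
Unshelve. all: by end_near. Qed.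

Definition fourier phi (lam : R) : R[i] :=
  cintegral mu setT (fun v : R => phi v * cexp (- ('i%C * lam%:C) * v%:C)).

Lemma cabs_cexp_i (lam v : R) : cabs (cexp (- ('i%C * lam%:C) * v%:C)) = 1.
Proof. by rewrite cabs_exp ReZ !ReIm /= -expR0; congr expR; ring. Qed.

Lemma supported_mul L phi g : supported L phi -> supported L (fun v => phi v * g v).
Proof. by move=> s v /s ->; rewrite mul0r. Qed.

(** Two integrations by parts, in the form of one exact derivative, express
[(1 + lam ^ 2) * fourier phi lam] as the transform of [phi - phi2]. *)
Lemma fourier_decay L phi phi1 phi2 : 0 <= L -> supported L phi ->
  cderiv phi phi1 -> cderiv phi1 phi2 -> ccontinuous phi2 ->
  exists K : R, forall lam, cabs (fourier phi lam) <= K / (1 + lam ^+ 2).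
Proof.
move=> L0 s0 d0 d1 c2.
have s1 := supported_cderiv d0 s0; have s2 := supported_cderiv d1 s1.
have c0 := cderiv_continuous d0; have c1 := cderiv_continuous d1.
have i0 := supported_cintegrable L0 c0 s0; have i2 := supported_cintegrable L0 c2 s2.
exists (2 * \int[mu]_v (cabs (phi v) + cabs (phi2 v))) => lam.
have p1 : 0 < 1 + lam ^+ 2 by rewrite ltr_pwDl// sqr_ge0.
pose e (v : R) := cexp (- ('i%C * lam%:C) * v%:C).
have de := cderiv_cexp (cderiv_linear (- ('i%C * lam%:C))).
have ce := cderiv_continuous de.
have ci (phi' : R -> R[i]) : ccontinuous phi' -> supported L phi' ->
    cintegrable mu setT (fun v => phi' v * e v).
  move=> cp sp; apply: (supported_cintegrable L0); first exact: ccontinuousM.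
  exact: supported_mul.
have parts : cintegral mu setT (fun v => (phi2 v + (lam ^+ 2)%:C * phi v) * e v) = 0.
  pose G v := (phi1 v + 'i%C * lam%:C * phi v) * e v.
  have dG : cderiv G (fun v => (phi2 v + (lam ^+ 2)%:C * phi v) * e v).
    have dc : cderiv (fun=> 'i%C * lam%:C : R[i]) (fun=> 0).
      by move=> x; split; exact: is_derive_cst.
    apply: (cderiv_ext _ (cderivM (cderivD d1 (cderivM dc d0)) de)) => v.
    rewrite -/(e v) mul0r add0r rmorphXn.
    have i2' : 'i%C * 'i%C = -1 :> R[i] by rewrite -expr2 sqr_i.
    have -> : (phi2 v + 'i%C * lam%:C * phi1 v) * e v +
      (phi1 v + 'i%C * lam%:C * phi v) * (- ('i%C * lam%:C) * e v) =
      (phi2 v - ('i%C * 'i%C) * lam%:C ^+ 2 * phi v) * e v by ring.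
    by rewrite i2'; ring.
  have G0 (x : R) : L < `|x| -> G x = 0.
    by move=> Lx; rewrite /G s1// s0// mulr0 addr0 mul0r.
  have Ginf (u : nat -> R) : (forall n, `|u n| = n.+1%:R) ->
      (fun n => cabs (G (u n))) @ \oo --> (0 : R).
    move=> un; apply: cvg_near_cst; exists (Num.truncn L) => // n /= hn.
    rewrite G0 ?cabs0// un; apply: (lt_le_trans (truncnS_gt L)).
    by rewrite ler_nat.
  apply: (cintegral_derive0 dG).
  - apply: ccontinuousM => //; apply: ccontinuousD => //.
    by apply: ccontinuousM => //; exact: ccontinuous_cst.
  - apply: ci.
      apply: ccontinuousD => //.
      by apply: ccontinuousM => //; exact: ccontinuous_cst.
    by move=> v Lv; rewrite s2// s0// mulr0 addr0.
  - by apply: Ginf => n; rewrite normr_nat.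
  - by apply: Ginf => n; rewrite normrN normr_nat.
have E : (1 + lam ^+ 2)%:C * fourier phi lam =
    cintegral mu setT (fun v => (phi v - phi2 v) * e v).
  rewrite /fourier -cintegralZ; last exact: ci.
  rewrite -[LHS]subr0 -parts -cintegralB.
  - by apply: eq_cintegral => v; rewrite -/(e v) rmorphD rmorph1; ring.
  - by apply: cintegrableZ; exact: ci.
  - apply: ci.
      apply: ccontinuousD => //.
      by apply: ccontinuousM => //; exact: ccontinuous_cst.
    by move=> v Lv; rewrite s2// s0// mulr0 addr0.
rewrite ler_pdivlMr// mulrC -{1}(gtr0_norm p1) -cabs_real -cabsM E.
apply: cabs_cintegral_le.
- have := cintegrableD (ci _ c0 s0) (cintegrableZ (-1) (ci _ c2 s2)).
  by apply: eq_cintegrable => v; ring.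
- by apply: rintegrableD; exact: rintegrable_cabs.
- by move=> v; rewrite cabsM cabs_cexp_i mulr1 cabsB.
Qed.

Lemma halfline_exp (c : R[i]) : complex.Re c < 0 ->
  let f := fun lam : R => if 0 <= lam then cexp (c * lam%:C) else 0 in
  cintegrable mu setT f /\ cintegral mu setT f = - c^-1.
Proof.
move=> c0 f.
have cn0 : c != 0 by apply: contraTneq c0 => ->; rewrite ltxx.
have mD : measurable (`[0, +oo[%classic : set mR) by exact: measurable_itv.
pose e (v : R) := cexp (c * v%:C).
have [pi pe] := cintegral_patch mu e mD.
have fE : (fun x : mR => if x \in `[0, +oo[%classic then e x else 0) = f.
  apply/funext => x; rewrite /f; congr (if _ then _ else _).
  by apply/idP/idP; rewrite inE /= in_itv/= andbT.
have mf : cmeas (f : mR -> R[i]).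
  rewrite (_ : f = fun x : mR => (\1_(`[0, +oo[%classic : set mR) x)%:C * e x).
    apply: cmeasM; first by apply: cmeas_real; exact: measurable_indic.
    by apply: cmeas_cexp; exact: cmeas_linear.
  apply/funext => x; rewrite -fE indicE; case: (x \in _).
    by rewrite rmorph1 mul1r.
  by rewrite rmorph0 mul0r.
have fi : cintegrable mu setT f.
  have h := @rintegrable_expRN_abs R (- complex.Re c).
  rewrite oppr_gt0 in h; apply: (cintegrable_le mf (h c0)) => v.
  rewrite /f; case: ifPn => [v0|_]; last by rewrite cabs0 expR_ge0.
  by rewrite cabs_exp ReZ ger0_norm// mulNr opprK.
split => //.
have cup : \bigcup_n `[(0 : R), n.+1%:R]%classic = `[0, +oo[%classic.
  apply/seteqP; split => [x [n _] /=|x /=]; rewrite !in_itv/= ?andbT.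
    by move=> /andP[].
  move=> x0; exists (Num.truncn x) => //=; rewrite in_itv/= x0 ltW//.
  exact: truncnS_gt.
rewrite -fE -pe -cup.
have dG : cderiv (fun v => c^-1 * e v) e.
  have dc : cderiv (fun=> c^-1 : R[i]) (fun=> 0).
    by move=> x; split; exact: is_derive_cst.
  apply: (cderiv_ext _ (cderivM dc (cderiv_cexp (cderiv_linear c)))) => v.
  by rewrite mul0r add0r -/(e v) mulKf.
apply: (cintegral_derive (a := fun=> 0) (b := fun n => n.+1%:R) dG).
- exact: (cderiv_continuous (cderiv_cexp (cderiv_linear c))).
- by move=> n; rewrite ltr0n.
- apply/nondecreasing_seqP => n; apply/subsetPset => x /=.
  rewrite !in_itv/= => /andP[-> h]; apply: (le_trans h); by rewrite ler_nat.
- by rewrite cup; apply/pi; rewrite fE.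
apply/cvg_cabsP.
have cp : 0 < - complex.Re c by rewrite oppr_gt0.
apply: null_le (expRN_nat_cvg0 (cabs c^-1) cp) => n; rewrite cabs_ge0 /=.
rewrite /e mulr0 cexp0 mulr1 opprK subrK cabsM cabs_exp ReZ.
by rewrite mulNr opprK.
Qed.

(** Each half-line contributes the reciprocal of [eps -+ i y]. *)
Lemma poisson_kernel (eps y : R) : 0 < eps ->
  let f := fun lam : R => (expR (- (eps * `|lam|)))%:C * cexp ('i%C * y%:C * lam%:C) in
  cintegral mu setT f = (2 * eps / (eps ^+ 2 + y ^+ 2))%:C.
Proof.
move=> eps0 f.
pose c1 : R[i] := (- eps) +i* y; pose c2 : R[i] := (- eps) +i* (- y).
have e1 : complex.Re c1 < 0 by rewrite oppr_lt0.
have e2 : complex.Re c2 < 0 by rewrite oppr_lt0.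
have [i1 h1] := halfline_exp e1; have [i2 h2] := halfline_exp e2.
set f1 := (X in cintegrable _ _ X) in i1 h1.
set f2 := (X in cintegrable _ _ X) in i2 h2.
have H := @changes_measure_opp R.
have mopp : measurable_fun setT (fun x : mR => - x : mR) by exact: oppr_measurable.
have i2' := (transfer_cintegrable mopp ltr01 H (cintegrable_meas i2)).1 i2.
have h2' := transfer_cintegral mopp ltr01 H i2.
have [_ ->] : cintegrable mu setT f /\ cintegral mu setT f =
    cintegral mu setT (fun x => f1 x + (f2 \o -%R) x).
  apply: cintegral_off0; last exact: cintegrableD.
  move=> x x0; rewrite /f /f1 /f2 /= oppr_ge0 -cexp_real -cexpD.
  case: ltrgt0P x0 => // x0 _; rewrite ?addr0 ?add0r; congr cexp;
    by apply: complex_eqP; rewrite !ReIm /=; ring.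
rewrite cintegralD//; move: h2'; rewrite rmorph1 mul1r => <-; rewrite h1 h2.
have n0 : eps ^+ 2 + y ^+ 2 != 0 by rewrite gt_eqF// ltr_pwDl ?sqr_ge0// exprn_gt0.
by apply: complex_eqP => /=; field; rewrite ?sqrrN.
Qed.

End fourier.

Section inversion.
Variable R : realType.
Local Notation mu := (@lebesgue_measure R).
Local Notation mR := (measurableTypeR R).
Variables (L : R) (phi phi1 phi2 : R -> R[i]).
Hypotheses (L0 : 0 <= L) (s0 : supported L phi).
Hypotheses (d0 : cderiv phi phi1) (d1 : cderiv phi1 phi2) (c2 : ccontinuous phi2).

Let c0 : ccontinuous phi. Proof. exact: cderiv_continuous d0. Qed.
Let i0 : cintegrable mu setT phi. Proof. exact: supported_cintegrable L0 c0 s0. Qed.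
Let m0 : cmeas (phi : mR -> R[i]). Proof. exact: ccontinuous_cmeas. Qed.

(** The Fourier inversion integral as a double integral in [(v, lam)], made
absolutely convergent by the factor [exp (- eps |lam|)]. *)
Let damp (eps x : R) (z : mR * mR) : R[i] :=
  phi z.1 * ((expR (- (eps * `|z.2|)))%:C * cexp ('i%C * (x - z.1)%:C * z.2%:C)).

Let dampi eps x : 0 < eps -> cintegrable (mu \x mu)%E setT (damp eps x).
Proof.
move=> eps0.
have [i _] := cintegral_prod i0 (cintegrable_real (rintegrable_expRN_abs eps0)).
have mn : measurable_fun setT (fun z : mR * mR => expR (- (eps * `|z.2|))).
  have /measurable_int /measurable_EFinP m := rintegrable_expRN_abs eps0.
  exact: (measurableT_comp m measurable_snd).
have mz2 : cmeas (fun z : mR * mR => (z.2 : R)%:C).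
  by apply: cmeas_real; exact: measurable_snd.
have mz1 : cmeas (fun z : mR * mR => (x - z.1 : R)%:C).
  apply: cmeas_real; apply: measurable_funB; first exact: measurable_cst.
  exact: measurable_fst.
have mc : cmeas (fun z : mR * mR => cexp ('i%C * (x - z.1)%:C * z.2%:C)).
  apply: cmeas_cexp; apply: cmeasM => //; apply: cmeasM => //; exact: cmeas_cst.
apply: cintegrable_domin i _.
  apply: cmeasM; first exact: (cmeas_comp m0 measurable_fst).
  by apply: cmeasM => //; exact: cmeas_real.
move=> z; rewrite /damp mulrA [leLHS]cabsM cabs_exp.
rewrite (_ : complex.Re _ = 0) ?expR0 ?mulr1//.
by rewrite !ReIm /=; ring.
Qed.

Let dampE eps x lam : cintegral mu setT (fun v => damp eps x (v, lam)) =
  (expR (- (eps * `|lam|)))%:C * (fourier phi lam * cexp ('i%C * lam%:C * x%:C)).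
Proof.
rewrite /fourier mulrCA mulrC -cintegralZ.
  apply: eq_cintegral => v; rewrite /damp /=.
  have -> : cexp ('i%C * (x - v)%:C * lam%:C) =
      cexp ('i%C * lam%:C * x%:C) * cexp (- ('i%C * lam%:C) * v%:C).
    by rewrite -cexpD rmorphB /=; congr cexp; ring.
  by ring.
apply: (supported_cintegrable L0); last exact: supported_mul.
apply: ccontinuousM => //.
exact: (cderiv_continuous (cderiv_cexp (cderiv_linear _))).
Qed.

(** The transform damped by [exp (- |lam|)] is measurable by Fubini's theorem. *)
Let fourier_meas : cmeas (fourier phi : mR -> R[i]).
Proof.
have mE := cmeas_fubini2 (dampi 0 ltr01).
have mw : cmeas (fun lam : mR => (expR `|lam|)%:C).
  by apply: cmeas_real; apply: (measurableT_comp (@measurable_expR R));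
    exact: normr_measurable.
have -> : fourier phi = fun lam => (expR `|lam|)%:C *
    cintegral mu setT (fun v => damp 1 0 (v, lam)).
  apply/funext => lam; rewrite dampE mul1r mulr0 cexp0 mulr1 mulrA.
  by rewrite -rmorphM /= -expRD subrr expR0 mul1r.
exact: cmeasM.
Qed.

Let fourieri x : cintegrable mu setT
  (fun lam => fourier phi lam * cexp ('i%C * lam%:C * x%:C)).
Proof.
have [K hK] := fourier_decay L0 s0 d0 d1 c2.
have mi : cmeas (fun lam : mR => 'i%C * lam%:C * x%:C : R[i]).
  by apply: cmeasM; [exact: cmeas_linear|exact: cmeas_cst].
apply: (cintegrable_le _ (rintegrableZ K (cauchy_weight R).1)).
  by apply: cmeasM; [exact: fourier_meas|exact: cmeas_cexp].
move=> lam; rewrite cabsM cabs_exp (_ : complex.Re _ = 0) ?expR0 ?mulr1//.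
by rewrite !ReIm /=; ring.
Qed.

Let poisson eps x : 0 < eps ->
  cintegral mu setT (fun lam => (expR (- (eps * `|lam|)))%:C *
    (fourier phi lam * cexp ('i%C * lam%:C * x%:C))) =
  cintegral mu setT (fun u => phi (eps * u + x) * (2 / (1 + u ^+ 2))%:C).
Proof.
move=> eps0; have di := dampi x eps0.
under eq_fun do rewrite -dampE.
rewrite (cintegral_fubini2 di) -(cintegral_fubini1 di).
pose h (v : R) := phi v * (2 * eps / (eps ^+ 2 + (x - v) ^+ 2))%:C.
have hE v : cintegral mu setT (fun lam => damp eps x (v, lam)) = h v.
  rewrite /damp /= cintegralZ; last first.
    have mc : cmeas (fun lam : mR => (expR (- (eps * `|lam|)))%:C *
        cexp ('i%C * (x - v)%:C * lam%:C)).
      apply: cmeasM; last by apply: cmeas_cexp; exact: cmeas_linear.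
      apply: cmeas_real; apply/measurable_EFinP.
      by have /measurable_int := rintegrable_expRN_abs eps0.
    apply: (cintegrable_le mc (rintegrable_expRN_abs eps0)) => lam.
    rewrite cabsM cabs_exp (_ : complex.Re _ = 0) ?expR0 ?mulr1.
      by rewrite cabs_real ger0_norm ?expR_ge0.
    by rewrite !ReIm /=; ring.
  by rewrite poisson_kernel.
rewrite (eq_cintegral _ hE).
have ch : ccontinuous h.
  apply: ccontinuousM => //; apply: ccontinuous_real => v.
  have cd : {for v, continuous (fun v : R => eps ^+ 2 + (x - v) ^+ 2)}.
    apply: cvgD; first exact: cvg_cst.
    by apply: cvgM; apply: cvgB; (exact: cvg_cst || exact: cvg_id).
  apply: cvgM; first exact: cvg_cst.
  apply: cvgV => //.
  by rewrite gt_eqF// ltr_pwDl ?sqr_ge0// exprn_gt0.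
have hi : cintegrable mu setT h.
  by apply: (supported_cintegrable L0 ch); exact: supported_mul.
rewrite (transfer_cintegral (measurable_affine eps x) eps0
  (@changes_measure_affine R eps x eps0) hi).
rewrite -cintegralZ; last first.
  exact: (transfer_cintegrable (measurable_affine eps x) eps0
    (@changes_measure_affine R eps x eps0) (cintegrable_meas hi)).1.
apply: eq_cintegral => u; rewrite /h /= mulrCA -rmorphM; congr (_ * _%:C).
have p1 : 1 + u ^+ 2 != 0 by rewrite gt_eqF// ltr_pwDl// sqr_ge0.
have e1 : eps != 0 by rewrite gt_eqF.
have -> : x - (eps * u + x) = - (eps * u) by ring.
have -> : eps ^+ 2 + (- (eps * u)) ^+ 2 = eps ^+ 2 * (1 + u ^+ 2) by ring.
by field; rewrite p1 e1.
Qed.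

(** Abel summation: the damped integral is a Poisson integral of [phi], and
both sides converge by domination as the damping is removed. *)
Lemma fourier_inversion x :
  cintegrable mu setT (fun lam => fourier phi lam * cexp ('i%C * lam%:C * x%:C)) /\
  cintegral mu setT (fun lam => fourier phi lam * cexp ('i%C * lam%:C * x%:C)) =
  (2 * pi)%:C * phi x.
Proof.
split; first exact: fourieri.
pose f lam := fourier phi lam * cexp ('i%C * lam%:C * x%:C).
pose ep (k : nat) : R := k.+1%:R^-1.
have ep0 k : 0 < ep k by rewrite invr_gt0 ltr0n.
have epcv : ep @ \oo --> (0 : R) by exact: cvg_harmonic.
have fi : cintegrable mu setT f := fourieri x.
have lim1 : (fun k => cintegral mu setT
      (fun lam => (expR (- (ep k * `|lam|)))%:C * f lam) : R[i]^o) @ \oo -->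
    (cintegral mu setT f : R[i]^o).
  apply: (@cvg_cintegral _ mR R mu _ f (fun lam => cabs (f lam))).
  - move=> k; apply: cmeasM; last exact: cintegrable_meas fi.
    apply: cmeas_real; apply/measurable_EFinP.
    by have /measurable_int := rintegrable_expRN_abs (ep0 k).
  - exact: cintegrable_meas fi.
  - move=> lam; apply/cvg_cabsP.
    have ce : (fun k => expR (- (ep k * `|lam|))) @ \oo --> (1 : R).
      rewrite -[X in _ --> X]expR0 -oppr0 -(mul0r `|lam|).
      apply: continuous_cvg; first exact: continuous_expR.
      by apply: cvgN; apply: cvgM => //; exact: cvg_cst.
    have h : null (fun k => `|expR (- (ep k * `|lam|)) - 1|).
      by apply/norm_cvg0P; apply/subr_cvg0.
    apply: null_le (nullZ (cabs (f lam)) h) => k; rewrite cabs_ge0 /=.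
    rewrite -{2}[f lam]mul1r -mulrBl -(rmorph1 (real_complex R)) -rmorphB.
    by rewrite cabsM cabs_real mulrC.
  - exact: rintegrable_cabs fi.
  - move=> k lam; rewrite cabsM cabs_real ger0_norm ?expR_ge0//.
    rewrite ler_piMl ?cabs_ge0// expR_le1 oppr_le0 mulr_ge0//.
    exact: ltW.
have [M M0 hM] := supported_bounded L0 c0 s0.
have mw : measurable_fun setT (fun u : mR => 2 / (1 + u ^+ 2) : mR).
  apply/measurable_EFinP.
  by have /measurable_int := rintegrableZ 2 (cauchy_weight R).1.
have lim2 : (fun k => cintegral mu setT
      (fun u => phi (ep k * u + x) * (2 / (1 + u ^+ 2))%:C) : R[i]^o) @ \oo -->
    (cintegral mu setT (fun u => phi x * (2 / (1 + u ^+ 2))%:C) : R[i]^o).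
  apply: (@cvg_cintegral _ mR R mu _ _ (fun u => M * (2 * (1 + u ^+ 2)^-1))).
  - move=> k; apply: cmeasM; last exact: cmeas_real.
    exact: (cmeas_comp m0 (measurable_affine _ _)).
  - by apply: cmeasM; [exact: cmeas_cst|exact: cmeas_real].
  - move=> u; have [cr ci] := c0.
    have cx : (fun k => ep k * u + x) @ \oo --> x.
      rewrite -[X in _ --> X]add0r -(mul0r u); apply: cvgD; last exact: cvg_cst.
      by apply: cvgM => //; exact: cvg_cst.
    have h : (fun k => phi (ep k * u + x) : R[i]^o) @ \oo --> (phi x : R[i]^o).
      apply: cvg_ReIm.
      + exact: (cvg_comp _ _ cx (cr x)).
      + exact: (cvg_comp _ _ cx (ci x)).
    apply/cvg_cabsP; move/cvg_cabsP : h => h.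
    apply: null_le (nullZ (cabs (2 / (1 + u ^+ 2))%:C) h) => k.
    by rewrite cabs_ge0 /= -mulrBl cabsM mulrC.
  - by do 2 apply: rintegrableZ; exact: (cauchy_weight R).1.
  - move=> k u; rewrite cabsM cabs_real ger0_norm.
      by rewrite ler_wpM2r// divr_ge0// addr_ge0// sqr_ge0.
    by rewrite divr_ge0// addr_ge0// sqr_ge0.
have E k : cintegral mu setT (fun lam => (expR (- (ep k * `|lam|)))%:C * f lam) =
    cintegral mu setT (fun u => phi (ep k * u + x) * (2 / (1 + u ^+ 2))%:C).
  exact: poisson.
rewrite (funext E) in lim1.
have e2 : cintegral mu setT (fun u => phi x * (2 / (1 + u ^+ 2))%:C) =
    (2 * pi)%:C * phi x.
  have [cw ew] := cauchy_weight R.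
  rewrite cintegralZ; last exact: (cintegrable_real (rintegrableZ 2 cw)).
  by rewrite cintegral_real RintegralZl// ew mulrC.
rewrite -e2; apply: complex_eqP.
- by rewrite -(cvg_lim _ (cvg_Re lim1))// -(cvg_lim _ (cvg_Re lim2)).
- by rewrite -(cvg_lim _ (cvg_Im lim1))// -(cvg_lim _ (cvg_Im lim2)).
Qed.

End inversion.

(** * Meromorphic continuation in the spectral parameter *)

Section continuation.
Variables (R : realType) (m : nat).
Local Notation mu := (@lebesgue_measure R).
Local Notation mR := (measurableTypeR R).
Local Notation nu := (@lebesgue_Rn R m.+1).
Local Notation dim := (m.+1%:R : R[i]).
Variables (F : R -> R[i]) (delta : R).
Hypotheses (gF : gauss_dominated F) (delta0 : 0 < delta).
Hypothesis F0 : forall t, 0 < t < delta -> F t = 0.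

(** The exponent in the kernel [|<x, (1, eta)>| ^ (- s)] of the transform. *)
Definition spec (z : R[i]) : R[i] := 'i%C * z + dim / 2.

Lemma ReV2 (w : R[i]) : complex.Re (w / 2) = complex.Re w / 2.
Proof.
by rewrite -(rmorph_nat (real_complex R)) -fmorphV ReZ.
Qed.

Lemma ImV2 (w : R[i]) : complex.Im (w / 2) = complex.Im w / 2.
Proof.
by rewrite -(rmorph_nat (real_complex R)) -fmorphV ImZ.
Qed.

Lemma Im_spec z : complex.Im (spec z) = complex.Re z.
Proof. by rewrite ImD ImV2 Im_nat ImM /= mul0r add0r mul1r mul0r addr0. Qed.

Lemma Re_spec z : complex.Re (spec z) = m.+1%:R / 2 - complex.Im z.
Proof. by rewrite ReD ReV2 Re_nat ReM /= mul0r mul1r sub0r addrC. Qed.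

(** Since [F] vanishes near the origin, division by [t ^ (2 N)] is harmless there;
it pays for a factor [|x_0| ^ (2 N)], which makes the kernel integrable across
the hyperplane [x_0 = 0]. *)
Definition divided N (t : R) : R[i] := F t * rpow t (- (2 * N%:R)).

Lemma gauss_dominated_divided N : gauss_dominated (divided N).
Proof.
have [mF [C FC]] := gF; split.
  apply: (@cmeasM _ mR) => //.
  exact: (@cmeas_rpow _ mR R (fun t => t) _ (@measurable_id _ mR setT)).
exists (C * (1 + expR (- (2 * N%:R) * ln delta))) => t.
have e0 : 0 <= expR (- (2 * N%:R) * ln delta) by exact: expR_ge0.
have C0 : 0 <= C * expR (- t ^+ 2) by apply: le_trans (FC t); exact: cabs_ge0.
rewrite cabsM cabs_rpow mulrAC.
have -> : complex.Re (- (2 * N%:R) : R[i]) = - (2 * N%:R).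
  by rewrite ReN -natrM Re_nat natrM.
have [td|td] := boolP (0 < t < delta).
  by rewrite F0// cabs0 mul0r mulr_ge0// addr_ge0.
apply: ler_pM; rewrite ?cabs_ge0 ?expR_ge0 ?FC//.
have [t0|t0] := leP t 0.
  by rewrite ln0// mulr0 expR0 lerDl.
apply: (@le_trans _ _ (expR (- (2 * N%:R) * ln delta))); last by rewrite lerDr.
rewrite ler_expR !mulNr lerN2 ler_wpM2l ?mulr_ge0//.
rewrite ler_ln ?posrE// leNgt; apply: contraNN td => ->.
by rewrite t0.
Qed.

Lemma mellin_divided N w : mellin (divided N) (w + 2 * N%:R) = mellin F w.
Proof.
apply: eq_cintegral => v; rewrite /mellin_term /divided /rpow expRK -mulrA -cexpD.
by congr (_ * cexp _); ring.
Qed.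

(** The comparison [radial_mellin] can be solved for the radial integral because
the Mellin transform of the Gaussian, a value of Gamma, has no zeros. *)
Lemma radial_value (F' : R -> R[i]) (s : R[i]) : gauss_dominated F' ->
  complex.Re s < 1 ->
  radial_integral m F' s = 2 * (Num.sqrt pi ^+ m)%:C *
    (euler_integral ((1 - s) / 2) / euler_integral ((dim - s) / 2)) *
    mellin F' (dim - s).
Proof.
move=> gF' s1; have d0 := dimB_gt0 m s1.
have [_ eg] := gauss_mellin d0; have [_ er] := radial_gaussian m s1.
have n0 : euler_integral ((dim - s) / 2) != 0.
  by apply: euler_neq0; rewrite ReV2 divr_gt0.
have := radial_mellin m gF' s1; rewrite er.
rewrite (_ : mellin (@gaussian R) (dim - s) = euler_integral ((dim - s) / 2) / 2)//.
move=> h; apply: (mulfI (mulf_neq0 n0 (_ : 2^-1 != 0))).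
  by rewrite invr_eq0 pnatr_eq0.
by rewrite h; field.
Qed.

(** The right-hand side of [radial_value] with Euler's integrals replaced by the
meromorphic function [cGamma]. *)
Definition continued (z : R[i]) : R[i] :=
  2 * (Num.sqrt pi ^+ m)%:C *
  (cGamma ((1 - spec z) / 2) / cGamma ((dim - spec z) / 2)) * mellin F (dim - spec z).

Definition shifted N (z : R[i]) : R[i] :=
  radial_integral m (divided N) (spec z - 2 * N%:R).

Lemma Re_spec_shift N z :
  complex.Re (spec z - 2 * N%:R) = complex.Re (spec z) - 2 * N%:R.
Proof. by rewrite ReD ReN -natrM Re_nat natrM. Qed.

(** The poles of the numerator and of the denominator of [continued], as points
of the [z]-plane. *)
Definition gamma_pole k : R[i] := 'i%C * (dim / 2 - (1 + 2 * k)%:R).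
Definition gamma_zero k : R[i] := - ('i%C * (dim / 2 + (2 * k)%:R)).

Lemma mulii : 'i%C * 'i%C = -1 :> R[i].
Proof. by rewrite -expr2 sqr_i. Qed.

Lemma pole_prod N z : \prod_(k < N) ((1 - spec z) / 2 + k%:R) =
  (- 'i%C / 2) ^+ N * \prod_(c <- map gamma_pole (index_iota 0 N)) (z - c).
Proof.
rewrite big_map big_mkord.
elim: N => [|N IH]; first by rewrite !big_ord0 expr0 mulr1.
rewrite !big_ord_recr /= IH exprSr.
have -> : (1 - spec z) / 2 + N%:R = - 'i%C / 2 * (z - gamma_pole N).
  rewrite /gamma_pole /spec natrD natrM.
  apply/eqP; rewrite -subr_eq0; apply/eqP.
  rewrite (_ : _ - _ = (1 + 'i%C * 'i%C) * (- dim / 2 / 2 + (1 + 2 * N%:R) / 2)).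
    by rewrite mulii subrr mul0r.
  by field.
by ring.
Qed.

Lemma nought_prod N z : \prod_(k < N) ((dim - spec z) / 2 + k%:R) =
  (- 'i%C / 2) ^+ N * \prod_(c <- map gamma_zero (index_iota 0 N)) (z - c).
Proof.
rewrite big_map big_mkord.
elim: N => [|N IH]; first by rewrite !big_ord0 expr0 mulr1.
rewrite !big_ord_recr /= IH exprSr.
have -> : (dim - spec z) / 2 + N%:R = - 'i%C / 2 * (z - gamma_zero N).
  rewrite /gamma_zero /spec natrM.
  apply/eqP; rewrite -subr_eq0; apply/eqP.
  rewrite (_ : _ - _ = (1 + 'i%C * 'i%C) * (dim / 2 / 2 + N%:R)).
    by rewrite mulii subrr mul0r.
  by field.
by ring.
Qed.

(** On the half-plane [Re s < 1 + 2 N] the continuation is a rational function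
times a convergent integral: shifting both Gamma factors by [N] amounts to
replacing [F] by [divided N F] and [s] by [s - 2 N]. *)
Lemma continuedE N z : complex.Re (spec z) < 1 + 2 * N%:R ->
  continued z = (\prod_(c <- map gamma_zero (index_iota 0 N)) (z - c)) * shifted N z /
    \prod_(c <- map gamma_pole (index_iota 0 N)) (z - c).
Proof.
move=> zN.
have s1 : complex.Re (spec z - 2 * N%:R) < 1 by rewrite Re_spec_shift; lra.
have rN : (0 : R) <= m%:R by [].
have g1 : 0 < complex.Re ((1 - spec z) / 2) + N%:R.
  by rewrite ReV2 ReD ReN /=; lra.
have g2 : 0 < complex.Re ((dim - spec z) / 2) + N%:R.
  by rewrite ReV2 Re_dimB -natr1; lra.
rewrite /continued (cGammaE g1) (cGammaE g2) /shifted.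
rewrite (radial_value (gauss_dominated_divided N) s1).
have -> : dim - (spec z - 2 * N%:R) = dim - spec z + 2 * N%:R by ring.
rewrite mellin_divided.
have -> : (1 - (spec z - 2 * N%:R)) / 2 = (1 - spec z) / 2 + N%:R by field.
have -> : (dim - spec z + 2 * N%:R) / 2 = (dim - spec z) / 2 + N%:R by field.
rewrite pole_prod nought_prod.
have i0 : (- 'i%C / 2 : R[i]) ^+ N != 0.
  rewrite expf_neq0// mulf_neq0 ?invr_eq0 ?pnatr_eq0//.
  by rewrite oppr_eq0 -cabs_gt0 cabs_i.
have cancel (I K E1 E2 P Q M : R[i]) : I != 0 ->
    K * (E1 / (I * P) / (E2 / (I * Q))) * M = Q * (K * (E1 / E2) * M) / P.
  move=> I0; rewrite !invfM !invrK.
  transitivity (I^-1 * I * (Q * (K * (E1 * E2^-1) * M) * P^-1)); first by ring.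
  by rewrite mulVf// mul1r.
exact: cancel.
Qed.

(** The integrand depends on [z] through [exp (- i z ln |x_0|)]. The exponents
[Re s +- eps] still lie in the domain of convergence, and the sum of the two
powers of [|x_0|] dominates the power with the factor [exp (eps |ln |x_0||)]. *)
Lemma analytic_shifted N p : complex.Re (spec p) < 1 + 2 * N%:R ->
  analytic_at (shifted N) p.
Proof.
move=> pN.
pose al : R[i] := 2 * N%:R - dim / 2; pose be : R[i] := - 'i%C.
pose u (x : m.+1.-tuple mR) : R := ln `|thead x|.
have sE z : - (spec z - 2 * N%:R) = al + be * z by rewrite /spec /al /be; ring.
have mdiv : cmeas (fun x : m.+1.-tuple mR => divided N (enorm x)).
  apply: (cmeas_comp _ (@measurable_enorm R m)).
  by have [] := gauss_dominated_divided N.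
have mabs : measurable_fun setT (fun x : m.+1.-tuple mR => `|thead x| : mR).
  exact: (measurableT_comp (@normr_measurable R setT) (@measurable_thead R m)).
have mln : measurable_fun setT u := measurableT_comp (@measurable_ln R) mabs.
pose sg := complex.Re (spec p) - 2 * N%:R.
pose eps := (1 - sg) / 2.
have sg1 : sg < 1 by rewrite /sg; lra.
have eps0 : 0 < eps by rewrite /eps; lra.
have Rep : complex.Re (al + be * p) = - sg by rewrite -sE ReN Re_spec_shift.
have int (t : R) : t < 1 -> rintegrable nu
    (fun x => cabs (divided N (enorm x)) * expR (- t * u x)).
  move=> t1; have := rintegrable_cabs (@cintegrable_radial R m (divided N) t%:C
    (gauss_dominated_divided N) t1).
  rewrite /rintegrable; congr (_.-integrable _ _); apply/funext => x /=.
  by rewrite /radial_term cabsM cabs_rpow.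
have h : rintegrable nu (fun x => cabs (divided N (enorm x)) *
    expR (complex.Re (al + be * p) * u x) * expR (eps * `|u x|)).
  have s1 : sg + eps < 1 by rewrite /eps; lra.
  have s2 : sg - eps < 1 by lra.
  apply: (rintegrable_le _ (rintegrableD (int _ s1) (int _ s2))).
    apply: measurable_funM.
      apply: measurable_funM; first exact: measurable_cabs.
      apply: (measurableT_comp (@measurable_expR R)).
      by apply: measurable_funM => //; exact: measurable_cst.
    apply: (measurableT_comp (@measurable_expR R)).
    apply: measurable_funM; first exact: measurable_cst.
    exact: (measurableT_comp (@normr_measurable R setT) mln).
  move=> x; rewrite ger0_norm ?mulr_ge0 ?cabs_ge0 ?expR_ge0//.
  rewrite -mulrDr -mulrA ler_wpM2l ?cabs_ge0// Rep -expRD.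
  have [u0|u0] := leP 0 (u x).
    rewrite ger0_norm//; apply: (@le_trans _ _ (expR (- (sg - eps) * u x))).
      by rewrite ler_expR [leLHS](_ : _ = - (sg - eps) * u x)//; ring.
    by rewrite lerDr expR_ge0.
  rewrite ltr0_norm//; apply: (@le_trans _ _ (expR (- (sg + eps) * u x))).
    by rewrite ler_expR [leLHS](_ : _ = - (sg + eps) * u x)//; ring.
  by rewrite lerDl expR_ge0.
have a := analytic_integral mdiv mln eps0 h.
apply: (analytic_ext ltr01 _ a) => z _.
by apply: eq_cintegral => x; rewrite /radial_term /rpow sE.
Qed.

Lemma spec_locally_bounded p : exists N : nat, complex.Re (spec p) < 1 + 2 * N%:R /\
  exists2 e : R, 0 < e & forall z, cabs (z - p) < e ->
    complex.Re (spec z) < 1 + 2 * N%:R.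
Proof.
pose N := (Num.truncn `|complex.Re (spec p)|).+1.
have hN : `|complex.Re (spec p)| < N%:R by exact: truncnS_gt.
have h0 := normr_ge0 (complex.Re (spec p)).
have h1 := ler_norm (complex.Re (spec p)).
exists N; split; first lra.
exists 1 => // z zp.
have : `|complex.Im (z - p)| < 1 by apply: le_lt_trans (norm_Im_le _) zp.
rewrite ImD ImN ltr_norml => /andP[h2 _].
rewrite Re_spec; move: hN h0 h1; rewrite Re_spec; lra.
Qed.

Lemma continued_meromorphic p : meromorphic_at continued p.
Proof.
have [N [pN [e e0 near]]] := spec_locally_bounded p.
have [l [g' [ag' gE]]] := meromorphic_div_prod (map gamma_pole (index_iota 0 N))
  (analytic_prod (map gamma_zero (index_iota 0 N)) (analytic_shifted pN)).
apply: meromorphicP; exists l, g'; split => //; exists e => // z zp /near zN.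
by rewrite -gE// (continuedE zN).
Qed.

Lemma continued_analytic p : ~ T_pole m p -> analytic_at continued p.
Proof.
move=> np; have [N [pN [e e0 near]]] := spec_locally_bounded p.
apply: (analytic_ext e0 (g := fun z => (\prod_(c <- map gamma_zero (index_iota 0 N)) (z - c)) *
  shifted N z / \prod_(c <- map gamma_pole (index_iota 0 N)) (z - c))).
  by move=> z /near zN; rewrite (continuedE zN).
apply: analytic_div_prod; last by apply: analytic_prod; exact: analytic_shifted.
apply/mapP => -[k _ pk]; apply: np; exists (1 + 2 * k)%N; split => //.
Qed.

Lemma continued_integral z : m.+1%:R / 2 - 1 < complex.Im z ->
  continued z = radial_integral m F (spec z).
Proof.
move=> zm; have z1 : complex.Re (spec z) < 1 by rewrite Re_spec; lra.
rewrite (radial_value gF z1) /continued !cGamma_euler//.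
- by rewrite ReV2 divr_gt0// dimB_gt0.
- by rewrite ReV2 divr_gt0// ReD ReN /= subr_gt0.
Qed.

End continuation.

(** * Rotation-invariant test functions *)

Section rotation_invariant.
Variables (R : realType) (m : nat).
Local Notation mR := (measurableTypeR R).
Implicit Types (v w : 'rV[R]_m.+1) (f : 'rV[R]_m.+1 -> R[i]).

Lemma dot_mulmx v w : v *m w^T = (dot v w)%:M.
Proof.
apply/matrixP => i j; rewrite !ord1 !mxE eqxx mulr1n /dot.
by apply: eq_bigr => k _; rewrite mxE.
Qed.

Lemma dot_ge0 v : 0 <= dot v v.
Proof. by apply: sumr_ge0 => i _; rewrite -expr2 sqr_ge0. Qed.

Lemma dot_eq0 v : dot v v = 0 -> v = 0.
Proof.
move=> /eqP; rewrite psumr_eq0; last by move=> i _; rewrite -expr2 sqr_ge0.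
move=> /allP h; apply/rowP => i; rewrite mxE.
by apply/eqP; have := h i (mem_index_enum _); rewrite -expr2 sqrf_eq0.
Qed.

Lemma dot_e0 v : dot v 'e_0 = v 0 0.
Proof.
rewrite /dot (bigD1 0)//= mxE !eqxx mulr1 big1 ?addr0// => i i0.
by rewrite mxE (negPf i0) andbF mulr0.
Qed.

(** The Householder reflection in the hyperplane orthogonal to [v - |v| e_0]
exchanges [v] and [|v| e_0]. *)
Lemma orthogonal_invariant_radial f v : orthogonal_invariant f ->
  f v = f (Num.sqrt (dot v v) *: 'e_0).
Proof.
move=> inv; set r := Num.sqrt (dot v v); set E : 'rV[R]_m.+1 := 'e_0.
have dotE x : dot x E = x 0 0 by exact: dot_e0.
have [w wE] : exists w, w = v - r *: E by exists (v - r *: E).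
have r2 : r ^+ 2 = dot v v by rewrite sqr_sqrtr ?dot_ge0.
have [w0|w0] := eqVneq w 0.
  by congr f; apply/eqP; rewrite -subr_eq0 -wE w0.
pose q := dot w w.
have q0 : q != 0 by apply: contraNneq w0 => /dot_eq0 ->.
have dotl (x y z : 'rV[R]_m.+1) a : dot (x - a *: y) z = dot x z - a * dot y z.
  rewrite /dot mulr_sumr -sumrB; apply: eq_bigr => i _; rewrite !mxE; ring.
have dotC (x y : 'rV[R]_m.+1) : dot x y = dot y x.
  by apply: eq_bigr => i _; rewrite mulrC.
have vw : dot v w = r ^+ 2 - r * v 0 0.
  by rewrite dotC wE dotl [dot E v]dotC dotE r2.
have e00 : dot E E = 1 by rewrite dotE mxE !eqxx.
have qE : q = 2 * dot v w.
  by rewrite /q {1}wE dotl vw [dot E w]dotC {1}wE dotl e00 dotE; ring.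
pose A : 'M[R]_m.+1 := 1%:M - (2 / q) *: (w^T *m w).
have AT : A^T = A.
  by rewrite /A linearB /= trmx1 linearZ /= trmx_mul trmxK.
have AA : A *m A^T = 1%:M.
  rewrite AT /A mulmxBl !mulmxBr !mul1mx mulmx1 -!scalemxAl -!scalemxAr.
  have -> : w^T *m w *m (w^T *m w) = q *: (w^T *m w).
    by rewrite mulmxA -[w^T *m w *m w^T]mulmxA dot_mulmx mul_mx_scalar -scalemxAl.
  have c0 : 2 / q + (2 / q - 2 / q * (2 / q) * q) = 0 by field.
  by rewrite !scalerA -scalerBl -addrA -opprD -scalerDl c0 scale0r subr0.
rewrite -(inv A AA v) AT /A mulmxBr mulmx1 -scalemxAr mulmxA dot_mulmx.
rewrite mul_scalar_mx scalerA (_ : 2 / q * dot v w = 1).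
  by rewrite scale1r wE opprB addrC subrK.
by rewrite qE; field; move: q0; rewrite qE mulf_eq0 negb_or => /andP[_ ->].
Qed.

Definition profile f (t : R) : R[i] := f (t *: 'e_0).

Lemma one_row0 v : dot v (one_row (0 : 'rV[R]_m)) = v 0 0.
Proof.
rewrite -dot_e0; apply: eq_bigr => i _; congr (_ * _).
rewrite /one_row [LHS]mxE [RHS]mxE eqxx /=.
case: splitP => j ij; rewrite mxE.
  by rewrite (ord1 j) in ij; rewrite -val_eqE /= ij.
by rewrite -val_eqE /= ij.
Qed.

Lemma T_integral0 f z : orthogonal_invariant f ->
  T_integral f z 0 = radial_integral m (profile f) (spec m z).
Proof.
move=> inv; apply: eq_cintegral => x.
rewrite /radial_term /= one_row0 mxE; congr (_ * _).
rewrite (orthogonal_invariant_radial _ inv) /profile /enorm /sqnorm /dot.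
by congr (f (Num.sqrt _ *: _)); apply: eq_bigr => i _; rewrite !mxE expr2.
Qed.

(** No pole has real part [lam], and on the vertical line through [lam] any two
continuations agree high up, where both are the defining integral. *)
Lemma T_continuation_unique f eta G1 G2 (lam : R) : lam != 0 ->
  is_T_continuation f eta G1 -> is_T_continuation f eta G2 ->
  G1 lam%:C = G2 lam%:C.
Proof.
move=> lam0 [e1 _ a1] [e2 _ a2]; apply/eqP; rewrite -subr_eq0; apply/eqP.
apply: (vertical_identity (g := fun z => G1 z - G2 z) (y0 := m.+1%:R / 2 - 1)).
- move=> y _; have np : ~ T_pole m (lam +i* y).
    move=> [j [_ /(congr1 (@complex.Re R))]]; move: lam0 => /eqP lam0.
    rewrite ReM /= mul0r sub0r mul1r ImD ImN Im_nat subr0.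
    have -> : complex.Im (m.+1%:R / 2 : R[i]) = 0.
      by rewrite -(rmorph_nat (real_complex R) 2) -fmorphV ImZ Im_nat mul0r.
    by rewrite oppr0.
  have := analyticZ (-1) (a2 _ np); move=> /(analyticD (a1 _ np)).
  by apply: (analytic_ext ltr01) => z _; rewrite mulN1r.
- by move=> y hy; rewrite e1// e2// subrr.
Qed.

End rotation_invariant.

Section regularity.
Variables (R : realType) (m : nat).
Local Notation mR := (measurableTypeR R).
Implicit Types (f : 'rV[R]_m.+1 -> R[i]).

Lemma is_derive_line (V : normedModType R) (g : V -> R) (v : V) (t : R) :
  derivable g (t *: v) v ->
  is_derive t (1 : R) (fun s : R => g (s *: v)) ('D_v g (t *: v)).
Proof.
have E : (fun h : R => h^-1 *: (((fun s : R => g (s *: v)) \o shift t) (h *: (1 : R)) -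
    g (t *: v))) = (fun h => h^-1 *: ((g \o shift (t *: v)) (h *: v) - g (t *: v))).
  by apply/funext => h /=; rewrite scalerDl /GRing.scale /= mulr1.
by move=> dg; apply: DeriveDef; rewrite /derivable /derive E.
Qed.

Lemma line_neq0 (t : R) : t != 0 -> (~` [set (0 : 'rV[R]_m.+1)]) (t *: 'e_0).
Proof.
move=> t0 /= /rowP /(_ 0); rewrite !mxE eqxx mulr1 => t00.
by move: t0; rewrite t00 eqxx.
Qed.

Lemma Ck_line (g : 'rV[R]_m.+1 -> R) : Ck_on (~` [set 0]) 2 g ->
  exists g1 g2 : R -> R, forall t, t != 0 ->
    [/\ is_derive t (1 : R) (fun s : R => g (s *: 'e_0)) (g1 t),
        is_derive t (1 : R) g1 (g2 t) & {for t, continuous g2}].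
Proof.
move=> [_ /(_ 0)[d1 [_ /(_ 0)[d2 c2]]]].
exists (fun t => 'D_('e_0) g (t *: 'e_0)).
exists (fun t => 'D_('e_0) ('D_('e_0) g) (t *: 'e_0)) => t /line_neq0 t0; split.
- exact: is_derive_line (d1 _ t0).
- exact: is_derive_line (d2 _ t0).
- exact: (cvg_comp _ _ (@scalel_continuous _ _ _ t) (c2 _ t0)).
Qed.

Lemma profile_support f : test_function f -> exists a b : R,
  [/\ 0 < a, 0 < b, forall t, `|t| < a -> profile f t = 0 &
      forall t, b < `|t| -> profile f t = 0].
Proof.
move=> [_ [K [cK K0 f0]]].
pose c := `|('e_0 : 'rV[R]_m.+1)|.
have c0 : 0 < c.
  by rewrite normr_gt0; have /eqP := line_neq0 (oner_neq0 R); rewrite scale1r.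
have nt t : `|t *: ('e_0 : 'rV[R]_m.+1)| = `|t| * c by rewrite normrZ.
have [M [_ hM]] := compact_bounded cK.
have oK : open (~` K) by apply: closed_openC; exact: compact_closed.
have /nbhs_normP[e /= e0 he] : nbhs (0 : 'rV[R]_m.+1) (~` K).
  exact: open_nbhs_nbhs.
exists (e / c), ((`|M| + 1) / c); split.
- by rewrite divr_gt0.
- by rewrite divr_gt0// ltr_pwDr.
- move=> t; rewrite ltr_pdivlMr// => tc; apply: f0; apply: he.
  by rewrite /= sub0r normrN nt.
- move=> t; rewrite ltr_pdivrMr// => tc; apply: f0 => Kt.
  have /hM /(_ _ Kt) : M < `|M| + 1 by rewrite (le_lt_trans (ler_norm M))// ltrDl.
  by rewrite /= nt leNgt tc.
Qed.

Lemma profile_continuous f : test_function f -> ccontinuous (profile f).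
Proof.
move=> tf; have [a [b [a0 _ fa _]]] := profile_support tf.
have [tf1 _] := tf; have [[cR _] [cI _]] := tf1 1%N.
have key (k : R[i] -> R) : k 0 = 0 ->
    (forall x, (~` [set (0 : 'rV[R]_m.+1)]) x -> {for x, continuous (fun x => k (f x))}) ->
    continuous (fun t => k (profile f t)).
  move=> k0 ck t; have [->|t0] := eqVneq t 0; last first.
    exact: (cvg_comp _ _ (@scalel_continuous _ _ _ t) (ck _ (line_neq0 t0))).
  rewrite /continuous_at fa ?normr0// k0; apply: cvg_near_cst.
  apply/nbhs_normP; exists a => // s /=; rewrite sub0r normrN => sa.
  by rewrite /= fa// k0.
split; first exact: (key (@complex.Re R)).
exact: (key (@complex.Im R)).
Qed.

Lemma profile_gauss_dominated f : test_function f -> gauss_dominated (profile f).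
Proof.
move=> tf; have cF := profile_continuous tf.
have [a [b [_ b0 _ fb]]] := profile_support tf.
split; first exact: ccontinuous_cmeas.
have [M M0 hM] := supported_bounded (ltW b0) cF fb.
exists (M * expR (b ^+ 2)) => t; rewrite -mulrA -expRD.
have [tb|tb] := leP `|t| b; last first.
  by rewrite fb// cabs0 mulr_ge0// expR_ge0.
apply: (le_trans (hM t)); rewrite ler_peMr// -expR0 ler_expR subr_ge0.
by rewrite -(real_normK (num_real t)) lerXn2r ?nnegrE// ltW.
Qed.

Lemma cderiv_expR (h h' : R -> R[i]) :
  (forall t : R, 0 < t ->
     is_derive t (1 : R) (fun s => complex.Re (h s)) (complex.Re (h' t)) /\
     is_derive t (1 : R) (fun s => complex.Im (h s)) (complex.Im (h' t))) ->
  cderiv (fun v => h (expR v)) (fun v => h' (expR v) * (expR v)%:C).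
Proof.
move=> dh v; have [d1 d2] := dh _ (expR_gt0 v).
rewrite ReZ ImZ; split.
- exact: (@is_derive1_comp _ (fun s => complex.Re (h s)) expR v _ _ d1).
- exact: (@is_derive1_comp _ (fun s => complex.Im (h s)) expR v _ _ d2).
Qed.

(** In the coordinate [v = ln t], vanishing near [0] and for large [t] becomes
bounded support, and the smoothness of [f] off the origin suffices. *)
Lemma expR_profile_smooth f (d : R[i]) : test_function f ->
  let phi := fun v : R => profile f (expR v) * cexp (d * v%:C) in
  exists L phi1 phi2, [/\ 0 <= L, supported L phi, cderiv phi phi1,
    cderiv phi1 phi2 & ccontinuous phi2].
Proof.
move=> tf phi; have [a [b [a0 b0 fa fb]]] := profile_support tf.
have [/(_ 2%N)[/Ck_line[r1 [r2 hr]] /Ck_line[i1 [i2 hi]]] _] := tf.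
pose F1 t : R[i] := r1 t +i* i1 t; pose F2 t : R[i] := r2 t +i* i2 t.
pose P v := profile f (expR v); pose ex (v : R) : R[i] := (expR v)%:C.
pose P1 v := F1 (expR v) * ex v.
pose P2 v := F2 (expR v) * ex v * ex v + F1 (expR v) * ex v.
pose E v := cexp (d * v%:C).
have pos (t : R) : 0 < t -> t != 0 by move=> t0; rewrite gt_eqF.
have dP : cderiv P P1.
  by apply: cderiv_expR => t /pos t0; have [? _ _] := hr t t0; have [? _ _] := hi t t0.
have dF1 : cderiv (fun v => F1 (expR v)) (fun v => F2 (expR v) * ex v).
  by apply: cderiv_expR => t /pos t0; have [_ ? _] := hr t t0; have [_ ? _] := hi t t0.
have dex : cderiv ex ex by apply: cderiv_real => v; exact: is_derive_expR.
have dP1 : cderiv P1 P2 := cderivM dF1 dex.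
have dE : cderiv E (fun v => d * E v) := cderiv_cexp (cderiv_linear d).
have dc : cderiv (fun=> d) (fun=> 0) by move=> x; split; exact: is_derive_cst.
have dE2 := cderivM dc dE.
have cP := cderiv_continuous dP; have cP1 := cderiv_continuous dP1.
have cE := cderiv_continuous dE; have cex := cderiv_continuous dex.
have cd := @ccontinuous_cst R d.
have cF1 := cderiv_continuous dF1.
have cF2 : ccontinuous (fun v => F2 (expR v)).
  split=> v /=; have [_ _ c1] := hr _ (pos _ (expR_gt0 v));
    have [_ _ c2] := hi _ (pos _ (expR_gt0 v)).
  - exact: (cvg_comp _ _ (@continuous_expR R v) c1).
  - exact: (cvg_comp _ _ (@continuous_expR R v) c2).
exists (`|ln a| + `|ln b|), (fun v => P1 v * E v + P v * (d * E v)).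
exists (fun v => (P2 v * E v + P1 v * (d * E v)) +
  (P1 v * (d * E v) + P v * (0 * E v + d * (d * E v)))); split.
- by rewrite addr_ge0.
- move=> v Lv; rewrite /phi.
  suff -> : profile f (expR v) = 0 by rewrite mul0r.
  have [v0|v0] := leP 0 v.
    apply: fb; rewrite ger0_norm ?expR_ge0// -[ltLHS]lnK// ltr_expR.
    move: Lv; rewrite [`|v|]ger0_norm//; have := ler_norm (ln b).
    by have := normr_ge0 (ln a); lra.
  apply: fa; rewrite ger0_norm ?expR_ge0// -[ltRHS]lnK// ltr_expR.
  move: Lv; rewrite [`|v|]ltr0_norm//; have := ler_norm (- ln a); rewrite normrN.
  by have := normr_ge0 (ln b); lra.
- exact: cderivM.
- by apply: cderivD; apply: cderivM.
- have cE1 := ccontinuousM cd cE.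
  have cz : ccontinuous (fun v => 0 * E v + d * (d * E v)).
    by apply: ccontinuousD; apply: ccontinuousM => //; exact: ccontinuous_cst.
  have cP2 : ccontinuous P2.
    by apply: ccontinuousD; apply: ccontinuousM => //; apply: ccontinuousM.
  by apply: ccontinuousD; apply: ccontinuousD; apply: ccontinuousM.
Qed.

End regularity.

(** * The inversion formula *)

Section transform_value.
Variables (R : realType) (m : nat).
Local Notation mu := (@lebesgue_measure R).
Local Notation dim := (m.+1%:R : R[i]).

(** The Gaussian integral is the case [s = 0] of [gauss_power]. *)
Lemma euler_half : euler_integral (1 / 2) = (Num.sqrt pi : R)%:C.
Proof.
have s0 : complex.Re (0 : R[i]) < 1 by [].
have [_ h] := gauss_power s0; rewrite subr0 in h; rewrite -h.
under eq_fun do rewrite /rpow oppr0 mul0r cexp0 mul1r.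
by rewrite cintegral_real /Rintegral integralT_gauss.
Qed.

Lemma rpow_pi_half n : rpow (pi : R) (n%:R / 2) = (Num.sqrt pi ^+ n)%:C.
Proof.
have p0 : (0 : R) < pi by exact: pi_gt0.
have E : expR (ln (pi : R) / 2) = Num.sqrt pi.
  apply/eqP; rewrite -(@eqrXn2 _ 2)// ?expR_ge0 ?sqrtr_ge0//.
  by rewrite sqr_sqrtr ?ltW// -expRM_natl mulr_natl mulr2n -splitr lnK.
rewrite /rpow.
have -> : n%:R / 2 * (ln (pi : R))%:C = (ln (pi : R) / 2)%:C *+ n.
  by rewrite rmorphM /= fmorphV rmorph_nat -mulr_natl; ring.
by rewrite cexpX cexp_real E rmorphXn.
Qed.

(** At [eta = 0] the factor [1 + |eta| ^ 2] equals [1], so [ftilde lam] is the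
value at [lam] of the continued transform. *)
Lemma tilde_value (f : 'rV[R]_m.+1 -> R[i]) (ftilde : R -> R[i]) (lam : R) :
  test_function f -> orthogonal_invariant f -> is_tilde f ftilde -> lam != 0 ->
  ftilde lam = continued m (profile f) lam%:C.
Proof.
move=> tf inv ft lam0.
have gF := profile_gauss_dominated tf.
have [a [b [a0 _ fa _]]] := profile_support tf.
have F0 t : 0 < t < a -> profile f t = 0.
  by move=> /andP[t0 ta]; apply: fa; rewrite gtr0_norm.
have cont : is_T_continuation f 0 (continued m (profile f)).
  split.
  - by move=> z zm; rewrite T_integral0// continued_integral.
  - by move=> p; exact: (continued_meromorphic m gF a0 F0).
  - by move=> p; exact: (continued_analytic gF a0 F0).
have := ft lam 0 lam0.
have -> : 1 + dot (0 : 'rV[R]_m) 0 = 1.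
  by rewrite /dot big1 ?addr0// => i _; rewrite !mxE mul0r.
rewrite /rpow ln1 mulr0 cexp0 mulr1 => <-.
apply: (T_continuation_unique lam0 _ cont).
exact: (@xgetPex _ (fun=> 0) [set G | is_T_continuation f 0 G] (ex_intro _ _ cont)).
Qed.

End transform_value.

Unset Implicit Arguments.

(* The dimension is n = m.+1.  The integral is taken against d lambda / (2 pi)
   and the denominator is Gamma (- (2 i lambda + (n - 2)) / 4): with "/ 2" in
   place of "/ 4" the integral diverges for every f <> 0. *)
Theorem theorem4 (R : realType) (m : nat) (f : 'rV[R]_m.+1 -> R[i])
    (ftilde : R -> R[i]) (r : R) :
  test_function f ->
  orthogonal_invariant f ->
  is_tilde f ftilde ->
  0 < r ->
  let integrand := fun lam : R =>
    ftilde lam * rpow r ('i%C * lam%:C - m.+1%:R / 2) *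
    (cGamma ((- 2 * 'i%C * lam%:C + m.+1%:R) / 4) /
     cGamma (- (2 * 'i%C * lam%:C + (m.+1%:R - 2)) / 4)) in
  cintegrable (@lebesgue_measure R) setT integrand /\
  f (r *: 'e_0) =
    cGamma (1 / 2) / (2 * rpow pi (m.+1%:R / 2)) *
    ((2 * pi)^-1%:C * cintegral (@lebesgue_measure R) setT integrand).
Proof.
move=> tf inv ft r0 integrand.
pose d : R[i] := m.+1%:R / 2.
pose phi (v : R) := profile f (expR v) * cexp (d * v%:C).
have [L [phi1 [phi2 [L0 s0 d0 d1 c2]]]] := expR_profile_smooth d tf.
have [fi fe] := fourier_inversion L0 s0 d0 d1 c2 (ln r).
rewrite -/phi in fi fe.
(* Up to the constant [K] the quotient of Gamma factors in [integrand] cancels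
   the one in [continued], and the Fourier inversion integral of [phi] at [ln r]
   remains. *)
pose K : R[i] := 2 * (Num.sqrt pi ^+ m)%:C * cexp (- (d * (ln r)%:C)).
have E lam : lam != 0 ->
    integrand lam = K * (fourier phi lam * cexp ('i%C * lam%:C * (ln r)%:C)).
  move=> lam0; rewrite /integrand (tilde_value tf inv ft lam0) /continued.
  have eA : (m.+1%:R - spec m lam%:C) / 2 = (- 2 * 'i%C * lam%:C + m.+1%:R) / 4.
    by rewrite /spec; field.
  have eB : (1 - spec m lam%:C) / 2 = - (2 * 'i%C * lam%:C + (m.+1%:R - 2)) / 4.
    by rewrite /spec; field.
  have eM : mellin (profile f) (m.+1%:R - spec m lam%:C) = fourier phi lam.
    apply: eq_cintegral => v; rewrite /mellin_term /phi -mulrA -cexpD.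
    by congr (_ * cexp _); rewrite /spec /d; field.
  have eR : rpow r ('i%C * lam%:C - m.+1%:R / 2) =
      cexp (- (d * (ln r)%:C)) * cexp ('i%C * lam%:C * (ln r)%:C).
    by rewrite /rpow -cexpD; congr cexp; rewrite /d; ring.
  rewrite eM eR eA eB.
  set B := cGamma (- _ / _); set A := cGamma (_ / _).
  (* The argument has positive real part. *)
  have A0 : A != 0.
    apply: cGamma_neq0 => k; rewrite -eA; apply/eqP => /(congr1 (@complex.Re R)).
    rewrite ReD Re_nat ReV2 Re_dimB Re_spec /= subr0.
    have : (0 : R) < m.+1%:R by []. have : (0 : R) <= k%:R by []. lra.
  (* The argument is not real, since its imaginary part is [- lam / 2]. *)
  have B0 : B != 0.
    apply: cGamma_neq0 => k; rewrite -eB; apply/eqP => /(congr1 (@complex.Im R)).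
    rewrite ImD Im_nat addr0 ImV2 ImD ImN Im_spec [complex.Im 1]/= => h.
    by move/eqP : lam0; apply; move: h => /=; lra.
  by rewrite /K; field; rewrite A0 B0.
have [ii ie] := cintegral_off0 E (cintegrableZ K fi).
split => //.
have pi0 : (pi : R) != 0 by rewrite gt_eqF// pi_gt0.
rewrite ie cintegralZ// fe cGamma_euler; last first.
  by rewrite -[1 / 2]/(1 / 2 : R[i]) ReV2 divr_gt0.
rewrite euler_half rpow_pi_half /phi lnK// /K /profile.
set P := f _; set sq := Num.sqrt pi.
have sq0 : sq%:C != 0 :> R[i].
  by rewrite -cabs_gt0 cabs_real normr_gt0 gt_eqF// sqrtr_gt0 pi_gt0.
have p0 : (pi : R)%:C != 0 :> R[i] by rewrite -cabs_gt0 cabs_real normr_gt0.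
have c1 : cexp (- (d * (ln r)%:C)) * cexp (d * (ln r)%:C) = 1.
  by rewrite -cexpD addNr cexp0.
have sm : (sq%:C : R[i]) ^+ m != 0 by rewrite expf_neq0.
rewrite !fmorphV !rmorphM !rmorphXn /= rmorph_nat exprS.
transitivity (P * (cexp (- (d * (ln r)%:C)) * cexp (d * (ln r)%:C))).
  by rewrite c1 mulr1.
move: ((pi : R)%:C) (sq%:C) p0 sq0 sm => p q p0 q0 qm.
by field; rewrite p0 q0 qm.
Qed.
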